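(* Let $S:\ y=F(a,b,x)$ be a para-CR hypersurface of finite type $k>2$. For every $\ell>k$ there is a polynomial mapping (a product change of coordinates near the origin) that takes $F_\ell$ into normal form of order $\ell$ with respect to $b^mx^n$.
   Context: Coordinates on $\mathbb R^4=\mathbb R^2_{xy}\times\mathbb R^2_{ab}$ are $(x,y,a,b)$. Everything is local near the origin. A para-CR hypersurface is a smooth hypersurface $S:\ y=F(a,b,x)$ with $F(0,0,0)=0$ and $\frac{\partial F}{\partial a}(0,0,0)\neq0$, equipped with the two direction fields $TS\cap T\mathbb R^2_{xy}$ and $TS\cap T\mathbb R^2_{ab}$. $S$ is of finite type $k\ge2$ if $k$ is the smallest integer such that $\frac{\partial^kF}{\partial b^{p}\partial x^{q}}(0,0,0)\ne0$ for some $p,q>0$ with $p+q=k$. Weights: $x,b$ have weight $1$ and $y,a$ have weight $k$; a polynomial $P(a,b,x)$ has weight $\nu$ if $P(t^ka,tb,tx)=t^\nu P(a,b,x)$. The weighted $\ell$-jet $F_\ell$ of $F$ is the polynomial, consisting of terms of weight $\le\ell$, with $F(t^ka,tb,tx)=F_\ell(t^ka,tb,tx)+o(t^\ell)$ as $t\to0$. Standing form: coordinates are chosen so that, for every $\ell>k$, $$F_\ell(a,b,x)=a+b^mx^n+\sum_{j=m+1}^{k-1}\gamma_jb^jx^{k-j}+\sum_{\nu=k+1}^{\ell}P_\nu(a,b,x),$$ where $1\le m\le k-1$, $n=k-m$, $\gamma_j\in\mathbb R$, and $P_\nu$ is a polynomial of weight $\nu$; so $m$ is the smallest exponent of $b$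 occurring in the weight-$k$ part in $(b,x)$. Admissible mappings respect the product structure: $(x,y)\mapsto(X,Y)$ depends only on $(x,y)$ and $(a,b)\mapsto(A,B)$ depends only on $(a,b)$, both local diffeomorphisms fixing the origin. The image of $S$ is written $Y=F^*(A,B,X)$, and ''taking $F_\ell$ into normal form'' means that $F^*_\ell$ satisfies the following definition. $S$ is in normal form of order $\ell\ge k$ with respect to $b^mx^n$ if $F_k=a+b^mx^n+\sum_{j=m+1}^{k-1}\gamma_jb^jx^{k-j}$ and for every $k<\nu\le\ell$ the component $P_\nu$ contains no monomials (of weight $\nu$, with $i,j\ge0$ integers) of the types - $a^ix^j$, $a^ib^j$, with $ki+j=\nu$; - $a^ib^mx^{n-1+j}$, $a^ib^{m-1+j}x^n$, with $k(i+1)+j-1=\nu$; - $a^ib^{2m}x^{2n}$, $a^jb^{3m}x^{3n}$, with $k(i+2)=k(j+3)=\nu$; - $a^ibx^{2n}$, if $m=1$; - $a^ib^{2m}x$, if $n=1$. *)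

(* Defs.v *)
(* The real numbers are an arbitrary R : realType. *)
From mathcomp Require Import all_boot all_order all_algebra.
From mathcomp Require Import all_classical all_reals all_analysis.
(* The notations of mpoly conflict with those of normedtype. *)
From mathcomp Require Import -(notations) mpoly.

Set Implicit Arguments.
Unset Strict Implicit.
Unset Printing Implicit Defensive.

Import Order.TTheory GRing.Theory Num.Theory.
Import numFieldNormedType.Exports.
Local Open Scope classical_set_scope.
Local Open Scope ring_scope.

Local Notation "{ 'mpoly' T [ n ] }" := (mpoly n T)
  (at level 0, T, n at level 2).

(* Points of R^3 are listed in the order (a, b, x), points of the two factors
   of R^4 as (x, y) and (a, b). *)
Definition ia : 'I_3 := @Ordinal 3 0 isT.
Definition ib : 'I_3 := @Ordinal 3 1 isT.
Definition ix : 'I_3 := @Ordinal 3 2 isT.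

Definition fst2 : 'I_2 := @Ordinal 2 0 isT.
Definition snd2 : 'I_2 := @Ordinal 2 1 isT.

Definition pt3 (R : realType) (a b x : R) : 'rV[R]_3 :=
  \row_(i < 3) [:: a; b; x]`_i.

Section Smoothness.
Variable R : realType.

Definition partial n (i : 'I_n) (f : 'rV[R]_n -> R) : 'rV[R]_n -> R :=
  fun v => 'D_(delta_mx 0 i) f v.

Definition partials n (s : seq 'I_n) (f : 'rV[R]_n -> R) : 'rV[R]_n -> R :=
  foldr (@partial n) f s.

(* C^oo on a neighbourhood of the origin (one neighbourhood for all orders);
   the derivatives are total functions, so their existence is required. *)
Definition smooth0 n (f : 'rV[R]_n -> R) : Prop :=
  \forall v \near (0 : 'rV[R]_n), forall s : seq 'I_n,
    {for v, continuous (partials s f)} /\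
    forall i : 'I_n, derivable (partials s f) v (delta_mx 0 i).

Definition smooth_map0 n (f : 'rV[R]_n -> 'rV[R]_n) : Prop :=
  forall i : 'I_n, smooth0 (fun v => f v 0 i).

Definition local_diffeo0 n (f : 'rV[R]_n -> 'rV[R]_n) : Prop :=
  [/\ f 0 = 0, smooth_map0 f &
    exists g : 'rV[R]_n -> 'rV[R]_n,
      [/\ g 0 = 0, smooth_map0 g,
          \forall v \near (0 : 'rV[R]_n), g (f v) = v &
          \forall w \near (0 : 'rV[R]_n), f (g w) = w]].

End Smoothness.

Section Polynomials.
Variable R : realType.

Definition peval n (P : {mpoly R[n]}) (v : 'rV[R]_n) : R :=
  meval (fun i => v 0 i) P.

Definition polymap n (P : 'I_n -> {mpoly R[n]}) : 'rV[R]_n -> 'rV[R]_n :=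
  fun v => \row_(i < n) peval (P i) v.

Definition expo (i p q : nat) : multinom 3 :=
  Multinom [tuple i; p; q].

(* a^i b^p x^q *)
Definition mono (i p q : nat) : {mpoly R[3]} := mpolyX R (expo i p q).

End Polynomials.

Section ParaCR.
Variable R : realType.
Implicit Types F Fs : 'rV[R]_3 -> R.

Definition para_CR F : Prop :=
  [/\ smooth0 F, F 0 = 0 & partial ia F 0 != 0].

(* (p, q) = ((x, y), (a, b)) lies on S : y = F(a, b, x). *)
Definition on_hypersurface F (p q : 'rV[R]_2) : Prop :=
  p 0 snd2 = F (pt3 (q 0 fst2) (q 0 snd2) (p 0 fst2)).

(* Near the origin, phi x psi maps {y = F(a,b,x)} onto {Y = Fs(A,B,X)}; for
   local diffeomorphisms phi and psi this is equality of germs of sets. *)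
Definition is_image (phi psi : 'rV[R]_2 -> 'rV[R]_2) F Fs : Prop :=
  \forall p \near (0 : 'rV[R]_2) & q \near (0 : 'rV[R]_2),
    on_hypersurface F p q <-> on_hypersurface Fs (phi p) (psi q).

Definition mixed_derivative_nonzero F (k : nat) : Prop :=
  exists p q : nat, [/\ (0 < p)%N, (0 < q)%N, (p + q = k)%N &
    partials (nseq p ib ++ nseq q ix) F 0 != 0].

Definition finite_type F (k : nat) : Prop :=
  mixed_derivative_nonzero F k /\
  forall k' : nat, mixed_derivative_nonzero F k' -> (k <= k')%N.

Variable k : nat.

Definition dilation (t : R) (v : 'rV[R]_3) : 'rV[R]_3 :=
  pt3 (t ^+ k * v 0 ia) (t * v 0 ib) (t * v 0 ix).

Definition has_weight (nu : nat) (P : {mpoly R[3]}) : Prop :=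
  forall (t : R) (v : 'rV[R]_3),
    peval P (dilation t v) = t ^+ nu * peval P v.

Definition mono_weight (e : multinom 3) : nat := (k * e ia + e ib + e ix)%N.

(* P is the weighted l-jet of F. *)
Definition is_weighted_jet (l : nat) F (P : {mpoly R[3]}) : Prop :=
  (forall e, mcoeff e P != 0 -> (mono_weight e <= l)%N) /\
  (forall v : 'rV[R]_3,
    (fun t : R => F (dilation t v) - peval P (dilation t v))
      =o_ ((0 : R)^') (fun t : R => t ^+ l)).

Variables m n : nat.
Variable gamma : nat -> R.

Definition model : {mpoly R[3]} :=
  mono R 1 0 0 + mono R 0 m n
  + \sum_(m.+1 <= j < k) gamma j *: mono R 0 j (k - j).

Definition standing_form F : Prop :=
  exists P : nat -> {mpoly R[3]},
    (forall nu, (k < nu)%N -> has_weight nu (P nu)) /\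
    (forall l, (k < l)%N ->
      is_weighted_jet l F (model + \sum_(k.+1 <= nu < l.+1) P nu)).

(* excluded nu i p q : a^i b^p x^q may not occur in the component of
   weight nu. *)
Inductive excluded (nu : nat) : nat -> nat -> nat -> Prop :=
| excl_ax i j of (k * i + j = nu)%N : excluded nu i 0 j
| excl_ab i j of (k * i + j = nu)%N : excluded nu i j 0
| excl_bm i j of (k * (i + 1) + j - 1 = nu)%N : excluded nu i m (n - 1 + j)
| excl_xn i j of (k * (i + 1) + j - 1 = nu)%N : excluded nu i (m - 1 + j) n
| excl_2 i of (k * (i + 2) = nu)%N : excluded nu i (2 * m) (2 * n)
| excl_3 i of (k * (i + 3) = nu)%N : excluded nu i (3 * m) (3 * n)
| excl_m1 i of m = 1%N & (k * i + 1 + 2 * n = nu)%N : excluded nu i 1 (2 * n)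
| excl_n1 i of n = 1%N & (k * i + 2 * m + 1 = nu)%N : excluded nu i (2 * m) 1.

Definition normal_form (l : nat) F : Prop :=
  exists P : nat -> {mpoly R[3]},
    [/\ is_weighted_jet k F model,
        (forall nu, (k < nu <= l)%N -> has_weight nu (P nu)),
        is_weighted_jet l F (model + \sum_(k.+1 <= nu < l.+1) P nu) &
        (forall nu i p q, (k < nu <= l)%N -> excluded nu i p q ->
           mcoeff (expo i p q) (P nu) = 0)].

End ParaCR.

(* Main.v *)
Require Import Defs.
From HB Require Import structures.
From mathcomp Require Import all_boot all_order all_algebra.
From mathcomp Require Import all_classical all_reals all_analysis.
From mathcomp Require Import -(notations) mpoly.
From mathcomp Require Import ring lra zify.

(** Give x, b weight 1 and y, a weight k, and let M = a + q(b, x) be the model.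
    The normal form is reached one weight nu > k at a time. If F agrees with
    M + N up to weight nu - 1, where N is already normal, and P is its component
    of weight nu, one changes coordinates by
      X = x + f(x, y),  Y = y + g(x, y),  A = a + h(a, b),  B = b + e(a, b)
    with g, h of weight nu and f, e of weight nu - k + 1. The terms of weight
    less than nu do not move, and P becomes
      P + g(x, M) - h(a, b) - M_b e(a, b) - M_x f(x, M)
    (jet_equation, normalized_image).

    The algebraic heart is that f, g, h, e can be chosen so that this expression
    contains no excluded monomial (normalizable_homogeneous). It suffices to
    write every monomial of weight nu as a combination of non-excluded ones and
    of values of the operator, by induction on the degree in a. At a given degree
    in a, g = y^i x^d yields a^i x^d, h = a^i b^d yields itself, e = a^i b^s
    yields a^i b^(m-1+s) x^n and f = y^i x^s yields a^i b^m x^(n-1+s), each up to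
    monomials with fewer a or more b. This elimination breaks down only if
    nu = k N: then e = b a^(N-1) and f = x y^(N-1) have the same leading monomial
    u_1, where u_r = a^(N-r) b^(rm) x^(rn). The two parameters which are left, the
    coefficients of g = y^N and f = x y^(N-1), give
      C(N,2) u_2 + C(N,3) u_3  and  (N-1) n u_2 + C(N-1,2) n u_3,
    and the determinant of these two relations is n N (N-1)^2 (N-2) / 12; for
    N = 2 there is no u_3, and the first relation settles u_2. This is where the
    exclusion of b^(2m) x^(2n) and b^(3m) x^(3n) comes from.

    The analytic part makes the formal computation one about germs. Errors are
    measured by wO, the functions which are O(t^j) on the boxes |a| <= t^k,
    |b| <= t, |x| <= t. A map which is the identity up to terms of higher weight
    has a unipotent Jacobian at 0, hence a smooth local inverse
    (inverse_function, unipotent_local_diffeo), and this inverse preserves the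
    orders wO (wO_inverse). On S one has (A, B, X) = H(a, b, x) for such a map H,
    so the image of S is again a graph, of a function composed with the inverse
    of H (exists_image). Taylor polynomials (taylor) and their uniqueness with
    respect to weights (small_polynomial) provide the next component P. *)

Set Implicit Arguments.
Unset Strict Implicit.
Unset Printing Implicit Defensive.

Import Order.TTheory GRing.Theory Num.Theory.
Import numFieldNormedType.Exports.
Local Open Scope classical_set_scope.
Local Open Scope ring_scope.

(** * Mean values and the chain rule *)

Section MeanValue.
Variable R : realType.

Lemma coord_le_norm n (v : 'rV[R]_n) i : `|v 0 i| <= `|v|.
Proof.
rewrite [leRHS]/Num.Def.normr/= mx_normrE.
exact: (le_bigmax _ (fun j : 'I_1 * 'I_n => `|v j.1 j.2|) (0, i)).
Qed.

Lemma norm_le_coord n (v : 'rV[R]_n) c :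
  0 <= c -> (forall i, `|v 0 i| <= c) -> `|v| <= c.
Proof.
move=> c0 h; rewrite /Num.Def.normr/= mx_normrE bigmax_le//= => -[i j] _ /=.
by rewrite ord1.
Qed.

Lemma norm_lt_coord n (v : 'rV[R]_n) c :
  0 < c -> (forall i, `|v 0 i| < c) -> `|v| < c.
Proof.
move=> c0 h; rewrite /Num.Def.normr/= mx_normrE bigmax_lt//= => -[i j] _ /=.
by rewrite ord1.
Qed.

Definition dir n (i : 'I_n) : 'rV[R]_n := delta_mx 0 i.

Lemma growth_line n (f : 'rV[R]_n -> R) (v e : 'rV[R]_n) (t h : R) :
  h^-1 *: (f (v + (h *: 1 + t) *: e) - f (v + t *: e))
  = h^-1 *: (f (h *: e + (v + t *: e)) - f (v + t *: e)).
Proof.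
by congr (_ *: (f _ - _)); rewrite [h *: 1]mulr1 scalerDl addrCA.
Qed.

Lemma is_derive_line n (f : 'rV[R]_n -> R) (v e : 'rV[R]_n) (t : R) :
  derivable f (v + t *: e) e ->
  is_derive t 1 (fun s => f (v + s *: e)) ('D_e f (v + t *: e)).
Proof.
move=> df.
have E : (fun h : R => h^-1 *: (((fun s => f (v + s *: e)) \o shift t) (h *: 1)
      - f (v + t *: e))) =
  (fun h : R => h^-1 *: ((f \o shift (v + t *: e)) (h *: e) - f (v + t *: e))).
  by apply/funext => h /=; rewrite growth_line.
split; first by rewrite /derivable E.
by rewrite /derive E.
Qed.

Lemma mvt_coord n (f : 'rV[R]_n -> R) (v e : 'rV[R]_n) (c : R) :
  (forall t, `|t| <= `|c| -> derivable f (v + t *: e) e) ->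
  exists2 t, `|t| <= `|c| & f (v + c *: e) - f v = 'D_e f (v + t *: e) * c.
Proof.
move=> df.
have ct (a b : R) : (forall t, a <= t <= b -> `|t| <= `|c|) ->
    {within `[a, b], continuous (fun s => f (v + s *: e))}.
  move=> h; apply: derivable_within_continuous => t; rewrite in_itv/= => /h/df.
  by move=> /is_derive_line[].
have f0 : f v = f (v + 0 *: e) by rewrite scale0r addr0.
have [c0|c0] := leP 0 c.
- have hh t : 0 <= t <= c -> `|t| <= `|c|.
    by case/andP => t0 tc; rewrite !ger0_norm.
  have [|t|t tI E] := MVT_segment c0 (f := fun s => f (v + s *: e))
      (df := fun s => 'D_e f (v + s *: e)).
  + move=> t tI; apply/is_derive_line/df/hh.
    by move: tI; rewrite in_itv/= => /andP[/ltW -> /ltW ->].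
  + exact: ct hh t.
  + exists t; first by apply: hh; move: tI; rewrite in_itv.
    by rewrite f0 E subr0.
- have hh t : c <= t <= 0 -> `|t| <= `|c|.
    by case/andP => t0 tc; rewrite !ler0_norm ?lerN2 ?(ltW c0).
  have [|t|t tI E] := MVT_segment (ltW c0) (f := fun s => f (v + s *: e))
      (df := fun s => 'D_e f (v + s *: e)).
  + move=> t tI; apply/is_derive_line/df/hh.
    by move: tI; rewrite in_itv/= => /andP[/ltW -> /ltW ->].
  + exact: ct hh t.
  + exists t; first by apply: hh; move: tI; rewrite in_itv.
    rewrite -opprB f0 E; ring.
Qed.

(** The path from x to x' that changes one coordinate at a time stays, for the
    sup norm, in the closed ball around x through x'. The lemma takes the place
    of differentials: it only involves partial derivatives. *)
Lemma mean_value n (f : 'rV[R]_n -> R) (x x' : 'rV[R]_n) :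
  (forall y, `|y - x| <= `|x' - x| -> forall i, derivable f y (dir i)) ->
  exists2 xi : 'I_n -> 'rV[R]_n,
    forall i, `|xi i - x| <= `|x' - x| &
    f x' - f x = \sum_i partial i f (xi i) * (x' 0 i - x 0 i).
Proof.
move=> df.
(* the j-th vertex of the path: the first j coordinates are those of x' *)
pose p j : 'rV[R]_n := \row_i (if (i < j)%N then x' 0 i else x 0 i).
have pS (j : 'I_n) t : `|t| <= `|x' 0 j - x 0 j| ->
    `|p j + t *: dir j - x| <= `|x' - x|.
  move=> ht; apply: norm_le_coord => // i; rewrite !mxE eqxx/=.
  have [->|ij] := eqVneq i j.
    rewrite ltnn mulr1 addrAC subrr add0r (le_trans ht)//.
    by have := coord_le_norm (x' - x) j; rewrite !mxE.
  rewrite mulr0 addr0; case: ifP => _.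
    by have := coord_le_norm (x' - x) i; rewrite !mxE.
  by rewrite subrr normr0.
have step (j : 'I_n) : exists y : 'rV[R]_n, `|y - x| <= `|x' - x| /\
    f (p j.+1) - f (p j) = partial j f y * (x' 0 j - x 0 j).
  have [t /pS ht E] := @mvt_coord n f (p j) (dir j) (x' 0 j - x 0 j)
     (fun t h => df _ (pS j t h) j).
  exists (p j + t *: dir j); split => //.
  rewrite -E; congr (f _ - _); apply/rowP => i; rewrite !mxE eqxx/= ltnS.
  have [->|ij] := eqVneq i j; first by rewrite leqnn ltnn mulr1 addrC subrK.
  by rewrite mulr0 addr0 leq_eqVlt -[(i : nat) == j]/(i == j) (negbTE ij).
have [xi hxi] := choice step.
exists xi => [i|]; first by case: (hxi i).
have -> : f x' - f x = \sum_(0 <= j < n) (f (p j.+1) - f (p j)).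
  rewrite telescope_sumr//; congr (f _ - f _); apply/rowP => i.
    by rewrite mxE ltn_ord.
  by rewrite mxE.
by rewrite big_mkord; apply: eq_bigr => i _; case: (hxi i).
Qed.

End MeanValue.

Section ChainRule.
Variable R : realType.

Lemma continuous_coord n p (G : 'rV[R]_p -> 'rV[R]_n) v :
  (forall j, {for v, continuous (fun u => G u 0 j)}) -> {for v, continuous G}.
Proof.
move=> cG; apply/(@cvgrPdist_lt _ _ _ _ (nbhs_filter v)) => e e0.
suff : \forall u \near v, forall j, `|G v 0 j - G u 0 j| < e.
  apply: filterS => u h; apply: norm_lt_coord => // j.
  by have := h j; rewrite !mxE.
apply: (@filter_forall _ _ _ _ (nbhs_filter v)) => j.
by have /cvgrPdist_lt := cG j; apply.
Qed.

Lemma line_cvg n (v e : 'rV[R]_n) : (h *: e + v) @[h --> 0^'] --> v.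
Proof.
suff : (h *: e + v) @[h --> 0^'] --> 0 *: e + v by rewrite scale0r add0r.
apply: cvg_within_filter; apply: cvgD; last exact: cvg_cst.
by apply: cvgZr_tmp; exact: cvg_id.
Qed.

Lemma derivable_line_cvg n (f : 'rV[R]_n -> R) (v e : 'rV[R]_n) :
  derivable f v e -> f (h *: e + v) @[h --> 0^'] --> f v.
Proof.
move=> /derivable1P/derivable1_diffP/differentiable_continuous => h.
suff : f (h *: e + v) @[h --> 0^'] --> f (0 *: e + v).
  by rewrite scale0r add0r.
by apply: cvg_within_filter; exact: h.
Qed.

Lemma cvg_fsum (T I : Type) (F : set_system T) (FF : Filter F) (r : seq I)
    (f : I -> T -> R) (l : I -> R) :
  (forall i, f i t @[t --> F] --> l i) ->
  (\sum_(i <- r) f i t) @[t --> F] --> \sum_(i <- r) l i.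
Proof.
move=> h; elim: r => [|i r IH].
  rewrite big_nil; under eq_fun do rewrite big_nil; exact: cvg_cst.
rewrite big_cons; under eq_fun do rewrite big_cons; exact: cvgD.
Qed.

(** By the mean value formula the difference quotient of f \o G is a sum of
    products, each of which converges since the intermediate points tend to G v. *)
Lemma chain_rule n p (f : 'rV[R]_n -> R) (G : 'rV[R]_p -> 'rV[R]_n) v e :
  (\forall y \near G v, forall i, derivable f y (dir R i)) ->
  (forall i, {for G v, continuous (partial i f)}) ->
  (forall j, derivable (fun u => G u 0 j) v e) ->
  is_derive v e (f \o G)
    (\sum_j partial j f (G v) * 'D_e (fun u => G u 0 j) v).
Proof.
move=> df cf dG.
have cG : G (h *: e + v) @[h --> 0^'] --> G v.
  apply/cvgrPdist_lt => d d0.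
  suff : \forall h \near 0^', forall j, `|G v 0 j - G (h *: e + v) 0 j| < d.
    apply: filterS => u h; apply: norm_lt_coord => // j.
    by have := h j; rewrite !mxE.
  apply: filter_forall => j.
  by have /cvgrPdist_lt := derivable_line_cvg (dG j); apply.
have [r /= r0 hr] := (nbhs_ballP _ _).1 df.
have near_r : \forall h \near 0^', `|G v - G (h *: e + v)| < r.
  by move/cvgrPdist_lt : cG; apply.
have ex h : exists xi : 'I_n -> 'rV[R]_n,
   `|G v - G (h *: e + v)| < r ->
   (forall i, `|xi i - G v| <= `|G (h *: e + v) - G v|) /\
    f (G (h *: e + v)) - f (G v) =
    \sum_i partial i f (xi i) * (G (h *: e + v) 0 i - G v 0 i).
  have [hlt|] := ltP `|G v - G (h *: e + v)| r; last by exists (fun=> 0).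
  have [|xi h1 h2] := @mean_value R n f (G v) (G (h *: e + v)).
    move=> y hy i; apply: (hr y); rewrite -ball_normE /ball_/= distrC.
    by apply: le_lt_trans hy _; rewrite distrC.
  by exists xi.
have [xi hxi] := choice ex.
have cxi i : xi h i @[h --> 0^'] --> G v.
  apply/cvgrPdist_lt => d d0.
  have near_d : \forall h \near 0^', `|G v - G (h *: e + v)| < d.
    by move/cvgrPdist_lt : cG; apply.
  near=> h.
  have h1 : `|G v - G (h *: e + v)| < r by near: h.
  have h2 : `|G v - G (h *: e + v)| < d by near: h.
  have [h3 _] := hxi h h1.
  by rewrite distrC; apply: le_lt_trans (h3 i) _; rewrite distrC.
set L := \sum_j _.
have cL : h^-1 *: ((f \o G \o shift v) (h *: e) - (f \o G) v) @[h --> 0^'] --> L.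
  have : (\sum_i partial i f (xi h i) * (h^-1 *: (G (h *: e + v) 0 i - G v 0 i)))
      @[h --> 0^'] --> L.
    apply: cvg_fsum => i; apply: cvgM; last exact: (dG i).
    by apply: continuous_cvg => //; exact: cf.
  apply: cvg_trans; apply: near_eq_cvg.
  apply: filterS near_r => h /hxi [_ /= ->].
  rewrite scaler_sumr; apply: eq_bigr => i _.
  by rewrite /GRing.scale/=; ring.
split; first by apply/cvg_ex; exists L.
by apply/cvg_lim => //; exact: cL.
Unshelve. all: by end_near. Qed.

End ChainRule.

(** * Functions of class C^r *)

Section ClassCr.
Variable R : realType.

(** The innermost partial derivative is peeled off first, whence closure
    properties are inductions on r with the usual differentiation rules. *)
Fixpoint Cr n r (U : set 'rV[R]_n) (f : 'rV[R]_n -> R) : Prop :=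
  if r is r'.+1 then
    [/\ forall v, U v -> {for v, continuous f},
        forall v, U v -> forall i, derivable f v (dir R i) &
        forall i, Cr r' U (partial i f)]
  else forall v, U v -> {for v, continuous f}.

Section OneDomain.
Variables (n : nat) (U : set 'rV[R]_n).
Implicit Types f g : 'rV[R]_n -> R.

Lemma Cr_continuous r f : Cr r U f -> forall v, U v -> {for v, continuous f}.
Proof. by case: r => // r []. Qed.

Lemma Cr_le r r' f : (r' <= r)%N -> Cr r U f -> Cr r' U f.
Proof.
elim: r' r f => [|r' IH] [|r] f //= h; first by case.
by case=> fc fd fp; split => // i; exact: IH (fp i).
Qed.

Lemma CrS (V : set 'rV[R]_n) r f : V `<=` U -> Cr r U f -> Cr r V f.
Proof.
move=> VU; elim: r f => [|r IH] f /=; first by move=> h v /VU; exact: h.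
by case=> fc fd fp; split => [v /VU/fc//|v /VU/fd//|i]; exact/IH/fp.
Qed.

Hypothesis Uo : open U.

Lemma eq_Cr r f g : (forall v, U v -> f v = g v) -> Cr r U f -> Cr r U g.
Proof.
have near_eq (f' g' : 'rV[R]_n -> R) v : (forall v, U v -> f' v = g' v) -> U v ->
    {near v, f' =1 g'}.
  move=> fg Uv; have := open_nbhs_nbhs (conj Uo Uv).
  by apply: filterS => u /fg.
have ctE f' g' : (forall v, U v -> f' v = g' v) ->
    (forall v, U v -> {for v, continuous f'}) ->
    forall v, U v -> {for v, continuous g'}.
  move=> fg h v Uv; rewrite /prop_for /continuous_at -(fg _ Uv).
  apply: cvg_trans (h v Uv); apply: (@near_eq_cvg _ _ _ (nbhs_filter v)).
  exact: near_eq.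
elim: r f g => [|r IH] f g fg /=; first exact: ctE.
case=> fc fd fp; split; first exact: ctE fc.
  move=> v Uv i; exact: near_eq_derivable (near_eq _ _ _ fg Uv) (fd v Uv i).
move=> i; apply: IH (fp i) => v Uv; exact: near_eq_derive (near_eq _ _ _ fg Uv).
Qed.

Lemma Cr_cst r c : Cr r U (fun=> c).
Proof.
elim: r c => [|r IH] c /=; first by move=> v _; exact: cst_continuous.
split; [by move=> v _; exact: cst_continuous | by move=> v _ i; exact: derivable_cst |].
move=> i; have -> : partial i (fun=> c) = fun=> 0.
  by apply/funext => v; rewrite /partial derive_cst.
exact: IH.
Qed.

Lemma derive_coord i (v e : 'rV[R]_n) :
  is_derive v e (fun u : 'rV[R]_n => u 0 i) (e 0 i).
Proof.
have D : derivable (fun u : 'rV[R]_n => u) v e by exact: derivable_id.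
have DE := derive_mx D.
split; first exact: ((derivable_mxP _ _ _).1 D 0 i).
have := congr1 (fun M : 'rV[R]_n => M 0 i) DE; rewrite mxE => <-.
by rewrite derive_id.
Qed.

Lemma continuous_coordinate i (v : 'rV[R]_n) :
  {for v, continuous (fun u : 'rV[R]_n => u 0 i)}.
Proof. exact: coord_continuous. Qed.

Lemma Cr_coord r i : Cr r U (fun u => u 0 i).
Proof.
case: r => [|r] /=; first by move=> v _; exact: continuous_coordinate.
split; first by move=> v _; exact: continuous_coordinate.
  by move=> v _ j; have [] := derive_coord i v (dir R j).
move=> j; have -> : partial j (fun u : 'rV[R]_n => u 0 i) = fun=> dir R j 0 i.
  by apply/funext => v; rewrite /partial; have [_ ->] := derive_coord i v (dir R j).
exact: Cr_cst.
Qed.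

Lemma CrD r f g : Cr r U f -> Cr r U g -> Cr r U (fun v => f v + g v).
Proof.
elim: r f g => [|r IH] f g /=.
  by move=> hf hg v Uv; apply: continuousD; [exact: hf|exact: hg].
case=> fc fd fp [gc gd gp]; split.
- by move=> v Uv; apply: continuousD; [exact: fc|exact: gc].
- by move=> v Uv i; apply: derivableD; [exact: fd|exact: gd].
- move=> i; apply: eq_Cr (IH _ _ (fp i) (gp i)) => v Uv.
  by rewrite /partial [RHS](deriveD (fd v Uv i) (gd v Uv i)).
Qed.

Lemma CrM r f g : Cr r U f -> Cr r U g -> Cr r U (fun v => f v * g v).
Proof.
elim: r f g => [|r IH] f g /=.
  by move=> hf hg v Uv; apply: continuousM; [exact: hf|exact: hg].
move=> hf hg.
have hf' : Cr r U f by apply: (@Cr_le r.+1).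
have hg' : Cr r U g by apply: (@Cr_le r.+1).
case: hf hg => fc fd fp [gc gd gp]; split.
- by move=> v Uv; apply: continuousM; [exact: fc|exact: gc].
- by move=> v Uv i; apply: derivableM; [exact: fd|exact: gd].
- move=> i.
  apply: eq_Cr (CrD (IH _ _ hf' (gp i)) (IH _ _ hg' (fp i))) => v Uv.
  by rewrite /partial [RHS](deriveM (fd v Uv i) (gd v Uv i)).
Qed.

Lemma CrN r f : Cr r U f -> Cr r U (fun v => - f v).
Proof.
move=> h; have := CrM (Cr_cst r (-1)) h; apply: eq_Cr => v _.
by rewrite mulN1r.
Qed.

Lemma Cr_sum (I : Type) r (s : seq I) (f : I -> 'rV[R]_n -> R) :
  (forall i, Cr r U (f i)) -> Cr r U (fun v => \sum_(i <- s) f i v).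
Proof.
move=> h; elim: s => [|i s IH].
  by apply: eq_Cr (Cr_cst r 0) => v _; rewrite big_nil.
by apply: eq_Cr (CrD (h i) IH) => v _; rewrite big_cons.
Qed.

Lemma Cr_prod (I : Type) r (s : seq I) (f : I -> 'rV[R]_n -> R) :
  (forall i, Cr r U (f i)) -> Cr r U (fun v => \prod_(i <- s) f i v).
Proof.
move=> h; elim: s => [|i s IH].
  by apply: eq_Cr (Cr_cst r 1) => v _; rewrite big_nil.
by apply: eq_Cr (CrM (h i) IH) => v _; rewrite big_cons.
Qed.

Lemma CrX r f p : Cr r U f -> Cr r U (fun v => f v ^+ p).
Proof.
move=> h; elim: p => [|p IH].
  by apply: eq_Cr (Cr_cst r 1) => v _; rewrite expr0.
by apply: eq_Cr (CrM h IH) => v _; rewrite exprS.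
Qed.

Lemma Cr_inv r f : (forall v, U v -> f v != 0) ->
  Cr r U f -> Cr r U (fun v => (f v)^-1).
Proof.
move=> f0; elim: r => [|r IH] /=.
  by move=> hf v Uv; apply: continuousV; [exact: f0|exact: hf].
move=> hf; have hf' : Cr r U f by apply: (@Cr_le r.+1).
case: hf => fc fd fp; split.
- by move=> v Uv; apply: continuousV; [exact: f0|exact: fc].
- by move=> v Uv i; apply: derivableV; [exact: f0|exact: fd].
- move=> i; apply: eq_Cr (CrN (CrM (CrX 2 (IH hf')) (fp i))) => v Uv.
  rewrite /partial [RHS](deriveV (f0 v Uv) (fd v Uv i)) exprVn.
  by rewrite /GRing.scale/= mulNr.
Qed.

Lemma Cr_det r d (A : 'rV[R]_n -> 'M[R]_d) :
  (forall i j, Cr r U (fun v => A v i j)) -> Cr r U (fun v => \det (A v)).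
Proof.
move=> h; rewrite /determinant; apply: Cr_sum => s; apply: CrM; first exact: Cr_cst.
by apply: Cr_prod => i.
Qed.

(** Cramer's rule: the entries are cofactors divided by the determinant. *)
Lemma Cr_invmx r d (A : 'rV[R]_n -> 'M[R]_d) :
  (forall v, U v -> A v \in unitmx) ->
  (forall i j, Cr r U (fun v => A v i j)) ->
  forall i j, Cr r U (fun v => invmx (A v) i j).
Proof.
move=> uA h i j.
have h1 : Cr r U (fun v => (\det (A v))^-1).
  apply: Cr_inv (Cr_det h) => v /uA; by rewrite unitmxE unitfE.
have h2 : Cr r U (fun v => cofactor (A v) j i).
  rewrite /cofactor; apply: CrM; first exact: Cr_cst.
  by apply: Cr_det => k l; apply: eq_Cr (h (lift j k) (lift i l)) => v _; rewrite !mxE.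
apply: eq_Cr (CrM h1 h2) => v /uA uAv.
by rewrite /invmx uAv !mxE.
Qed.

End OneDomain.

(** The chain rule expresses the partial derivatives of f \o G through
    compositions with G of functions that are one order less regular. *)
Lemma Cr_comp n p r (U : set 'rV[R]_p) (V : set 'rV[R]_n)
    (f : 'rV[R]_n -> R) (G : 'rV[R]_p -> 'rV[R]_n) :
  open U -> open V -> (forall u, U u -> V (G u)) ->
  (forall j, Cr r U (fun u => G u 0 j)) -> Cr r V f -> Cr r U (f \o G).
Proof.
move=> Uo Vo UV.
have ct (f' : 'rV[R]_n -> R) : (forall j u, U u -> {for u, continuous (fun u => G u 0 j)}) ->
    (forall v, V v -> {for v, continuous f'}) ->
    forall u, U u -> {for u, continuous (f' \o G)}.
  move=> cG cf u Uu.
  have h1 : {for u, continuous G} by apply: continuous_coord => j; exact: cG.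
  exact: (@continuous_comp _ _ _ G f' u h1 (cf _ (UV _ Uu))).
elim: r f => [|r IH] f hG hf; first exact: ct.
have hG' j : Cr r U (fun u => G u 0 j) by apply: Cr_le (hG j).
have [fc fd fp] := hf.
have chain u e (Uu : U u) (dG : forall j, derivable (fun u => G u 0 j) u e) :
   is_derive u e (f \o G) (\sum_j partial j f (G u) * 'D_e (fun u => G u 0 j) u).
  apply: chain_rule => //.
    have := open_nbhs_nbhs (conj Vo (UV _ Uu)).
    by apply: filterS => v /fd.
  by move=> i; apply: (Cr_continuous (fp i)); exact: UV.
have dG u i (Uu : U u) j : derivable (fun u => G u 0 j) u (dir R i).
  by case: (hG j) => _ + _; apply.
split.
- apply: ct => // j; exact: Cr_continuous (hG j).
- by move=> u Uu i; case: (chain u (dir R i) Uu (fun j => dG u i Uu j)).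
- move=> i.
  have : Cr r U (fun u => \sum_j partial j f (G u) * partial i (fun u => G u 0 j) u).
    apply: Cr_sum => // j; apply: CrM => //; first exact: (IH _ hG' (fp j)).
    by case: (hG j) => _ _; apply.
  apply: eq_Cr => // u Uu; rewrite [RHS]/partial.
  by case: (chain u (dir R i) Uu (fun j => dG u i Uu j)) => _ ->.
Qed.

Lemma Cr_of_partials n (U : set 'rV[R]_n) (f : 'rV[R]_n -> R) :
  (forall v, U v -> forall s : seq 'I_n, {for v, continuous (partials s f)} /\
    forall i, derivable (partials s f) v (delta_mx 0 i)) ->
  forall r, Cr r U f.
Proof.
move=> h r; elim: r f h => [|r IH] f h /=; first by move=> v /h/(_ [::])[].
split; [by move=> v /h/(_ [::])[]|by move=> v /h/(_ [::])[]|].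
move=> i; apply: IH => v /h hv s; have := hv (rcons s i).
by rewrite /partials foldr_rcons.
Qed.

Lemma partials_of_Cr n (U : set 'rV[R]_n) (f : 'rV[R]_n -> R) s :
  (forall r, Cr r U f) -> forall r, Cr r U (partials s f).
Proof.
elim/last_ind: s f => [//|s i IH] f hf.
rewrite /partials foldr_rcons; apply: IH => r.
by have [_ _] := hf r.+1; apply.
Qed.

(** Reduces smoothness at the origin to the classes C^r on a single open set. *)
Lemma smooth0P n (f : 'rV[R]_n -> R) :
  smooth0 f <-> exists U : set 'rV[R]_n, [/\ open U, U 0 & forall r, Cr r U f].
Proof.
split.
- move=> /nbhs_interior h.
  exists (interior [set v : 'rV[R]_n | forall s : seq 'I_n,
    {for v, continuous (partials s f)} /\
    forall i, derivable (partials s f) v (delta_mx 0 i)]).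
  split; [exact: open_interior|exact: nbhs_singleton h|].
  by apply: Cr_of_partials => v /interior_subset.
- case=> U [Uo U0 hf]; have := open_nbhs_nbhs (conj Uo U0).
  apply: filterS => v Uv s.
  have := partials_of_Cr s hf.
  by move=> /(_ 1%N)[h1 h2 _]; split; [exact: h1|exact: h2].
Qed.

End ClassCr.

(** * The inverse function theorem *)

(** Completeness of row vectors, for the Banach fixed point theorem. *)
HB.instance Definition _ (R : realType) (n : nat) :=
  Uniform_isComplete.Build 'rV[R]_n (@mx_complete R 1 n).

Section InverseFunction.
Variable R : realType.

Lemma nearP_norm n (x : 'rV[R]_n) (P : 'rV[R]_n -> Prop) :
  (\forall v \near x, P v) <->
  exists2 r : R, 0 < r & forall v, `|v - x| < r -> P v.
Proof.
split=> [/nbhs_ballP[r /= r0 h]|[r r0 h]].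
  by exists r => // v hv; apply: h; rewrite -ball_normE /ball_/= distrC.
apply/nbhs_ballP; exists r => //= v; rewrite -ball_normE /ball_/= distrC.
exact: h.
Qed.

Lemma near0P_norm n (P : 'rV[R]_n -> Prop) :
  (\forall v \near (0 : 'rV[R]_n), P v) <->
  exists2 r : R, 0 < r & forall v, `|v| < r -> P v.
Proof.
split=> [/nearP_norm[r r0 h]|[r r0 h]].
  by exists r => // v hv; apply: h; rewrite subr0.
by apply/nearP_norm; exists r => // v; rewrite subr0; exact: h.
Qed.

Lemma norm_mulmx_le n (u : 'rV[R]_n) (M : 'M[R]_n) c :
  0 <= c -> (forall i j, `|M i j| <= c) -> `|u *m M| <= n%:R * c * `|u|.
Proof.
move=> c0 h; apply: norm_le_coord => [|j]; first by rewrite !mulr_ge0.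
rewrite mxE (le_trans (ler_norm_sum _ _ _))//.
have -> : n%:R * c * `|u| = \sum_(i < n) (`|u| * c).
  by rewrite sumr_const card_ord -mulr_natl; ring.
apply: ler_sum => i _; rewrite normrM ler_pM//; exact: coord_le_norm.
Qed.

Definition entry_bound n (M : 'M[R]_n) := \sum_i \sum_j `|M i j|.

Lemma entry_bound_ge0 n (M : 'M[R]_n) : 0 <= entry_bound M.
Proof. by apply: sumr_ge0 => i _; apply: sumr_ge0. Qed.

Lemma le_entry_bound n (M : 'M[R]_n) i j : `|M i j| <= entry_bound M.
Proof.
rewrite /entry_bound (bigD1 i)//= (bigD1 j)//= -addrA lerDl addr_ge0//.
  exact: sumr_ge0.
by apply: sumr_ge0 => ? _; apply: sumr_ge0.
Qed.

(** Points are row vectors, so the differential at v is u |-> u *m jac H v: rows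
    are indexed by the variables and columns by the components. *)
Definition jac n (H : 'rV[R]_n -> 'rV[R]_n) (v : 'rV[R]_n) : 'M[R]_n :=
  \matrix_(i, j) partial i (fun u => H u 0 j) v.

(** Each component of H has its own intermediate points, so B is no Jacobian
    matrix; but it satisfies every entrywise bound which the Jacobian satisfies
    near x. *)
Lemma secant n (H : 'rV[R]_n -> 'rV[R]_n) (x x' : 'rV[R]_n) (eta : R) J :
  (forall y, `|y - x| <= `|x' - x| -> forall i j,
     derivable (fun u => H u 0 j) y (dir R i) /\ `|J i j - jac H y i j| <= eta) ->
  exists2 B : 'M[R]_n, H x' - H x = (x' - x) *m B &
     forall i j, `|J i j - B i j| <= eta.
Proof.
move=> h.
have ex j : exists xi : 'I_n -> 'rV[R]_n, (forall i, `|xi i - x| <= `|x' - x|) /\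
    H x' 0 j - H x 0 j =
    \sum_i partial i (fun u => H u 0 j) (xi i) * (x' 0 i - x 0 i).
  have [|xi h1 h2] := @mean_value R n (fun u => H u 0 j) x x'.
    by move=> y /h hy i; case: (hy i j).
  by exists xi.
have [xi hxi] := choice ex.
exists (\matrix_(i, j) jac H (xi j i) i j).
  apply/rowP => j; rewrite !mxE (hxi j).2; apply: eq_bigr => i _.
  by rewrite !mxE mulrC.
by move=> i j; rewrite [X in _ - X]mxE; have [_] := h _ ((hxi j).1 i) i j.
Qed.

Lemma smooth_map0P n (H : 'rV[R]_n -> 'rV[R]_n) : smooth_map0 H ->
  exists U : set 'rV[R]_n, [/\ open U, U 0 & forall r j, Cr r U (fun u => H u 0 j)].
Proof.
move=> sH.
have ex j : exists U : set 'rV[R]_n, [/\ open U, U 0 & forall r, Cr r U (fun u => H u 0 j)].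
  exact: (smooth0P _).1 (sH j).
have [U hU] := choice ex.
exists (interior [set v | forall j, U j v]); split.
- exact: open_interior.
- apply: (@filter_forall _ _ _ _ (nbhs_filter (0 : 'rV[R]_n))) => j.
  by case: (hU j) => h1 h2 _; exact: open_nbhs_nbhs.
- move=> r j; case: (hU j) => _ _ /(_ r); apply: CrS => v /interior_subset.
  exact.
Qed.

Section LocalInverse.
Variables (n : nat) (H : 'rV[R]_n -> 'rV[R]_n) (U : set 'rV[R]_n).
Hypotheses (H0 : H 0 = 0) (Uo : open U) (U0 : U 0).
Hypothesis sH : forall r j, Cr r U (fun u => H u 0 j).
Hypothesis J0 : jac H 0 \in unitmx.
Let A := invmx (jac H 0).
Let a := entry_bound A.

Let na_ge0 : 0 <= n%:R * a.
Proof. by rewrite mulr_ge0// entry_bound_ge0. Qed.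

(* two uses of norm_mulmx_le then lose at most a factor 1/2 *)
Let eta : R := (2 * (n%:R * n%:R * a + 1))^-1.

Let Cr_jac r i j : Cr r U (fun u => jac H u i j).
Proof.
have -> : (fun u => jac H u i j) = partial i (fun u => H u 0 j).
  by apply/funext => u; rewrite mxE.
by have [_ _] := sH r.+1 j; apply.
Qed.

Let jac_continuous v i j : U v -> {for v, continuous (fun u => jac H u i j)}.
Proof. exact: Cr_jac 0%N i j v. Qed.

Let near_jac v (e : R) : U v -> 0 < e ->
  \forall u \near v, U u /\ forall i j, `|jac H v i j - jac H u i j| <= e.
Proof.
move=> Uv e0; have nU := open_nbhs_nbhs (conj Uo Uv).
have F := nbhs_filter v.
apply: (@filterI _ _ F) => //.
apply: (@filter_forall _ _ _ _ F) => i; apply: (@filter_forall _ _ _ _ F) => j.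
have := @jac_continuous v i j Uv.
by move/(@cvgrPdist_le _ _ _ _ F) => /(_ _ e0).
Qed.

Let exists_radius : exists2 r : R, 0 < r & forall v, `|v| < r ->
  [/\ U v, jac H v \in unitmx &
   forall i j, `|jac H 0 i j - jac H v i j| <= eta].
Proof.
apply/near0P_norm.
have eta0 : 0 < eta.
  by rewrite invr_gt0 mulr_gt0// ltr_wpDl// -mulrA mulr_ge0.
have F := nbhs_filter (0 : 'rV[R]_n).
have det0 : {for 0, continuous (fun v => \det (jac H v))}.
  have : Cr 0 U (fun v => \det (jac H v)).
    by apply: Cr_det => // i j; exact: Cr_jac.
  by move/(_ 0 U0).
have detn0 : 0 < `|\det (jac H 0)| by rewrite normr_gt0 -unitfE -unitmxE.
have := (@cvgrPdist_lt _ _ _ _ F _ _).1 det0 _ detn0.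
apply: (@filterS2 _ _ F) (near_jac U0 eta0) => v [Uv hv] hd; split => //.
rewrite unitmxE unitfE; apply/eqP => d0.
by move: hd; rewrite /= d0 subr0 ltxx.
Qed.

Section Radius.
Variable r : R.
Hypothesis r_gt0 : 0 < r.
Hypothesis hr : forall v, `|v| < 4 * r ->
  [/\ U v, jac H v \in unitmx & forall i j, `|jac H 0 i j - jac H v i j| <= eta].

Let derH (v : 'rV[R]_n) i j : `|v| < 4 * r -> derivable (fun u => H u 0 j) v (dir R i).
Proof. by move=> /hr[Uv _ _]; have [_ /(_ _ Uv) + _] := sH 1 j; apply. Qed.

(** A inverts the Jacobian at 0, so v - H v *m A has a small Jacobian and is a
    contraction of the ball. *)
Let secant_le (x x' : 'rV[R]_n) : `|x| <= r -> `|x'| <= r ->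
  `|(x' - x) - (H x' - H x) *m A| <= 2^-1 * `|x' - x|.
Proof.
move=> hx hx'.
(* the points compared by secant may leave the ball of radius r *)
have far (y : 'rV[R]_n) : `|y - x| <= `|x' - x| -> `|y| < 4 * r.
  move=> hy; have h1 : `|y| <= `|y - x| + `|x|.
    by rewrite -{1}(subrK x y); exact: ler_normD.
  have h : `|x' - x| <= `|x'| + `|x| by exact: ler_normB.
  have r0 := r_gt0; lra.
have [|B -> hB] := @secant n H x x' eta (jac H 0).
  by move=> y /far hy i j; split; [exact: derH|case: (hr hy)].
have E (d : 'rV[R]_n) : d - d *m B *m A = d *m (jac H 0 - B) *m A.
  by rewrite mulmxBr mulmxBl -(mulmxA d (jac H 0)) mulmxV// mulmx1.
rewrite E.
have eta0 : 0 <= eta.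
  by rewrite invr_ge0 mulr_ge0// addr_ge0// -mulrA mulr_ge0.
have h1 := @norm_mulmx_le n ((x' - x) *m (jac H 0 - B)) A a (entry_bound_ge0 _)
   (@le_entry_bound n A).
have h2 : `|(x' - x) *m (jac H 0 - B)| <= n%:R * eta * `|x' - x|.
  by apply: norm_mulmx_le => // i j; rewrite !mxE; have := hB i j; rewrite mxE.
apply: (le_trans h1); apply: (le_trans (ler_wpM2l na_ge0 h2)).
rewrite mulrA ler_wpM2r//.
have -> : n%:R * a * (n%:R * eta) = (n%:R * n%:R * a) * eta by ring.
have p0 : 0 < 2 * (n%:R * n%:R * a + 1).
  by rewrite mulr_gt0// ltr_wpDl// -mulrA mulr_ge0.
rewrite /eta ler_pdivrMr//; lra.
Qed.

Let expansion (x x' : 'rV[R]_n) : `|x| <= r -> `|x'| <= r ->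
  `|x' - x| <= 2 * `|(H x' - H x) *m A|.
Proof.
move=> hx hx'; have h := secant_le hx hx'.
have := lerB_normD (x' - x) (- ((H x' - H x) *m A)); rewrite normrN.
move: h; set p := `|_ - _ *m A|; set q := `|_ *m A|; set s := `|x' - x|.
lra.
Qed.

Let injective_ball (x x' : 'rV[R]_n) : `|x| <= r -> `|x'| <= r -> H x = H x' -> x = x'.
Proof.
move=> hx hx' E; have := expansion hx hx'.
rewrite E subrr mul0mx normr0 mulr0 normr_le0 subr_eq0 => /eqP ->//.
Qed.

(** The solutions of H x = w are the fixed points of x - H x *m A + w *m A. *)
Let surjective_ball (w : 'rV[R]_n) : `|w *m A| <= r / 2 -> exists2 x, `|x| <= r & H x = w.
Proof.
move=> hw.
pose T x := x - H x *m A + w *m A.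
pose D := [set x : 'rV[R]_n | `|x| <= r].
have TD : {homo T : x / D x >-> D x}.
  move=> x hx; rewrite /D/= in hx *.
  have h1 : `|T x| <= `|x - H x *m A| + `|w *m A| by exact: ler_normD.
  have := @secant_le 0 x; rewrite normr0 H0 !subr0 => /(_ (ltW r_gt0) hx) h2.
  lra.
have half0 : 0 <= 2^-1 :> R by rewrite invr_ge0.
have ctr : is_contraction (mkfun TD).
  exists (NngNum half0); split => /=; first by rewrite invf_lt1// ltr1n.
  move=> [x x'] /= [hx hx']; rewrite /T.
  have -> : x - H x *m A + w *m A - (x' - H x' *m A + w *m A) =
    (x - x') - (H x - H x') *m A.
    by rewrite mulmxBl; apply/rowP => i; rewrite !mxE; ring.
  exact: secant_le.
have [||x hx xE] := @banach_fixed_point R _ D _ ctr.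
- have -> : D = closed_ball_ (fun x => `|x|) 0 r.
    by apply/seteqP; split=> y /=; rewrite /D /closed_ball_/= sub0r normrN.
  exact: closed_closed_ball_.
- by exists 0; rewrite /D/= normr0 ltW.
- exists x => //; move: xE; rewrite /= /T => xE.
  have : H x *m A = w *m A.
    by apply/rowP => i; have := congr1 (fun M : 'rV[R]_n => M 0 i) xE;
      rewrite !mxE => E; lra.
  move/(congr1 (mulmx^~ (jac H 0))); rewrite -!mulmxA mulVmx// !mulmx1.
  exact.
Qed.

Let G (w : 'rV[R]_n) : 'rV[R]_n := xget 0 [set x | `|x| <= r /\ H x = w].
(* for |w| < rho the solution of H x = w has norm less than r *)
Let rho : R := r / (4 * (n%:R * a + 1)).
Let W : set 'rV[R]_n := [set w | `|w| < rho].
Let V : set 'rV[R]_n := [set v | `|v| < r].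

Let na1_gt0 : 0 < n%:R * a + 1. Proof. by rewrite ltr_wpDl. Qed.

Let rho_gt0 : 0 < rho.
Proof. by rewrite divr_gt0// mulr_gt0. Qed.

Let mulA_le (w : 'rV[R]_n) : `|w *m A| <= n%:R * a * `|w|.
Proof. by apply: norm_mulmx_le; [exact: entry_bound_ge0|exact: le_entry_bound]. Qed.

Let W_small (w : 'rV[R]_n) : W w -> `|w *m A| < r / 4.
Proof.
move=> hw; apply: le_lt_trans (mulA_le w) _.
have : (n%:R * a + 1) * `|w| < (n%:R * a + 1) * rho by rewrite ltr_pM2l.
have -> : (n%:R * a + 1) * rho = r / 4.
  by rewrite /rho; field; rewrite gt_eqF.
apply: le_lt_trans; rewrite mulrDl mul1r lerDl//.
Qed.

Let G_in (w : 'rV[R]_n) : W w -> `|G w| <= r /\ H (G w) = w.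
Proof.
move=> /W_small hw; have [|x hx Hx] := @surjective_ball w.
  by have r0 := r_gt0; lra.
by rewrite /G; case: xgetP => [y -> //|/(_ x)[]].
Qed.

Let G_V (w : 'rV[R]_n) : W w -> V (G w).
Proof.
move=> Ww; have [h1 h2] := G_in Ww.
have := @expansion 0 (G w); rewrite normr0 h2 H0 !subr0 => /(_ (ltW r_gt0) h1).
have := W_small Ww; rewrite /V/= => h3 h4.
have r0 := r_gt0; lra.
Qed.

Let GH (v : 'rV[R]_n) : `|v| <= r -> G (H v) = v.
Proof.
move=> hv; rewrite /G; case: xgetP => [y -> [hy]|/(_ v)[]//].
exact: injective_ball.
Qed.

Let G_lip (w w' : 'rV[R]_n) : W w -> W w' ->
  `|G w' - G w| <= 2 * (n%:R * a) * `|w' - w|.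
Proof.
move=> /G_in[h1 h2] /G_in[h3 h4]; apply: le_trans (expansion h1 h3) _.
by rewrite h2 h4 -mulrA ler_wpM2l.
Qed.

Let W_open : open W.
Proof.
have -> : W = ball 0 rho.
  by apply/seteqP; split=> w; rewrite -ball_normE /W/= sub0r normrN.
exact: ball_open.
Qed.

Let V_open : open V.
Proof.
have -> : V = ball 0 r.
  by apply/seteqP; split=> w; rewrite -ball_normE /V/= sub0r normrN.
exact: ball_open.
Qed.

Let V_hr v : V v -> [/\ U v, jac H v \in unitmx &
  forall i j, `|jac H 0 i j - jac H v i j| <= eta].
Proof. by rewrite /V/= => hv; apply: hr; have r0 := r_gt0; lra. Qed.

Let G_cvg w : W w -> {for w, continuous G}.
Proof.
move=> Ww; have F := nbhs_filter w.
apply/(@cvgrPdist_lt _ _ _ _ F) => e e0.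
have e'0 : 0 < e / (2 * (n%:R * a + 1)) by rewrite divr_gt0// mulr_gt0.
have nw : nbhs w [set u : 'rV[R]_n | `|u - w| < e / (2 * (n%:R * a + 1))].
  by apply/nearP_norm; exists (e / (2 * (n%:R * a + 1))).
apply: (@filterS2 _ _ F _ _ _ _ (open_nbhs_nbhs (conj W_open Ww)) nw) => u Wu /= hu.
rewrite distrC; apply: le_lt_trans (G_lip Ww Wu) _.
apply: (@le_lt_trans _ _ (2 * (n%:R * a + 1) * `|u - w|)).
  by rewrite ler_wpM2r// ler_wpM2l// lerDl.
by rewrite mulrC -ltr_pdivlMr// mulr_gt0.
Qed.

(** If B is the secant matrix between G w and G (h e + w), then
    h e = (G (h e + w) - G w) *m B. As B tends to the Jacobian and the increment
    of G is O(h), replacing B by its limit costs o(h). *)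
Let G_derive w (e : 'rV[R]_n) : W w -> is_derive w e G (e *m invmx (jac H (G w))).
Proof.
move=> Ww; have Vx := G_V Ww; have [Ux uJ _] := V_hr Vx.
set x := G w in Vx Ux uJ *; set Ji := invmx _.
suff cG : h^-1 *: ((G \o shift w) (h *: e) - G w) @[h --> 0^'] --> e *m Ji.
  by split; [apply/cvg_ex; exists (e *m Ji)|exact: cvg_lim].
apply/cvgrPdist_le => eps eps0.
pose c := n%:R * entry_bound Ji * (2 * (n%:R * a) * `|e|) * n%:R + 1.
have c0 : 0 < c.
  by rewrite ltr_wpDl// !mulr_ge0// entry_bound_ge0.
have e'0 : 0 < eps / c by rewrite divr_gt0.
have nJ : \forall u \near x, U u /\ forall i j, `|jac H x i j - jac H u i j| <= eps / c.
  exact: near_jac.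
have [d d0 hd] := (nearP_norm _ _).1 nJ.
have nG : \forall u \near w, W u /\ `|G u - x| < d.
  have F := nbhs_filter w.
  have := (@cvgrPdist_lt _ _ _ _ F _ _).1 (G_cvg Ww) _ d0.
  apply: (@filterS2 _ _ F) (open_nbhs_nbhs (conj W_open Ww)) => u Wu.
  by rewrite distrC.
have nh : \forall h \near 0^', W (h *: e + w) /\ `|G (h *: e + w) - x| < d.
  exact: line_cvg nG.
near=> h.
have h0 : h != 0 by near: h; exact: nbhs_dnbhs_neq.
have [Wh hGh] : W (h *: e + w) /\ `|G (h *: e + w) - x| < d by near: h.
have [|B hB1 hB2] := @secant n H x (G (h *: e + w)) (eps / c) (jac H x).
  move=> y hy i j; have [Uy hJ] := hd y (le_lt_trans hy hGh).
  by split=> //; have [_ /(_ _ Uy) + _] := sH 1 j; apply.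
move: hB1; rewrite (G_in Wh).2 (G_in Ww).2 addrK => hB1.
rewrite /=; set y := G (h *: e + w) - x in hB1 *.
have lip : `|y| <= 2 * (n%:R * a) * (`|h| * `|e|).
  by have := G_lip Ww Wh; rewrite addrK normrZ.
have -> : e *m Ji - h^-1 *: y = - ((h^-1 *: y) *m (jac H x - B) *m Ji).
  have -> : e = h^-1 *: (y *m B) by rewrite -hB1 scalerA mulVf// scale1r.
  have E (u : 'rV[R]_n) : u *m B *m Ji - u = - (u *m (jac H x - B) *m Ji).
    by rewrite mulmxBr mulmxBl -(mulmxA u (jac H x)) mulmxV// mulmx1 opprB.
  by rewrite scalemxAl E.
rewrite normrN.
have k1 := norm_mulmx_le (h^-1 *: y *m (jac H x - B)) (entry_bound_ge0 Ji)
   (@le_entry_bound _ Ji).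
have k2 : `|h^-1 *: y *m (jac H x - B)| <= n%:R * (eps / c) * `|h^-1 *: y|.
  by apply: norm_mulmx_le => [|i j]; [exact: ltW|rewrite !mxE; have := hB2 i j; rewrite mxE].
have k3 : `|h^-1 *: y| <= 2 * (n%:R * a) * `|e|.
  rewrite normrZ normfV ler_pdivrMl ?normr_gt0// mulrCA; exact: lip.
apply: le_trans k1 _.
have k4 : n%:R * entry_bound Ji * `|h^-1 *: y *m (jac H x - B)| <=
   n%:R * entry_bound Ji * (n%:R * (eps / c) * (2 * (n%:R * a) * `|e|)).
  rewrite ler_wpM2l ?mulr_ge0 ?entry_bound_ge0//; apply: le_trans k2 _.
  by rewrite ler_wpM2l// mulr_ge0// ltW.
apply: le_trans k4 _.
have -> : n%:R * entry_bound Ji * (n%:R * (eps / c) * (2 * (n%:R * a) * `|e|)) =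
  (c - 1) * (eps / c) by rewrite /c; ring.
rewrite mulrBl mul1r mulrCA mulfV ?gt_eqF// mulr1.
by rewrite gerBl ltW.
Unshelve. all: by end_near. Qed.

(** The Jacobian of G is the inverse Jacobian of H composed with G; so G of class
    C^r makes the partial derivatives of G of class C^r. *)
Let G_smooth r' j : Cr r' W (fun w => G w 0 j).
Proof.
have der w i l (Ww : W w) :
    is_derive w (dir R i) (fun w => G w 0 l) (invmx (jac H (G w)) i l).
  have [dG DG] := G_derive (dir R i) Ww.
  split; first exact: ((derivable_mxP _ _ _).1 dG 0 l).
  have := congr1 (fun M : 'rV[R]_n => M 0 l) (derive_mx dG); rewrite mxE => <-.
  by rewrite DG -rowE mxE.
have cG l w : W w -> {for w, continuous (fun w => G w 0 l)}.
  move=> Ww; apply: (@continuous_comp _ _ _ G (fun u => u 0 l) w (G_cvg Ww)).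
  exact: continuous_coordinate.
elim: r' j => [|r' IH] j /=; first exact: cG.
split; [exact: cG|by move=> w Ww i; case: (der w i j Ww)|].
move=> i.
have : Cr r' W ((fun x => invmx (jac H x) i j) \o G).
  apply: (@Cr_comp _ _ _ _ W V _ _ W_open V_open G_V IH).
  apply: Cr_invmx => [|v /V_hr[]//|k l]; first exact: V_open.
  by apply: CrS (Cr_jac r' k l) => v /V_hr[].
apply: eq_Cr; first exact: W_open.
by move=> w Ww /=; rewrite /partial; case: (der w i j Ww) => _ ->.
Qed.

Lemma local_inverse : exists g : 'rV[R]_n -> 'rV[R]_n,
  [/\ g 0 = 0, smooth_map0 g, \forall v \near (0 : 'rV[R]_n), g (H v) = v &
      \forall w \near (0 : 'rV[R]_n), H (g w) = w].
Proof.
exists G; split.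
- by rewrite -{1}H0 GH// normr0 ltW.
- by move=> j; apply/smooth0P; exists W; split => //; rewrite /W/= normr0.
- by apply/near0P_norm; exists r => // v /ltW; exact: GH.
- by apply/near0P_norm; exists rho => // w /G_in[].
Qed.

End Radius.

Lemma inverse_function_on : exists g : 'rV[R]_n -> 'rV[R]_n,
  [/\ g 0 = 0, smooth_map0 g, \forall v \near (0 : 'rV[R]_n), g (H v) = v &
      \forall w \near (0 : 'rV[R]_n), H (g w) = w].
Proof.
have [r r0 hr] := exists_radius.
apply: (@local_inverse (r / 4)); first by rewrite divr_gt0.
by move=> v hv; apply: hr; rewrite mulrC divfK in hv.
Qed.

End LocalInverse.

Theorem inverse_function n (H : 'rV[R]_n -> 'rV[R]_n) :
  H 0 = 0 -> smooth_map0 H -> jac H 0 \in unitmx -> local_diffeo0 H.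
Proof.
move=> H0 sH uJ; split=> //.
have [U [Uo U0 hU]] := smooth_map0P sH.
exact: inverse_function_on Uo U0 hU uJ.
Qed.

End InverseFunction.

(** * Smooth germs and Taylor polynomials *)

Section SmoothGerms.
Variable R : realType.

Lemma smooth0_continuous n (f : 'rV[R]_n -> R) :
  smooth0 f -> {for 0, continuous f}.
Proof. by case/smooth0P => U [_ U0 /(_ 0%N)]; apply. Qed.

Lemma smooth_map0_continuous n (G : 'rV[R]_n -> 'rV[R]_n) :
  smooth_map0 G -> {for 0, continuous G}.
Proof. by move=> h; apply: continuous_coord => j; exact: smooth0_continuous. Qed.

Lemma smooth0_comp n p (f : 'rV[R]_n -> R) (G : 'rV[R]_p -> 'rV[R]_n) :
  smooth0 f -> (forall j, smooth0 (fun v => G v 0 j)) -> G 0 = 0 ->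
  smooth0 (f \o G).
Proof.
move=> /smooth0P[V [Vo V0 hV]] sG G0.
have [U hU] := choice (fun j => (smooth0P _).1 (sG j)).
have cG : {for 0, continuous G}.
  by apply: continuous_coord => j; exact: smooth0_continuous.
have F := nbhs_filter (0 : 'rV[R]_p).
have n1 : nbhs (0 : 'rV[R]_p) [set v | forall j, U j v].
  apply: (@filter_forall _ _ _ _ F) => j.
  by case: (hU j) => h1 h2 _; exact: open_nbhs_nbhs.
have n2 : nbhs (0 : 'rV[R]_p) (G @^-1` V).
  by apply: cG; rewrite G0; exact: open_nbhs_nbhs.
have n3 := @filterI _ _ F _ _ n1 n2.
apply/smooth0P; exists (interior ([set v | forall j, U j v] `&` G @^-1` V)).
split => [||r]; [exact: open_interior|exact: n3|].
apply: (Cr_comp _ Vo _ _ (hV r)); first exact: open_interior.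
  by move=> u /interior_subset[].
move=> j; case: (hU j) => _ _ /(_ r); apply: CrS => v /interior_subset[].
by move=> + _; apply.
Qed.

Lemma Cr_peval n r (U : set 'rV[R]_n) (P : mpoly n R) :
  open U -> Cr r U (peval P).
Proof.
move=> Uo; have -> : peval P = fun v => \sum_(e <- msupp P) mcoeff e P *
     \prod_(i < n) (v 0 i) ^+ e i.
  by apply/funext => v; rewrite /peval mevalE.
apply: Cr_sum => // e; apply: CrM => //; first exact: Cr_cst.
by apply: Cr_prod => // i; apply: CrX => //; exact: Cr_coord.
Qed.

Lemma smooth0_peval n (P : mpoly n R) : smooth0 (peval P).
Proof.
apply/smooth0P; exists setT; split=> // [|r]; first exact: openT.
by apply: Cr_peval; exact: openT.
Qed.

Lemma smooth0D n (f g : 'rV[R]_n -> R) :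
  smooth0 f -> smooth0 g -> smooth0 (fun v => f v + g v).
Proof.
move=> /smooth0P[U [Uo U0 hU]] /smooth0P[V [Vo V0 hV]].
apply/smooth0P; exists (U `&` V); split => //; first exact: openI.
move=> r; apply: CrD; first exact: openI.
  by apply: CrS (hU r) => v [].
by apply: CrS (hV r) => v [].
Qed.

Lemma smooth_map0_polymap n (P : 'I_n -> mpoly n R) : smooth_map0 (polymap P).
Proof.
move=> i; have -> : (fun v => polymap P v 0 i) = peval (P i).
  by apply/funext => v; rewrite mxE.
exact: smooth0_peval.
Qed.

Lemma local_diffeo0_comp n (f g : 'rV[R]_n -> 'rV[R]_n) :
  local_diffeo0 f -> local_diffeo0 g -> local_diffeo0 (g \o f).
Proof.
case=> f0 sf [f' [f'0 sf' f'f ff']] [g0 sg [g' [g'0 sg' g'g gg']]].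
have cpt (u v : 'rV[R]_n -> 'rV[R]_n) : smooth_map0 u -> smooth_map0 v ->
    u 0 = 0 -> smooth_map0 (v \o u).
  move=> su sv u0 i; exact: (smooth0_comp (sv i) su u0).
have F := nbhs_filter (0 : 'rV[R]_n).
split; [by rewrite /= f0|exact: cpt|].
exists (f' \o g'); split; [by rewrite /= g'0|exact: cpt| |].
- have := smooth_map0_continuous sf; rewrite /prop_for /continuous_at f0.
  move/(_ _ g'g) => h; apply: (@filterS2 _ _ F _ _ _ _ h f'f) => v /= h1 h2.
  by rewrite h1.
- have := smooth_map0_continuous sg'; rewrite /prop_for /continuous_at g'0.
  move/(_ _ ff') => h; apply: (@filterS2 _ _ F _ _ _ _ h gg') => v /= h1 h2.
  by rewrite h1.
Qed.

Lemma Cr_bounded n (U : set 'rV[R]_n) f : U 0 -> Cr 0 U f ->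
  exists2 C, 0 <= C & \forall v \near (0 : 'rV[R]_n), `|f v| <= C.
Proof.
move=> U0 /(_ 0 U0) cf; exists (`|f 0| + 1); first by rewrite addr_ge0.
have F := nbhs_filter (0 : 'rV[R]_n).
have := (@cvgrPdist_le _ _ _ _ F _ _).1 cf 1 ltr01.
apply: (@filterS _ _ F) => v /= h.
have : `|f v| <= `|f 0| + `|f 0 - f v|.
  by rewrite -{1}(subKr (f 0) (f v)) ler_normB.
by move=> h2; apply: le_trans h2 _; rewrite lerD2l.
Qed.

(** The polynomial vanishing at 0 whose derivative along rays is sum_i x_i P_i:
    the monomial x_i x^e restricts to a multiple of t^(|e|+1), hence the division
    by |e| + 1. *)
Definition ray_primitive n (P : 'I_n -> mpoly n R) : mpoly n R :=
  \sum_i \sum_(e <- msupp (P i))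
    ((mcoeff e (P i) / (mdeg e).+1%:R) *: (mpolyX R (mnm1 i) * mpolyX R e)).

Lemma prod_ray n (v : 'rV[R]_n) t (e : multinom n) :
  \prod_(i < n) ((t *: v) 0 i) ^+ e i = t ^+ mdeg e * \prod_(i < n) (v 0 i) ^+ e i.
Proof.
rewrite mdegE -prodrXr -big_split /=.
by apply: eq_bigr => i _; rewrite mxE exprMn.
Qed.

Lemma ray_primitive_derive n (P : 'I_n -> mpoly n R) (v : 'rV[R]_n) (t : R) :
  is_derive t 1 (fun s => peval (ray_primitive P) (s *: v))
    (\sum_i peval (P i) (t *: v) * v 0 i).
Proof.
pose p : {poly R} := \sum_i \sum_(e <- msupp (P i))
  ((mcoeff e (P i) / (mdeg e).+1%:R) * v 0 i * \prod_(j < n) (v 0 j) ^+ e j) *: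
   'X^((mdeg e).+1).
have -> : (fun s => peval (ray_primitive P) (s *: v)) = horner p.
  apply/funext => s; rewrite /peval /ray_primitive raddf_sum /p horner_sum /=.
  apply: eq_bigr => i _; rewrite raddf_sum horner_sum /=; apply: eq_bigr => e _.
  rewrite mevalZ mevalM mevalXU mevalX prod_ray hornerZ hornerXn mxE exprS.
  ring.
have -> : \sum_i peval (P i) (t *: v) * v 0 i = (p^`()).[t].
  rewrite /p raddf_sum horner_sum /=; apply: eq_bigr => i _.
  rewrite raddf_sum horner_sum /peval mevalE mulr_suml /=; apply: eq_bigr => e _.
  rewrite derivZ derivXn hornerZ hornerMn hornerXn prod_ray /= -(mulr_natr (t ^+ _)).
  have : (mdeg e).+1%:R != 0 :> R by rewrite pnatr_eq0.
  by move: ((mdeg e).+1%:R : R) => N N0; field.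
split; first exact: derivable_horner.
by rewrite -derive1E -derivE.
Qed.

Lemma ray_derive n (U : set 'rV[R]_n) f (v : 'rV[R]_n) (t : R) :
  open U -> Cr 1 U f -> U (t *: v) ->
  is_derive t 1 (fun s => f (s *: v)) (\sum_i partial i f (t *: v) * v 0 i).
Proof.
move=> Uo [fc fd fp] Ut.
have h : is_derive (t *: v) v f (\sum_i partial i f (t *: v) * v 0 i).
  have := @chain_rule R n n f id (t *: v) v.
  have -> : f \o id = f by [].
  have -> : \sum_j partial j f (t *: v) * v 0 j =
     \sum_j partial j f (t *: v) * 'D_v (fun u : 'rV[R]_n => u 0 j) (t *: v).
    by apply: eq_bigr => j _; case: (derive_coord j (t *: v) v) => _ ->.
  apply.
  - have := open_nbhs_nbhs (conj Uo Ut); apply: (@filterS _ _ (nbhs_filter _)).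
    by move=> y /fd.
  - by move=> i; exact: fp.
  - by move=> j; case: (derive_coord j (t *: v) v).
have h' : derivable f (0 + t *: v) v by rewrite add0r; case: h.
have := is_derive_line h'; rewrite add0r.
have -> : (fun s => f (0 + s *: v)) = (fun s => f (s *: v)).
  by apply/funext => s; rewrite add0r.
by case: h => _ ->.
Qed.

(** Induction on l: polynomials P_i approximating the partial derivatives to
    order l are integrated along rays, and the mean value theorem on [0, 1]
    bounds the error. Only radial derivatives are compared, so that the P_i may
    be chosen independently of each other. *)
Lemma taylor n (U : set 'rV[R]_n) l f : open U -> U 0 -> Cr l U f ->
  exists T : mpoly n R, exists2 C, 0 <= C &
    \forall v \near (0 : 'rV[R]_n), `|f v - peval T v| <= C * `|v| ^+ l.
Proof.
move=> Uo U0; elim: l f => [|l IH] f hf.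
  have [C C0 hC] := Cr_bounded U0 hf; exists 0, C => //.
  apply: filterS hC => v; by rewrite /peval meval0 subr0 expr0 mulr1.
have [fc fd fp] := hf.
have ex i : exists T : mpoly n R, exists C, 0 <= C /\
    \forall v \near (0 : 'rV[R]_n), `|partial i f v - peval T v| <= C * `|v| ^+ l.
  by have [T [C C0 h]] := IH _ (fp i); exists T, C.
have [P hP] := choice ex; have [C hC] := choice hP.
exists (mpolyC n (f 0) + ray_primitive P), (\sum_i C i).
  by apply: sumr_ge0 => i _; case: (hC i).
have F := nbhs_filter (0 : 'rV[R]_n).
have n1 : \forall v \near (0 : 'rV[R]_n), U v /\ forall i,
    `|partial i f v - peval (P i) v| <= C i * `|v| ^+ l.
  apply: (@filterI _ _ F); first exact: open_nbhs_nbhs.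
  by apply: (@filter_forall _ _ _ _ F) => i; case: (hC i).
have [r r0 hr] := (near0P_norm _).1 n1.
apply/near0P_norm; exists r => // v hv.
pose D (s : R) := f (s *: v) - peval (ray_primitive P) (s *: v).
(* D is the error along the ray through v, and D' its derivative *)
pose D' (s : R) := \sum_i partial i f (s *: v) * v 0 i - \sum_i peval (P i) (s *: v) * v 0 i.
have tv (t : R) : 0 <= t <= 1 -> `|t *: v| < r.
  case/andP => t0 t1; apply: le_lt_trans hv; rewrite normrZ ger0_norm//.
  by rewrite ler_piMl.
have dD (t : R) : 0 <= t <= 1 -> is_derive t 1 D (D' t).
  move=> /tv/hr[Ut _]; apply: is_deriveB; last exact: ray_primitive_derive.
  exact: ray_derive Uo (Cr_le _ hf) Ut.
have [||t tI E] := @MVT_segment R D D' 0 1 ler01.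
- by move=> t; rewrite in_itv/= => /andP[/ltW t0 /ltW t1]; apply: dD; rewrite t0.
- by apply: derivable_within_continuous => t; rewrite in_itv/= => /dD[].
- move: tI; rewrite in_itv/= => tI.
  have E0 : peval (ray_primitive P) 0 = 0.
    rewrite /peval /ray_primitive raddf_sum /= big1// => i _.
    rewrite raddf_sum /= big1// => e _.
    by rewrite mevalZ mevalM mevalXU mxE mul0r mulr0.
  have -> : f v - peval (mpolyC n (f 0) + ray_primitive P) v = D 1 - D 0.
    rewrite /D scale1r scale0r E0 /peval mevalD mevalC; ring.
  rewrite E subr0 mulr1 /D' -sumrB (le_trans (ler_norm_sum _ _ _))//.
  rewrite mulr_suml; apply: ler_sum => i _.
  rewrite -mulrBl normrM exprSr mulrA ler_pM//; last exact: coord_le_norm.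
  have [_ /(_ i)] := hr _ (tv _ tI); move/le_trans; apply.
  have [C0 _] := hC i; rewrite ler_wpM2l// lerXn2r ?nnegrE//.
  by case/andP: tI => t0 t1; rewrite normrZ ger0_norm// ler_piMl.
Qed.

Lemma smooth0_taylor n l (f : 'rV[R]_n -> R) : smooth0 f ->
  exists T : mpoly n R, exists2 C, 0 <= C &
    \forall v \near (0 : 'rV[R]_n), `|f v - peval T v| <= C * `|v| ^+ l.
Proof. by move=> /smooth0P[U [Uo U0 /(_ l)]]; exact: taylor. Qed.

End SmoothGerms.

(** * Weighted orders of vanishing *)

Section WeightedOrder.
Variable R : realType.

Definition box n (w : 'I_n -> nat) (t : R) (v : 'rV[R]_n) :=
  forall i, `|v 0 i| <= t ^+ w i.

(** For a smooth f: no Taylor terms of weight less than j. The constant C is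
    uniform on the whole box, which makes the notion stable under composition. *)
Definition wO n (w : 'I_n -> nat) (j : nat) (f : 'rV[R]_n -> R) :=
  exists2 C : R, 0 <= C &
    \forall t \near 0^'+, forall v, box w t v -> `|f v| <= C * t ^+ j.

Lemma right_gt0 : \forall t \near (0 : R)^'+, 0 < t.
Proof. exact: nbhs_right_gt. Qed.

Lemma right_le (e : R) : 0 < e -> \forall t \near (0 : R)^'+, t <= e.
Proof. exact: nbhs_right_le. Qed.

Lemma right_scale (c : R) (P : R -> Prop) : 0 < c ->
  (\forall t \near 0^'+, P t) -> \forall t \near 0^'+, P (c * t).
Proof.
move=> c0 [e /= e0 h]; exists (e / c); first by rewrite /= divr_gt0.
move=> t /=; rewrite sub0r normrN => ht t0; apply: h => /=; last by rewrite mulr_gt0.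
by rewrite sub0r normrN normrM gtr0_norm// mulrC -ltr_pdivlMr.
Qed.

Lemma nearP_right (P : Prop) : (\forall t \near (0 : R)^'+, P) -> P.
Proof. by move=> h; near (0 : R)^'+ => t; near: t. Unshelve. all: by end_near. Qed.

Section Fixed.
Variables (n : nat) (w : 'I_n -> nat).
Implicit Types f g : 'rV[R]_n -> R.

Lemma wO_le j j' f : (j' <= j)%N -> wO w j f -> wO w j' f.
Proof.
move=> jj [C C0 h]; exists C => //; near=> t => v bv.
have t0 : 0 < t by near: t; exact: right_gt0.
have t1 : t <= 1 by near: t; exact: right_le.
have ht : forall v, box w t v -> `|f v| <= C * t ^+ j by near: t.
apply: le_trans (ht v bv) _; rewrite ler_wpM2l//.
by apply: ler_wiXn2l => //; exact: ltW.
Unshelve. all: by end_near. Qed.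

Lemma eq_wO j f g : f =1 g -> wO w j f -> wO w j g.
Proof. by move=> /funext ->. Qed.

Lemma wO0 j : wO w j (fun=> 0).
Proof. by exists 0 => //; near=> t => v _; rewrite normr0 mul0r. Unshelve. all: by end_near. Qed.

Lemma wO_cst c : wO w 0 (fun=> c).
Proof. by exists `|c| => //; near=> t => v _; rewrite mulr1. Unshelve. all: by end_near. Qed.

Lemma wOD j f g : wO w j f -> wO w j g -> wO w j (fun v => f v + g v).
Proof.
case=> C C0 hC [D D0 hD]; exists (C + D); first exact: addr_ge0.
near=> t => v bv.
have h1 : forall v, box w t v -> `|f v| <= C * t ^+ j by near: t.
have h2 : forall v, box w t v -> `|g v| <= D * t ^+ j by near: t.
by apply: le_trans (ler_normD _ _) _; rewrite mulrDl lerD ?h1 ?h2.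
Unshelve. all: by end_near. Qed.

Lemma wOM j j' f g : wO w j f -> wO w j' g -> wO w (j + j') (fun v => f v * g v).
Proof.
case=> C C0 hC [D D0 hD]; exists (C * D); first exact: mulr_ge0.
near=> t => v bv.
have h1 : forall v, box w t v -> `|f v| <= C * t ^+ j by near: t.
have h2 : forall v, box w t v -> `|g v| <= D * t ^+ j' by near: t.
rewrite normrM exprD mulrACA ler_pM// ?h1 ?h2//.
Unshelve. all: by end_near. Qed.

Lemma wOZ j c f : wO w j f -> wO w j (fun v => c * f v).
Proof. by move=> h; rewrite -[j]add0n; apply: wOM => //; exact: wO_cst. Qed.

Lemma wON j f : wO w j f -> wO w j (fun v => - f v).
Proof. by move=> /(wOZ (-1)); apply: eq_wO => v; rewrite mulN1r. Qed.

Lemma wOB j f g : wO w j f -> wO w j g -> wO w j (fun v => f v - g v).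
Proof. by move=> hf hg; apply: wOD => //; exact: wON. Qed.

Lemma wO_coord i : wO w (w i) (fun v => v 0 i).
Proof. by exists 1 => //; near=> t => v /(_ i); rewrite mul1r. Unshelve. all: by end_near. Qed.

Hypothesis w_gt0 : forall i, (0 < w i)%N.

Lemma box_norm t v : 0 <= t <= 1 -> box w t v -> `|v| <= t.
Proof.
case/andP=> t0 t1 h; apply: norm_le_coord => // i.
by apply: le_trans (h i) _; rewrite -{2}[t]expr1; apply: ler_wiXn2l.
Qed.

Lemma box_near (P : 'rV[R]_n -> Prop) : (\forall v \near (0 : 'rV[R]_n), P v) ->
  \forall t \near 0^'+, forall v, box w t v -> P v.
Proof.
move=> /near0P_norm[r r0 h]; near=> t => v bv; apply: h.
have t0 : 0 < t by near: t; exact: right_gt0.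
have t1 : t <= 1 by near: t; exact: right_le.
have tr : t <= r / 2 by near: t; apply: right_le; rewrite divr_gt0.
have := @box_norm t v; rewrite (ltW t0) t1 => /(_ isT bv) h2.
by apply: le_lt_trans h2 _; lra.
Unshelve. all: by end_near. Qed.

Lemma near_eq_wO j f g : (\forall v \near (0 : 'rV[R]_n), f v = g v) ->
  wO w j f -> wO w j g.
Proof.
move=> /box_near fg [C C0 h]; exists C => //; near=> t => v bv.
have h1 : forall v, box w t v -> f v = g v by near: t.
have h2 : forall v, box w t v -> `|f v| <= C * t ^+ j by near: t.
by rewrite -h1// h2.
Unshelve. all: by end_near. Qed.

Lemma wO_norm j f C : 0 <= C ->
  (\forall v \near (0 : 'rV[R]_n), `|f v| <= C * `|v| ^+ j) -> wO w j f.
Proof.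
move=> C0 /box_near h; exists C => //; near=> t => v bv.
have t0 : 0 < t by near: t; exact: right_gt0.
have t1 : t <= 1 by near: t; exact: right_le.
have h1 : forall v, box w t v -> `|f v| <= C * `|v| ^+ j by near: t.
apply: le_trans (h1 v bv) _; rewrite ler_wpM2l// lerXn2r ?nnegrE// ?(ltW t0)//.
by apply: box_norm => //; rewrite (ltW t0).
Unshelve. all: by end_near. Qed.

Lemma wO_at0 j f : (0 < j)%N -> wO w j f -> f 0 = 0.
Proof.
move=> j0 [C C0 h]; apply/eqP; rewrite -normr_le0; apply/ler_addgt0Pr => e e0.
have c1 : 0 < C + 1 by rewrite ltr_wpDl.
suff : \forall t \near (0 : R)^'+, `|f 0| <= 0 + e by case/nearP_right.
near=> t.
have t0 : 0 < t by near: t; exact: right_gt0.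
have t1 : t <= 1 by near: t; exact: right_le.
have te : t <= e / (C + 1) by near: t; apply: right_le; rewrite divr_gt0.
have ht : forall v, box w t v -> `|f v| <= C * t ^+ j by near: t.
have b0 : box w t 0 by move=> i; rewrite mxE normr0 exprn_ge0// ltW.
rewrite add0r; apply: le_trans (ht _ b0) _.
have h2 : t ^+ j <= t by rewrite -{2}[t]expr1; apply: ler_wiXn2l; rewrite ?(ltW t0).
apply: (@le_trans _ _ ((C + 1) * t)).
  by rewrite ler_pM ?exprn_ge0 ?(ltW t0)// lerDl.
by rewrite mulrC -ler_pdivlMr.
Unshelve. all: by end_near. Qed.

End Fixed.

(** H carries the box of size t into the box of size K t. *)
Lemma wO_comp n p (w : 'I_n -> nat) (w' : 'I_p -> nat) l
    (f : 'rV[R]_p -> R) (H : 'rV[R]_n -> 'rV[R]_p) :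
  (forall j, (0 < w' j)%N) -> (forall j, wO w (w' j) (fun v => H v 0 j)) ->
  wO w' l f -> wO w l (f \o H).
Proof.
move=> w'0 hH [D D0 hD].
have ex j : exists C : R, 0 <= C /\ \forall t \near 0^'+, forall v, box w t v ->
    `|H v 0 j| <= C * t ^+ w' j.
  by have [C C0 h] := hH j; exists C.
have [C hC] := choice ex.
pose K := 1 + \sum_j C j.
have CK j : C j <= K.
  rewrite /K (bigD1 j)//= addrCA lerDl addr_ge0// sumr_ge0// => i _.
  by case: (hC i).
have K1 : 1 <= K by rewrite lerDl sumr_ge0// => i _; case: (hC i).
have K0 : 0 < K by rewrite (lt_le_trans ltr01).
exists (D * K ^+ l); first by rewrite mulr_ge0// exprn_ge0// ltW.
have n1 : \forall t \near 0^'+, forall j v, box w t v -> `|H v 0 j| <= C j * t ^+ w' j.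
  by apply: filter_forall => j; case: (hC j).
have n2 := right_scale K0 hD.
near=> t => v bv.
have t0 : 0 < t by near: t; exact: right_gt0.
have h1 : forall j v, box w t v -> `|H v 0 j| <= C j * t ^+ w' j by near: t.
have h2 : forall v, box w' (K * t) v -> `|f v| <= D * (K * t) ^+ l by near: t.
rewrite -mulrA -exprMn; apply: h2 => j; apply: le_trans (h1 j v bv) _.
rewrite exprMn ler_wpM2r ?exprn_ge0 ?(ltW t0)//; apply: le_trans (CK j) _.
by rewrite -{1}[K]expr1; apply: ler_weXn2l.
Unshelve. all: by end_near. Qed.

(** rho is the largest of the |v_i|^(1/w_i), that is, the size of the smallest
    box that contains v. *)
Lemma exists_gauge n (w : 'I_n -> nat) (v : 'rV[R]_n) : (forall i, (0 < w i)%N) ->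
  v != 0 -> exists rho j, [/\ 0 < rho, box w rho v & `|v 0 j| = rho ^+ w j].
Proof.
move=> w0 v0.
have [i0 vi0] : exists i0, v 0 i0 != 0.
  apply/existsP; apply: contraNT v0; rewrite negb_exists => /forallP h.
  by apply/eqP/rowP => i; rewrite mxE; apply/eqP; have := h i; rewrite negbK.
pose q i := `|v 0 i| `^ (w i)%:R^-1.
have qX i : q i ^+ w i = `|v 0 i|.
  rewrite /q -powR_mulrn ?powR_ge0// -powRrM mulVf ?powRr1//.
  by rewrite pnatr_eq0 -lt0n.
have [j _ hj] := @arg_maxP _ _ _ i0 xpredT q isT.
exists (q j), j; split=> //.
  apply: lt_le_trans (hj i0 isT); rewrite powR_gt0// normr_gt0//.
move=> i; rewrite -qX lerXn2r ?nnegrE ?powR_ge0//; exact: hj.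
Qed.

(** Let v = G u lie in a smallest box of size rho, attained at the coordinate j.
    The difference |u_j - v_j| is O(rho^(w_j+1)), hence at most half of
    |v_j| = rho^(w_j) when u is near 0; so rho <= 2 t as soon as u is in the box
    of size t. *)
Lemma wO_inverse n (w : 'I_n -> nat) (H G : 'rV[R]_n -> 'rV[R]_n) :
  (forall i, (0 < w i)%N) ->
  (forall j, wO w (w j).+1 (fun v => H v 0 j - v 0 j)) ->
  {for 0, continuous G} -> G 0 = 0 ->
  (\forall u \near (0 : 'rV[R]_n), H (G u) = u) ->
  forall j, wO w (w j) (fun u => G u 0 j).
Proof.
move=> w0 hH cG G0 HG j0.
have ex j : exists C : R, 0 <= C /\ \forall t \near 0^'+, forall v, box w t v ->
    `|H v 0 j - v 0 j| <= C * t ^+ (w j).+1.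
  by have [C C0 h] := hH j; exists C.
have [C hC] := choice ex.
pose K := 1 + \sum_j C j.
have CK j : C j <= K.
  rewrite /K (bigD1 j)//= addrCA lerDl addr_ge0// sumr_ge0// => i _.
  by case: (hC i).
have K1 : 1 <= K by rewrite lerDl sumr_ge0// => i _; case: (hC i).
have K0 : 0 < K by rewrite (lt_le_trans ltr01).
have n1 : \forall t \near (0 : R)^'+, forall j v, box w t v ->
    `|H v 0 j - v 0 j| <= C j * t ^+ (w j).+1.
  by apply: filter_forall => j; case: (hC j).
have [e /= e0 he] := n1.
(* below tau the error bound applies and is at most half of the leading term *)
pose tau := Num.min (e / 2) (2 * K)^-1.
have tau0 : 0 < tau by rewrite lt_min divr_gt0//= invr_gt0 mulr_gt0.
have taue : tau < e by rewrite gt_min; apply/orP; left; lra.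
have tauK : tau <= (2 * K)^-1 by rewrite ge_min lexx orbT.
have F := nbhs_filter (0 : 'rV[R]_n).
have n2 : \forall u \near (0 : 'rV[R]_n), H (G u) = u /\ box w tau (G u).
  apply: (@filterI _ _ F) => //.
  suff /cG : nbhs (G 0) [set v : 'rV[R]_n | box w tau v] by [].
  rewrite G0; apply: (@filter_forall _ _ _ _ F) => i.
  apply/near0P_norm; exists (tau ^+ w i); first exact: exprn_gt0.
  move=> v hv; apply: ltW; apply: le_lt_trans hv; exact: coord_le_norm.
have n3 := box_near w0 n2.
exists (2 ^+ w j0); first exact: exprn_ge0.
near=> t => u bu.
have t0 : 0 < t by near: t; exact: right_gt0.
have h3 : forall u, box w t u -> H (G u) = u /\ box w tau (G u) by near: t.
have [HGu bG] := h3 u bu; rewrite -exprMn.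
have [->|v0] := eqVneq (G u) 0.
  by rewrite mxE normr0 exprn_ge0// mulr_ge0// ltW.
have [rho [j [rho0 brho vj]]] := exists_gauge w0 v0.
have rhotau : rho <= tau.
  by have := bG j; rewrite vj ler_pXn2r ?nnegrE ?(ltW rho0) ?(ltW tau0).
have := he rho; rewrite /= sub0r normrN gtr0_norm// => /(_ (le_lt_trans rhotau taue) rho0).
move=> /(_ j _ brho); rewrite HGu => h4.
have h5 : rho ^+ w j <= t ^+ w j + 2^-1 * rho ^+ w j.
  rewrite -vj; have := bu j.
  have : `|G u 0 j| <= `|u 0 j| + `|u 0 j - G u 0 j|.
    by rewrite -{1}(subKr (u 0 j) (G u 0 j)) ler_normB.
  have : C j * rho ^+ (w j).+1 <= 2^-1 * `|G u 0 j|.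
    rewrite vj exprS mulrA ler_wpM2r ?exprn_ge0 ?(ltW rho0)//.
    apply: (@le_trans _ _ (K * (2 * K)^-1)); last by rewrite invfM mulrCA mulfV ?mulr1// gt_eqF.
    by rewrite ler_pM ?(ltW rho0)//; [case: (hC j)|apply: le_trans tauK].
  move: h4; lra.
have h6 : rho <= 2 * t.
  have : rho ^+ w j <= (2 * t) ^+ w j.
    rewrite exprMn; apply: (@le_trans _ _ (2 * t ^+ w j)); first by lra.
    rewrite ler_wpM2r ?exprn_ge0 ?(ltW t0)// -{1}[2]expr1.
    by apply: ler_weXn2l => //; rewrite ler1n.
  by rewrite ler_pXn2r ?nnegrE ?(ltW rho0) ?mulr_ge0 ?(ltW t0).
apply: le_trans (brho j0) _.
by rewrite lerXn2r ?nnegrE ?(ltW rho0) ?mulr_ge0 ?(ltW t0).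
Unshelve. all: by end_near. Qed.

(** The point t^(w_i) e_i lies in the box of size t, where f is
    O(t^(w_i+1)); so the difference quotient there is O(t). *)
Lemma wO_partial0 n (w : 'I_n -> nat) f i : (forall i, (0 < w i)%N) ->
  derivable f 0 (dir R i) -> wO w (w i).+1 f -> partial i f 0 = 0.
Proof.
move=> w0 df fO; have f0 := wO_at0 (ltn0Sn _) fO.
have [C C0 hC] := fO.
apply/eqP; apply: contraT => L0; set L := partial i f 0 in L0.
have : h^-1 *: ((f \o shift 0) (h *: dir R i) - f 0) @[h --> 0^'] --> L by exact: df.
move=> /cvgrPdist_lt/(_ (`|L| / 2)); rewrite divr_gt0 ?normr_gt0// => /(_ isT).
case=> d /= d0 hd.
have c1 : 0 < C + 1 by rewrite ltr_wpDl.
apply: nearP_right; near=> t.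
have t0 : 0 < t by near: t; exact: right_gt0.
have t1 : t <= 1 by near: t; exact: right_le.
have td : t <= d / 2 by near: t; apply: right_le; rewrite divr_gt0.
have te : t <= `|L| / 2 / (C + 1).
  by near: t; apply: right_le; rewrite !divr_gt0// normr_gt0.
have ht : forall v, box w t v -> `|f v| <= C * t ^+ (w i).+1 by near: t.
have tw0 : 0 < t ^+ w i by exact: exprn_gt0.
have twt : t ^+ w i <= t.
  by rewrite -{2}[t]expr1; apply: ler_wiXn2l; rewrite ?(ltW t0).
have bt : box w t (t ^+ w i *: dir R i).
  move=> j; rewrite !mxE eqxx/=; have [->|ji] := eqVneq j i.
    by rewrite mulr1 gtr0_norm.
  by rewrite mulr0 normr0 exprn_ge0// ltW.
have := hd (t ^+ w i); rewrite /= sub0r normrN gtr0_norm// => /(_ _ (lt0r_neq0 tw0)).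
rewrite addr0 f0 subr0 => H1.
have {}H1 : `|L - (t ^+ w i)^-1 *: f (t ^+ w i *: dir R i)| < `|L| / 2.
  by apply: H1; apply: le_lt_trans twt _; lra.
have H2 : `|(t ^+ w i)^-1 *: f (t ^+ w i *: dir R i)| <= `|L| / 2.
  rewrite normrM normfV (gtr0_norm tw0) ler_pdivrMl//; apply: le_trans (ht _ bt) _.
  rewrite exprSr mulrCA ler_pM2l//.
  apply: (@le_trans _ _ ((C + 1) * t)); first by rewrite ler_wpM2r ?(ltW t0)// lerDl.
  by rewrite mulrC -ler_pdivlMr.
have := ler_normD (L - (t ^+ w i)^-1 *: f (t ^+ w i *: dir R i))
   ((t ^+ w i)^-1 *: f (t ^+ w i *: dir R i)); rewrite subrK.
by move: H1 H2 => /=; lra.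
Unshelve. all: by end_near. Qed.

Lemma smooth0_derivable n (f : 'rV[R]_n -> R) i : smooth0 f -> derivable f 0 (dir R i).
Proof. by case/smooth0P => U [_ U0 /(_ 1%N)[_ + _]]; apply. Qed.

(** By wO_partial0 the Jacobian at 0 differs from the identity only at the
    entries (i, j) with w_j < w_i. A row vector in its kernel therefore vanishes,
    coordinate by coordinate from the highest weight downwards. *)
Lemma unipotent_local_diffeo n (w : 'I_n -> nat) (H : 'rV[R]_n -> 'rV[R]_n) :
  (forall i, (0 < w i)%N) -> smooth_map0 H ->
  (forall j, wO w (w j).+1 (fun v => H v 0 j - v 0 j)) ->
  local_diffeo0 H.
Proof.
move=> w0 sH hH.
have H0 : H 0 = 0.
  apply/rowP => j; have := wO_at0 (ltn0Sn _) (hH j).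
  by rewrite !mxE subr0.
apply: inverse_function => //.
have jacE i j : (w i <= w j)%N -> jac H 0 i j = (i == j)%:R.
  move=> wij; rewrite mxE.
  have [dc Dc] := derive_coord j 0 (dir R i).
  have dH : derivable (fun v => H v 0 j) 0 (dir R i) by exact: smooth0_derivable.
  have := @wO_partial0 n w (fun v => H v 0 j - v 0 j) i w0.
  rewrite /partial => /(_ (derivableB dH dc)).
  have h1 : wO w (w i).+1 (fun v => H v 0 j - v 0 j) by apply: wO_le (hH j).
  move=> /(_ h1).
  rewrite (deriveB dH dc) Dc !mxE eqxx/= => /eqP.
  by rewrite subr_eq0 => /eqP ->; rewrite eq_sym.
rewrite -row_free_unit; apply: inj_row_free => u uJ.
pose K := (\sum_i w i)%N.
have wK i : (w i <= K)%N by rewrite /K (bigD1 i)//= leq_addr.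
have claim m : forall j, (K - w j <= m)%N -> u 0 j = 0.
  elim: m => [|m IH] j hj; have := congr1 (fun M : 'rV[R]_n => M 0 j) uJ;
    rewrite !mxE (bigD1 j)//= jacE// eqxx mulr1 big1 ?addr0// => i ij.
    by rewrite jacE ?(negbTE ij) ?mulr0//; apply: leq_trans (wK i) _; rewrite -subn_eq0 -leqn0.
  have [wij|wij] := leqP (w i) (w j); first by rewrite jacE// (negbTE ij) mulr0.
  rewrite IH ?mul0r//; have := wK i; have := wK j; lia.
by apply/rowP => j; rewrite mxE; apply: claim (leqnn _).
Qed.

End WeightedOrder.

(** * Polynomials with weights *)

Section Support.
Variables (R : realType) (n : nat).
Implicit Types (S : multinom n -> Prop) (P Q : mpoly n R).

Definition wt (w : 'I_n -> nat) (e : multinom n) := (\sum_i w i * e i)%N.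

(** One predicate for homogeneity, lower bounds on the weight and absence of
    excluded monomials; psuppM is the rule by which they are all propagated. *)
Definition psupp S P := forall e, mcoeff e P != 0 -> S e.

Lemma psuppW S S' P : (forall e, S e -> S' e) -> psupp S P -> psupp S' P.
Proof. by move=> SS h e /h/SS. Qed.

Lemma psupp0 S : psupp S 0.
Proof. by move=> e; rewrite mcoeff0 eqxx. Qed.

Lemma psuppD S P Q : psupp S P -> psupp S Q -> psupp S (P + Q).
Proof.
move=> hP hQ e; rewrite mcoeffD => h.
have [P0|/hP//] := eqVneq (mcoeff e P) 0.
by apply: hQ; apply: contraNneq h => ->; rewrite P0 addr0.
Qed.

Lemma psuppN S P : psupp S P -> psupp S (- P).
Proof. by move=> hP e; rewrite mcoeffN oppr_eq0; exact: hP. Qed.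

Lemma psuppZ S c P : psupp S P -> psupp S (c *: P).
Proof.
move=> hP e; rewrite mcoeffZ => h; apply: hP.
by apply: contraNneq h => ->; rewrite mulr0.
Qed.

Lemma psupp_sum S (I : eqType) (r : seq I) (p : pred I) (F : I -> mpoly n R) :
  (forall i, i \in r -> p i -> psupp S (F i)) -> psupp S (\sum_(i <- r | p i) F i).
Proof.
move=> h; rewrite big_seq_cond; elim/big_rec: _ => [|i P /andP[ir pi] hP].
  exact: psupp0.
by apply: psuppD => //; exact: h.
Qed.

Lemma psuppX S e : S e -> psupp S (mpolyX R e).
Proof. by move=> Se e'; rewrite mcoeffX; case: (eqVneq e e') => [<-//|_]; rewrite eqxx. Qed.

Lemma psuppM S1 S2 S P Q :
  (forall e1 e2, S1 e1 -> S2 e2 -> S (mnm_add e1 e2)) ->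
  psupp S1 P -> psupp S2 Q -> psupp S (P * Q).
Proof.
move=> h hP hQ e; rewrite -mcoeff_msupp => /msuppM_le/allpairsP[[e1 e2] /= [h1 h2 ->]].
by apply: h; [apply: hP|apply: hQ]; rewrite -mcoeff_msupp.
Qed.

Lemma wtD w e e' : wt w (mnm_add e e') = (wt w e + wt w e')%N.
Proof.
by rewrite /wt -big_split; apply: eq_bigr => i _; rewrite mnmDE mulnDr.
Qed.

Lemma wtU w i : wt w (mnm1 i) = w i.
Proof.
rewrite /wt (bigD1 i)//= mnm1E eqxx muln1 big1 ?addn0// => j /negbTE ji.
by rewrite mnm1E eq_sym ji muln0.
Qed.

Definition wpart (w : 'I_n -> nat) (mu : nat) P : mpoly n R :=
  \sum_(e <- msupp P | wt w e == mu) mcoeff e P *: mpolyX R e.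

Lemma mcoeff_wpart w mu P e :
  mcoeff e (wpart w mu P) = if wt w e == mu then mcoeff e P else 0.
Proof.
rewrite /wpart raddf_sum /=.
under eq_bigr do rewrite mcoeffZ mcoeffX.
rewrite big_mkcond /=.
have [he|he] := boolP (e \in msupp P).
  rewrite (bigD1_seq e) ?msupp_uniq//= eqxx mulr1 big1 ?addr0// => e' ee'.
  by rewrite (negbTE ee') mulr0 if_same.
rewrite big1_seq => [|e' /= he']; first by rewrite (memN_msupp_eq0 he) if_same.
case: (eqVneq e' e) => [E|]; last by rewrite mulr0 if_same.
by rewrite E (negbTE he) in he'.
Qed.

End Support.

Section WeightedPolynomials.
Variables (R : realType).

Lemma pevalD r (P Q : mpoly r R) v : peval (P + Q) v = peval P v + peval Q v.
Proof. exact: mevalD. Qed.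

Lemma pevalB r (P Q : mpoly r R) v : peval (P - Q) v = peval P v - peval Q v.
Proof. exact: mevalB. Qed.

Lemma pevalM r (P Q : mpoly r R) v : peval (P * Q) v = peval P v * peval Q v.
Proof. exact: mevalM. Qed.

Section Shift.
Variables (n p : nat) (w : 'I_n -> nat) (w' : 'I_p -> nat) (d : nat).
Variables (u dl : 'I_p -> 'rV[R]_n -> R).
Hypothesis uO : forall i, wO w (w' i) (u i).
Hypothesis dO : forall i, wO w (w' i + d)%N (dl i).

Let ev (P : mpoly p R) (v : 'rV[R]_n) := meval (fun i => u i v) P.
Let ev' (P : mpoly p R) (v : 'rV[R]_n) := meval (fun i => u i v + dl i v) P.
Let lin (P : mpoly p R) (v : 'rV[R]_n) :=
  \sum_i meval (fun i => u i v) (mderiv i P) * dl i v.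

(** The value at u, the first variation in the direction dl and the remainder of
    order two, with the weights they should have. By the Leibniz rule this is
    stable under products, so it is enough to look at the variables. *)
Let good (P : mpoly p R) j := [/\ wO w j (ev P), wO w (j + d)%N (lin P) &
   wO w (j + 2 * d)%N (fun v => ev' P v - ev P v - lin P v)].

Let good_le P j j' : (j' <= j)%N -> good P j -> good P j'.
Proof.
move=> jj [h1 h2 h3]; split; [exact: wO_le h1|apply: wO_le h2|apply: wO_le h3];
by rewrite leq_add2r.
Qed.

Let goodC c : good (mpolyC p c) 0.
Proof.
split.
- by apply: eq_wO (wO_cst w c) => v; rewrite /ev mevalC.
- apply: eq_wO (wO0 R w _) => v; rewrite /lin big1// => i _.
  by rewrite mderivC meval0 mul0r.
- apply: eq_wO (wO0 R w _) => v; rewrite /lin big1; first by rewrite /ev /ev' !mevalC subrr subr0.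
  by move=> i _; rewrite mderivC meval0 mul0r.
Qed.

Let linX i v : lin (mpolyX R (mnm1 i)) v = dl i v.
Proof.
rewrite /lin (bigD1 i)//= big1 => [|j ji].
  rewrite mderivX mnm1E eqxx scale1r addr0.
  have -> : mnm_sub (mnm1 i) (mnm1 i) = mnm0 by apply/mnmP => k; rewrite mnmBE mnm0E subnn.
  by rewrite mpolyX0 meval1 mul1r.
by rewrite mderivX mnm1E eq_sym (negbTE ji) scale0r meval0 mul0r.
Qed.

Let goodXU i : good (mpolyX R (mnm1 i)) (w' i).
Proof.
split.
- by apply: eq_wO (uO i) => v; rewrite /ev mevalXU.
- by apply: eq_wO (dO i) => v; rewrite linX.
- apply: eq_wO (wO0 R w _) => v; rewrite linX /ev' /ev !mevalXU; ring.
Qed.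

Let linM P Q v : lin (P * Q) v = lin P v * ev Q v + ev P v * lin Q v.
Proof.
rewrite /lin mulr_suml mulr_sumr -big_split; apply: eq_bigr => i _ /=.
rewrite mderivM mevalD !mevalM /ev; ring.
Qed.

Let goodM P Q j j' : good P j -> good Q j' -> good (P * Q) (j + j').
Proof.
case=> P1 P2 P3 [Q1 Q2 Q3].
have Q' : wO w j' (ev' Q).
  have Q2' : wO w j' (lin Q) by apply: wO_le Q2; rewrite leq_addr.
  have Q3' : wO w j' (fun v => ev' Q v - ev Q v - lin Q v).
    by apply: wO_le Q3; rewrite leq_addr.
  apply: eq_wO (wOD Q1 (wOD Q2' Q3')) => v; ring.
split.
- by apply: eq_wO (wOM P1 Q1) => v; rewrite /ev mevalM.
- apply: (@eq_wO _ _ _ _ (fun v => lin P v * ev Q v + ev P v * lin Q v)).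
    by move=> v; rewrite linM.
  apply: wOD; first by rewrite addnAC; exact: wOM.
  by rewrite -addnA; exact: wOM.
- apply: (@eq_wO _ _ _ _ (fun v =>
    ev P v * (ev' Q v - ev Q v - lin Q v) +
    (lin P v * (lin Q v + (ev' Q v - ev Q v - lin Q v)) +
     (ev' P v - ev P v - lin P v) * ev' Q v))).
    move=> v; rewrite linM /ev' /ev !mevalM; ring.
  apply: wOD; first by rewrite -addnA; exact: wOM.
  apply: wOD; last by rewrite addnAC; exact: wOM.
  have -> : (j + j' + 2 * d = (j + d) + (j' + d))%N by lia.
  apply: wOM => //; apply: wOD => //; apply: wO_le Q3; lia.
Qed.

Let goodD P Q j : good P j -> good Q j -> good (P + Q) j.
Proof.
have linD v : lin (P + Q) v = lin P v + lin Q v.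
  rewrite /lin -big_split; apply: eq_bigr => i _ /=.
  by rewrite mderivD mevalD mulrDl.
case=> P1 P2 P3 [Q1 Q2 Q3]; split.
- by apply: eq_wO (wOD P1 Q1) => v; rewrite /ev mevalD.
- by apply: eq_wO (wOD P2 Q2) => v; rewrite linD.
- apply: eq_wO (wOD P3 Q3) => v; rewrite linD /ev' /ev !mevalD; ring.
Qed.

Let good_pow P j q : good P j -> good (P ^+ q) (j * q).
Proof.
move=> h; elim: q => [|q IH]; first by rewrite expr0 muln0; exact: goodC 1.
by rewrite exprS mulnS; exact: goodM.
Qed.

Let good_mono e : good (mpolyX R e) (wt w' e).
Proof.
rewrite mpolyXE_id /wt; elim/big_ind2: _ => [|P j Q j' hP hQ|i _].
- exact: goodC 1.
- exact: goodM.
- exact: good_pow.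
Qed.

Let good_supp P j : psupp (fun e => j <= wt w' e)%N P -> good P j.
Proof.
move=> h; rewrite (mpolyE P) big_seq; elim/big_ind: _ => [|Q Q'|e he].
- by have := goodC 0; rewrite mpolyC0 => -[_ _ _]; split;
   [apply: eq_wO (wO0 R w _) => v; rewrite /ev meval0
   |apply: eq_wO (wO0 R w _) => v; rewrite /lin big1// => i _; rewrite mderiv0 meval0 mul0r
   |apply: eq_wO (wO0 R w _) => v; rewrite /lin big1; [rewrite /ev /ev' !meval0 !subr0|
      move=> i _; rewrite mderiv0 meval0 mul0r]].
- exact: goodD.
- rewrite -mul_mpolyC; apply: (@good_le _ (0 + wt w' e)).
    by rewrite add0n; apply: h; rewrite -mcoeff_msupp.
  by apply: goodM; [exact: goodC|exact: good_mono].
Qed.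

Lemma wO_meval P j : psupp (fun e => j <= wt w' e)%N P ->
  wO w j (fun v => meval (fun i => u i v) P).
Proof. by case/good_supp. Qed.

Lemma wO_meval_shift P j : psupp (fun e => j <= wt w' e)%N P ->
  wO w (j + d) (fun v => meval (fun i => u i v + dl i v) P - meval (fun i => u i v) P).
Proof.
case/good_supp => h1 h2 h3.
have h3' : wO w (j + d) (fun v => ev' P v - ev P v - lin P v) by apply: wO_le h3; lia.
apply: eq_wO (wOD h2 h3') => v; rewrite /ev' /ev; ring.
Qed.

Lemma wO_meval_shift2 P j : psupp (fun e => j <= wt w' e)%N P ->
  wO w (j + 2 * d) (fun v => meval (fun i => u i v + dl i v) P - meval (fun i => u i v) P
    - \sum_i meval (fun i => u i v) (mderiv i P) * dl i v).
Proof. by case/good_supp. Qed.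

End Shift.

Lemma wO_peval n (w : 'I_n -> nat) (P : mpoly n R) j :
  psupp (fun e => j <= wt w e)%N P -> wO w j (peval P).
Proof.
move=> h; apply: (@wO_meval n n w w 0 (fun i v => v 0 i) (fun i v => 0)) h.
  by move=> i; exact: (wO_coord R).
by move=> i; exact: wO0.
Qed.

Lemma smooth0_taylor_wO n (w : 'I_n -> nat) l f : (forall i, (0 < w i)%N) ->
  smooth0 f -> exists T : mpoly n R, wO w l (fun v => f v - peval T v).
Proof.
move=> w0 sf; have [T [C C0 h]] := smooth0_taylor l sf; exists T.
exact: wO_norm C0 h.
Qed.

(** Otherwise q is equivalent to q_i t^i at 0, for the least i with q_i <> 0. *)
Lemma horner_small (q : {poly R}) j C :
  (\forall t \near (0 : R)^'+, `|q.[t]| <= C * t ^+ j) ->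
  forall i, (i < j)%N -> q`_i = 0.
Proof.
move=> hq; elim/ltn_ind => i IH ij.
have E : q = drop_poly i q * 'X^i.
  rewrite -[LHS](poly_take_drop i).
  suff -> : take_poly i q = 0 by rewrite add0r.
  apply/polyP => l; rewrite coef_take_poly coef0; case: ifP => // li.
  by apply: IH => //; exact: ltn_trans ij.
set g := drop_poly i q in E.
have g0 : g.[0] = q`_i by rewrite horner_coef0 coef_drop_poly add0n.
rewrite -g0; apply/eqP; apply: contraT => gn0.
have gp : 0 < `|g.[0]| / 2 by rewrite divr_gt0// normr_gt0.
have cg := @continuous_horner R g 0.
have /= [e /= e0 he] := (cvgrPdist_lt _ _).1 cg _ gp.
apply: nearP_right; near=> t.
have t0 : 0 < t by near: t; exact: right_gt0.
have t1 : t <= 1 by near: t; exact: right_le.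
have te : t <= e / 2 by near: t; apply: right_le; rewrite divr_gt0.
have c1 : 0 < `|C| + 1 by rewrite ltr_wpDl.
have tC : t <= `|g.[0]| / 2 / (`|C| + 1) by near: t; apply: right_le; rewrite divr_gt0.
have ht : `|q.[t]| <= C * t ^+ j by near: t.
have h1 : `|g.[0] - g.[t]| < `|g.[0]| / 2.
  by apply: he => /=; rewrite sub0r normrN gtr0_norm//; lra.
have h2 : `|g.[t]| <= `|g.[0]| / 2.
  have ti0 : 0 < t ^+ i by exact: exprn_gt0.
  rewrite -(ler_pM2r ti0).
  have -> : `|g.[t]| * t ^+ i = `|q.[t]|.
    by rewrite E hornerM hornerXn normrM (gtr0_norm ti0).
  apply: le_trans ht _.
  have -> : C * t ^+ j = C * t ^+ (j - i.+1) * t * t ^+ i.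
    by rewrite -{1}(subnK ij) exprD exprS !mulrA.
  rewrite ler_wpM2r ?(ltW ti0)//.
  apply: (@le_trans _ _ ((`|C| + 1) * t)); last by rewrite mulrC -ler_pdivlMr.
  rewrite ler_wpM2r ?(ltW t0)//; apply: (@le_trans _ _ (`|C| * 1)).
    rewrite (le_trans (ler_norm _))// normrM ler_wpM2l//.
    by rewrite ger0_norm ?exprn_ge0 ?(ltW t0)// exprn_ile1// ltW.
  by rewrite mulr1 lerDl.
have := ler_normD (g.[0] - g.[t]) g.[t]; rewrite subrK.
move: h1 h2; lra.
Unshelve. all: by end_near. Qed.

Lemma digits_inj n M (e e' : nat -> nat) :
  (forall i, (i < n)%N -> (e i < M)%N) -> (forall i, (i < n)%N -> (e' i < M)%N) ->
  (\sum_(i < n) M ^ i * e i = \sum_(i < n) M ^ i * e' i)%N ->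
  forall i, (i < n)%N -> e i = e' i.
Proof.
elim: n e e' => [//|n IH] e e' he he'.
have S (f : nat -> nat) : (\sum_(i < n.+1) M ^ i * f i =
    (\sum_(i < n) M ^ i * f i.+1) * M + f 0)%N.
  rewrite big_ord_recl expn0 mul1n addnC big_distrl /=; congr (_ + _)%N.
  by apply: eq_bigr => i _; rewrite /bump /= add1n expnS -mulnA mulnC.
have M0 : (0 < M)%N by apply: leq_ltn_trans (he 0%N _).
rewrite !S => E.
have E0 : e 0%N = e' 0%N.
  have := congr1 (fun x => x %% M)%N E.
  by rewrite !modnMDl !modn_small ?he ?he'.
move: E; rewrite E0 => /addIn/eqP; rewrite eqn_pmul2r// => /eqP E [//|i] hi.
by apply: (IH (fun i => e i.+1) (fun i => e' i.+1)) => // l hl; [apply: he|apply: he'].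
Qed.

(** Kronecker's substitution x_i = t^(M^i), for M larger than all exponents, sends
    distinct monomials of P to distinct powers of t. *)
Lemma mpoly_eq0_meval n (P : mpoly n R) : (forall v, peval P v = 0) -> P = 0.
Proof.
move=> h; apply/mpolyP => e0; rewrite mcoeff0.
apply/eqP; apply: contraT => Pe0.
(* exceeds every exponent in P *)
pose M := (msize P).+1.
have eM e i : e \in msupp P -> (e i < M)%N.
  move=> /msize_mdeg_lt h1; rewrite ltnS; apply: leq_trans (ltnW h1).
  by rewrite mdegE (bigD1 i)//= leq_addr.
pose k (e : multinom n) := (\sum_(i < n) M ^ i * e i)%N.
have k_inj e : e \in msupp P -> k e = k e0 -> e = e0.
  move=> he E; apply/mnmP => i.
  pose x (e : multinom n) (i : nat) := if insub i is Some j then e j else 0%N.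
  have xE e' (j : 'I_n) : x e' j = e' j by rewrite /x valK.
  have xM e' : e' \in msupp P -> forall i, (i < n)%N -> (x e' i < M)%N.
    by move=> he' j hj; rewrite (xE e' (Ordinal hj)) eM.
  have := @digits_inj n M (x e) (x e0) (xM _ he).
  have he0 : e0 \in msupp P by rewrite mcoeff_msupp.
  move=> /(_ (xM _ he0)); under eq_bigr do rewrite xE.
  under [X in _ = X -> _]eq_bigr do rewrite xE.
  by move=> /(_ E i (ltn_ord i)); rewrite !xE.
pose q : {poly R} := \sum_(e <- msupp P) mcoeff e P *: 'X^(k e).
have q0 t : q.[t] = 0.
  rewrite -(h (\row_i t ^+ (M ^ i)%N)) /q horner_sum /peval mevalE.
  apply: eq_bigr => e _; rewrite hornerZ hornerXn -prodrXr; congr (_ * _).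
  by apply: eq_bigr => i _; rewrite mxE -exprM.
have : q`_(k e0) = 0.
  apply: (@horner_small q (k e0).+1 0) (ltnSn _).
  by near=> t; rewrite q0 normr0 mul0r.
rewrite /q coef_sum (bigD1_seq e0) ?msupp_uniq ?mcoeff_msupp//=.
rewrite coefZ coefXn eqxx mulr1 big1_seq ?addr0; first by move/eqP; rewrite (negbTE Pe0).
move=> e /andP[ee0 he]; rewrite coefZ coefXn.
case: (eqVneq (k e0) (k e)) => [E|]; last by rewrite mulr0.
by move: ee0; rewrite (k_inj e)// eqxx.
Unshelve. all: by end_near. Qed.

Definition dil n (w : 'I_n -> nat) (t : R) (v : 'rV[R]_n) : 'rV[R]_n :=
  \row_i (t ^+ w i * v 0 i).

Lemma prod_dil n (w : 'I_n -> nat) t (v : 'rV[R]_n) (e : multinom n) :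
  \prod_(i < n) (dil w t v 0 i) ^+ e i = t ^+ wt w e * \prod_(i < n) (v 0 i) ^+ e i.
Proof.
rewrite /wt -prodrXr -big_split /=.
by apply: eq_bigr => i _; rewrite mxE exprMn exprM.
Qed.

Lemma peval_dil n (w : 'I_n -> nat) j (P : mpoly n R) t v :
  psupp (fun e => wt w e = j) P -> peval P (dil w t v) = t ^+ j * peval P v.
Proof.
move=> h; rewrite /peval !mevalE mulr_sumr big_seq [RHS]big_seq.
apply: eq_bigr => e he; rewrite prod_dil h -?mcoeff_msupp//; ring.
Qed.

(** For fixed v, the value of P at dil w t v is a polynomial in t, whose
    coefficient of degree mu is the value at v of the part of weight mu of P. *)
Lemma small_polynomial n (w : 'I_n -> nat) j (P : mpoly n R) :
  (forall v, exists C, \forall t \near (0 : R)^'+, `|peval P (dil w t v)| <= C * t ^+ j) ->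
  psupp (fun e => j <= wt w e)%N P.
Proof.
move=> h e0 Pe0; rewrite leqNgt; apply/negP => we0.
have : wpart w (wt w e0) P = 0.
  apply: mpoly_eq0_meval => v; have [C hC] := h v.
  pose q : {poly R} := \sum_(e <- msupp P)
    (mcoeff e P * \prod_(i < n) (v 0 i) ^+ e i) *: 'X^(wt w e).
  have qE t : q.[t] = peval P (dil w t v).
    rewrite /q horner_sum /peval mevalE; apply: eq_bigr => e _.
    by rewrite prod_dil hornerZ hornerXn; ring.
  have hq : \forall t \near (0 : R)^'+, `|q.[t]| <= C * t ^+ j.
    by apply: filterS hC => t; rewrite qE.
  rewrite -(horner_small hq we0) /q coef_sum /peval /wpart raddf_sum /= big_mkcond /=.
  apply: eq_bigr => e _; rewrite coefZ coefXn eq_sym.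
  by case: eqP => _; rewrite ?mulr0// mulr1 mevalZ mevalX.
move/(congr1 (mcoeff e0)); rewrite mcoeff_wpart eqxx mcoeff0 => /eqP.
by rewrite (negbTE Pe0).
Qed.

Lemma box_dil n (w : 'I_n -> nat) c t (v : 'rV[R]_n) : (forall i, (0 < w i)%N) ->
  0 <= t -> 1 <= c -> `|v| <= c -> box w (c * t) (dil w t v).
Proof.
move=> w0 t0 c1 vc i; have c0 : 0 <= c by apply: le_trans c1.
rewrite mxE normrM ger0_norm ?exprn_ge0// exprMn mulrC.
rewrite ler_wpM2r ?exprn_ge0//; apply: le_trans (coord_le_norm _ _) _.
by apply: le_trans vc _; rewrite -{1}[c]expr1; apply: ler_weXn2l.
Qed.

Lemma wO_dil n (w : 'I_n -> nat) j f (v : 'rV[R]_n) : (forall i, (0 < w i)%N) ->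
  wO w j f -> exists C, \forall t \near (0 : R)^'+, `|f (dil w t v)| <= C * t ^+ j.
Proof.
move=> w0 [C C0 h]; pose c := 1 + `|v|.
have c0 : 0 < c by rewrite ltr_pwDl.
exists (C * c ^+ j); have h' := right_scale c0 h; near=> t.
have t0 : 0 < t by near: t; exact: right_gt0.
have ht : forall u, box w (c * t) u -> `|f u| <= C * (c * t) ^+ j by near: t.
rewrite -mulrA -exprMn; apply: ht; apply: box_dil => //; rewrite ?(ltW t0)//.
  by rewrite lerDl.
by rewrite lerDr.
Unshelve. all: by end_near. Qed.

Lemma wO_psupp n (w : 'I_n -> nat) j (P : mpoly n R) : (forall i, (0 < w i)%N) ->
  wO w j (peval P) -> psupp (fun e => j <= wt w e)%N P.
Proof. by move=> w0 h; apply: small_polynomial => v; exact: wO_dil. Qed.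

End WeightedPolynomials.

(** * The homological equation *)

Section Monomials.
Variable R : realType.

Lemma expo_a i p s : expo i p s ia = i. Proof. by rewrite multinomE (tnth_nth 0%N). Qed.
Lemma expo_b i p s : expo i p s ib = p. Proof. by rewrite multinomE (tnth_nth 0%N). Qed.
Lemma expo_x i p s : expo i p s ix = s. Proof. by rewrite multinomE (tnth_nth 0%N). Qed.
Definition expoE := (expo_a, expo_b, expo_x).

Lemma ord3P (P : 'I_3 -> Prop) : P ia -> P ib -> P ix -> forall i, P i.
Proof.
move=> ha hb hx [[|[|[|//]]] hi].
- by have -> : Ordinal hi = ia by exact: val_inj.
- by have -> : Ordinal hi = ib by exact: val_inj.
- by have -> : Ordinal hi = ix by exact: val_inj.
Qed.

Lemma ord2P (P : 'I_2 -> Prop) : P fst2 -> P snd2 -> forall i, P i.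
Proof.
move=> ha hb [[|[|//]] hi].
- by have -> : Ordinal hi = fst2 by exact: val_inj.
- by have -> : Ordinal hi = snd2 by exact: val_inj.
Qed.

Lemma multinom3E (e : multinom 3) : e = expo (e ia) (e ib) (e ix).
Proof. by apply/mnmP; apply: ord3P; rewrite expoE. Qed.

Lemma expoD i p s i' p' s' :
  mnm_add (expo i p s) (expo i' p' s') = expo (i + i') (p + p') (s + s').
Proof. by apply/mnmP; apply: ord3P; rewrite mnmDE !expoE. Qed.

Lemma monoM i p s i' p' s' :
  mono R i p s * mono R i' p' s' = mono R (i + i') (p + p') (s + s').
Proof. by rewrite /mono -mpolyXD expoD. Qed.

Lemma mono0 : mono R 0 0 0 = 1.
Proof.
rewrite /mono -mpolyX0; congr (mpolyX R _); apply/mnmP; apply: ord3P;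
by rewrite expoE mnm0E.
Qed.

Lemma monoX i p s r : mono R i p s ^+ r = mono R (r * i) (r * p) (r * s).
Proof.
elim: r => [|r IH]; first by rewrite expr0 !mul0n mono0.
by rewrite exprS IH monoM !mulSn.
Qed.

Lemma big_ord2 (T : Type) (idx : T) (op : Monoid.law idx) (F : 'I_2 -> T) :
  \big[op/idx]_(i < 2) F i = op (F fst2) (F snd2).
Proof.
rewrite !big_ord_recl big_ord0 Monoid.mulm1; congr (op (F _) (F _)); exact: val_inj.
Qed.

Lemma big_ord3 (T : Type) (idx : T) (op : Monoid.law idx) (F : 'I_3 -> T) :
  \big[op/idx]_(i < 3) F i = op (F ia) (op (F ib) (F ix)).
Proof.
rewrite !big_ord_recl big_ord0 Monoid.mulm1.
by congr (op (F _) (op (F _) (F _))); exact: val_inj.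
Qed.

Lemma mderiv_b_mono i p s : mderiv ib (mono R i p s) = p%:R *: mono R i p.-1 s.
Proof.
rewrite /mono mderivX expoE; congr (_ *: mpolyX R _); apply/mnmP.
by apply: ord3P; rewrite mnmBE mnm1E !expoE ?subn0 ?subn1.
Qed.

Lemma mderiv_x_mono i p s : mderiv ix (mono R i p s) = s%:R *: mono R i p s.-1.
Proof.
rewrite /mono mderivX expoE; congr (_ *: mpolyX R _); apply/mnmP.
by apply: ord3P; rewrite mnmBE mnm1E !expoE ?subn0 ?subn1.
Qed.

Lemma mderiv_a_mono i p s : mderiv ia (mono R i p s) = i%:R *: mono R i.-1 p s.
Proof.
rewrite /mono mderivX expoE; congr (_ *: mpolyX R _); apply/mnmP.
by apply: ord3P; rewrite mnmBE mnm1E !expoE ?subn0 ?subn1.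
Qed.

End Monomials.

Section Weights.
Variable k : nat.

Definition w3 (i : 'I_3) : nat := if i == ia then k else 1.
Definition wxy (i : 'I_2) : nat := if i == fst2 then 1 else k.
Definition wab (i : 'I_2) : nat := if i == fst2 then k else 1.

Lemma wt_w3 e : wt w3 e = (k * e ia + e ib + e ix)%N.
Proof. by rewrite /wt big_ord3 /= !mul1n addnA. Qed.

Lemma wt_wxy e : wt wxy e = (e fst2 + k * e snd2)%N.
Proof. by rewrite /wt big_ord2 /= !mul1n. Qed.

Lemma wt_wab e : wt wab e = (k * e fst2 + e snd2)%N.
Proof. by rewrite /wt big_ord2 /= !mul1n. Qed.

End Weights.

Lemma bilinear_split (T : comNzRingType) (a a' b b' c c' d d' p q : T) :
  (a + a') - (b + b') - p * (c + c') - q * (d + d') =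
  (a - b - p * c - q * d) + (a' - b' - p * c' - q * d').
Proof. by ring. Qed.

Lemma split_product (T : comNzRingType) (d y t w a : T) :
  d * (y * t) = w * (y * a) + ((d - w) * (y * a) + d * (y * (t - a))).
Proof. by ring. Qed.

Section Homological.
Variables (R : realType) (k m n : nat) (gamma : nat -> R).
Hypotheses (m_gt0 : (0 < m)%N) (n_gt0 : (0 < n)%N) (mnk : (m + n = k)%N).

Let M := model k m n gamma.

Definition restrict_xy (g : mpoly 2 R) : mpoly 3 R :=
  comp_mpoly [tuple mono R 0 0 1; M] g.
Definition lift_ab (h : mpoly 2 R) : mpoly 3 R :=
  comp_mpoly [tuple mono R 1 0 0; mono R 0 1 0] h.

(** The change of the component of weight nu of F under X = x + f, Y = y + g,
    A = a + h, B = b + e, to first order and with F replaced by the model. *)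
Definition homological (f g h e : mpoly 2 R) : mpoly 3 R :=
  restrict_xy g - lift_ab h - mderiv ib M * lift_ab e - mderiv ix M * restrict_xy f.

Variable nu : nat.

Definition normal_part (e : multinom 3) :=
  wt (w3 k) e = nu /\ ~ excluded k m n nu (e ia) (e ib) (e ix).

(** Z is congruent to a sum of non-excluded monomials modulo the image of the
    operator homological. The Z of this kind form a vector space, and the
    following lemmas show that it contains all monomials of weight nu. *)
Definition normalizable (Z : mpoly 3 R) := exists f g h e : mpoly 2 R,
  [/\ psupp (fun u => wt (wxy k) u + k = nu.+1)%N f,
      psupp (fun u => wt (wxy k) u = nu) g,
      psupp (fun u => wt (wab k) u = nu) h,
      psupp (fun u => wt (wab k) u + k = nu.+1)%N e &
      psupp normal_part (Z + homological f g h e)].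

Lemma homologicalD f g h e f' g' h' e' :
  homological (f + f') (g + g') (h + h') (e + e') =
  homological f g h e + homological f' g' h' e'.
Proof. rewrite /homological /restrict_xy /lift_ab !comp_mpolyD; exact: bilinear_split. Qed.

Lemma homologicalZ c f g h e :
  homological (c *: f) (c *: g) (c *: h) (c *: e) = c *: homological f g h e.
Proof.
rewrite /homological /restrict_xy /lift_ab !comp_mpolyZ !scalerBr -!scalerAr//.
Qed.

Lemma homological0 : homological 0 0 0 0 = 0.
Proof. by have := homologicalZ 0 0 0 0 0; rewrite !scale0r. Qed.

Lemma normalizable_normal Z : psupp normal_part Z -> normalizable Z.
Proof.
move=> h; exists 0, 0, 0, 0; rewrite homological0 addr0.
by split=> //; exact: psupp0.
Qed.

Lemma normalizableD Z Z' : normalizable Z -> normalizable Z' -> normalizable (Z + Z').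
Proof.
case=> f [g [h [e [h1 h2 h3 h4 h5]]]] [f' [g' [h' [e' [h1' h2' h3' h4' h5']]]]].
exists (f + f'), (g + g'), (h + h'), (e + e'); split; try exact: psuppD.
by rewrite homologicalD (addrACA Z); exact: (psuppD h5 h5').
Qed.

Lemma normalizableZ c Z : normalizable Z -> normalizable (c *: Z).
Proof.
case=> f [g [h [e [h1 h2 h3 h4 h5]]]].
exists (c *: f), (c *: g), (c *: h), (c *: e); split; try exact: psuppZ.
by rewrite homologicalZ -scalerDr; exact: psuppZ.
Qed.

Lemma normalizableB Z Z' : normalizable Z -> normalizable Z' -> normalizable (Z - Z').
Proof. by move=> h h'; rewrite -scaleN1r; apply: normalizableD => //; exact: normalizableZ. Qed.

Lemma normalizable0 : normalizable 0.
Proof. by apply: normalizable_normal; exact: psupp0. Qed.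

Lemma normalizable_cancel c Z : c != 0 -> normalizable (c *: Z) -> normalizable Z.
Proof. by move=> c0 /(normalizableZ c^-1); rewrite scalerA mulVf// scale1r. Qed.

Lemma normalizable_subl Z Z' : normalizable Z' -> normalizable (Z + Z') -> normalizable Z.
Proof. by move=> h' h; have := normalizableB h h'; rewrite addrK. Qed.

Lemma normalizable_supp S Z : psupp S Z ->
  (forall i p s, S (expo i p s) -> normalizable (mono R i p s)) -> normalizable Z.
Proof.
move=> hZ h; rewrite (mpolyE Z) big_seq; elim/big_ind: _ => [|Q Q'|e].
- exact: normalizable0.
- exact: normalizableD.
- rewrite mcoeff_msupp => /hZ; rewrite (multinom3E e) => /h; exact: normalizableZ.
Qed.

Lemma normalizable_g g : psupp (fun u => wt (wxy k) u = nu) g ->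
  normalizable (restrict_xy g).
Proof.
move=> hg; exists 0, (- g), 0, 0; split; try exact: psupp0; first exact: psuppN.
have -> : restrict_xy g + homological 0 (- g) 0 0 = 0.
  rewrite /homological /restrict_xy /lift_ab !comp_mpoly0 comp_mpolyN; ring.
exact: psupp0.
Qed.

Lemma normalizable_h h : psupp (fun u => wt (wab k) u = nu) h ->
  normalizable (lift_ab h).
Proof.
move=> hg; exists 0, 0, h, 0; split; try exact: psupp0; first by [].
have -> : lift_ab h + homological 0 0 h 0 = 0.
  rewrite /homological /restrict_xy /lift_ab !comp_mpoly0; ring.
exact: psupp0.
Qed.

Lemma normalizable_e e : psupp (fun u => wt (wab k) u + k = nu.+1)%N e ->
  normalizable (mderiv ib M * lift_ab e).
Proof.
move=> hg; exists 0, 0, 0, e; split; try exact: psupp0; first by [].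
have -> : mderiv ib M * lift_ab e + homological 0 0 0 e = 0.
  rewrite /homological /restrict_xy /lift_ab !comp_mpoly0; ring.
exact: psupp0.
Qed.

Lemma normalizable_f f : psupp (fun u => wt (wxy k) u + k = nu.+1)%N f ->
  normalizable (mderiv ix M * restrict_xy f).
Proof.
move=> hg; exists f, 0, 0, 0; split; try exact: psupp0; first by [].
have -> : mderiv ix M * restrict_xy f + homological f 0 0 0 = 0.
  rewrite /homological /restrict_xy /lift_ab !comp_mpoly0; ring.
exact: psupp0.
Qed.

Definition mono2 p q : mpoly 2 R := mpolyX R (Multinom [tuple p; q]).

Lemma mono2_fst p q : Multinom [tuple p; q] fst2 = p.
Proof. by rewrite multinomE (tnth_nth 0%N). Qed.
Lemma mono2_snd p q : Multinom [tuple p; q] snd2 = q.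
Proof. by rewrite multinomE (tnth_nth 0%N). Qed.

Lemma restrict_mono p q : restrict_xy (mono2 p q) = mono R 0 0 p * M ^+ q.
Proof.
rewrite /restrict_xy comp_mpolyX big_ord2 mono2_fst mono2_snd !(tnth_nth 0) /=.
by rewrite monoX !muln0 muln1.
Qed.

Lemma lift_mono p q : lift_ab (mono2 p q) = mono R p q 0.
Proof.
rewrite /lift_ab comp_mpolyX big_ord2 mono2_fst mono2_snd !(tnth_nth 0) /=.
by rewrite !monoX monoM !muln0 !muln1 !addn0 add0n.
Qed.

Lemma normal_h i d : (k * i + d = nu)%N -> normalizable (mono R i d 0).
Proof.
move=> E; rewrite -lift_mono; apply: normalizable_h; apply: psuppX.
by rewrite wt_wab mono2_fst mono2_snd.
Qed.

Lemma normal_g i d : (k * i + d = nu)%N -> normalizable (mono R 0 0 d * M ^+ i).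
Proof.
move=> E; rewrite -restrict_mono; apply: normalizable_g; apply: psuppX.
by rewrite wt_wxy mono2_fst mono2_snd addnC.
Qed.

Lemma normal_e i s : (k * i + s + k = nu.+1)%N ->
  normalizable (mderiv ib M * mono R i s 0).
Proof.
move=> E; rewrite -lift_mono; apply: normalizable_e; apply: psuppX.
by rewrite wt_wab mono2_fst mono2_snd.
Qed.

Lemma normal_f i s : (k * i + s + k = nu.+1)%N ->
  normalizable (mderiv ix M * (mono R 0 0 s * M ^+ i)).
Proof.
move=> E; rewrite -restrict_mono; apply: normalizable_f; apply: psuppX.
by rewrite wt_wxy mono2_fst mono2_snd addnAC addnC addnA addnAC -addnA addnC -E; lia.
Qed.

(** The exponents of a^i b^p x^s with p >= p0 and p + s = d. The model, its
    derivatives and the powers of q are each the sum of a leading monomial and of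
    terms with a higher power of b, collected by this predicate. *)
Definition tail i p0 d (e : multinom 3) :=
  [/\ e ia = i, (p0 <= e ib)%N & (e ib + e ix = d)%N].

Let q : mpoly 3 R := mono R 0 m n + \sum_(m.+1 <= j < k) gamma j *: mono R 0 j (k - j).

Let ME : M = mono R 1 0 0 + q.
Proof. by rewrite /M /model /q addrA. Qed.

Let q_tail : psupp (tail 0 m.+1 k) (q - mono R 0 m n).
Proof.
rewrite /q addrC addKr; apply: psupp_sum => j; rewrite mem_index_iota => /andP[h1 h2] _.
apply: psuppZ; apply: psuppX; rewrite /tail !expoE; split; lia.
Qed.

Let q_supp : psupp (tail 0 m k) q.
Proof.
rewrite -(subrK (mono R 0 m n) q); apply: psuppD.
  by refine (psuppW _ q_tail) => e [h1 h2 h3]; split=> //; exact: ltnW.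
by apply: psuppX; rewrite /tail !expoE; split; lia.
Qed.

Let tailM i p0 d i' p0' d' e e' : tail i p0 d e -> tail i' p0' d' e' ->
  tail (i + i') (p0 + p0') (d + d') (mnm_add e e').
Proof. by case=> a1 a2 a3 [b1 b2 b3]; split; rewrite !mnmDE; lia. Qed.

Let qX_supp r : psupp (tail 0 (r * m) (r * k)) (q ^+ r).
Proof.
elim: r => [|r IH]; first by rewrite expr0 -mono0; apply: psuppX; rewrite /tail !expoE; split; lia.
rewrite exprS !mulSn; apply: (psuppM _ q_supp IH) => e e'; exact: tailM.
Qed.

Let qX_tail r : psupp (tail 0 (r * m).+1 (r * k)) (q ^+ r - mono R 0 (r * m) (r * n)).
Proof.
elim: r => [|r IH]; first by rewrite expr0 !mul0n mono0 subrr; exact: psupp0.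
rewrite exprS.
have -> : q * q ^+ r - mono R 0 (r.+1 * m) (r.+1 * n) =
  (q - mono R 0 m n) * q ^+ r + mono R 0 m n * (q ^+ r - mono R 0 (r * m) (r * n)).
  have -> : mono R 0 (r.+1 * m) (r.+1 * n) = mono R 0 m n * mono R 0 (r * m) (r * n).
    by rewrite monoM !mulSn.
  by ring.
rewrite !mulSn; apply: psuppD.
  by apply: (psuppM _ q_tail (@qX_supp r)) => e e'; rewrite -addSn; exact: tailM.
have hm : psupp (tail 0 m k) (mono R 0 m n) by apply: psuppX; rewrite /tail !expoE; split; lia.
by apply: (psuppM _ hm IH) => e e'; rewrite -addnS; exact: tailM.
Qed.

Let mderiv_psupp S i P : psupp S P -> psupp (fun e => S (mnm_add e (mnm1 i))) (mderiv i P : mpoly 3 R).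
Proof.
move=> h e; rewrite mcoeff_deriv => h0; apply: h; apply: contraNneq h0 => ->.
by rewrite mul0rn.
Qed.

Let Mb_tail : psupp (tail 0 m k.-1) (mderiv ib M - m%:R *: mono R 0 m.-1 n).
Proof.
rewrite ME mderivD (mderiv_b_mono R 1 0 0) scale0r add0r -mderiv_b_mono -mderivB.
refine (psuppW _ (mderiv_psupp q_tail)) => e [].
by rewrite !mnmDE !mnm1E /= => h1 h2 h3; split; lia.
Qed.

Let Mx_tail : psupp (tail 0 m.+1 k.-1) (mderiv ix M - n%:R *: mono R 0 m n.-1).
Proof.
rewrite ME mderivD (mderiv_x_mono R 1 0 0) scale0r add0r -mderiv_x_mono -mderivB.
refine (psuppW _ (mderiv_psupp q_tail)) => e [].
by rewrite !mnmDE !mnm1E /= => h1 h2 h3; split; lia.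
Qed.

Definition lower i d (e : multinom 3) := (e ia < i)%N /\ (k * e ia + e ib + e ix = d)%N.

Let MX_lower i : psupp (lower i (k * i)) (M ^+ i - mono R i 0 0).
Proof.
elim: i => [|i IH]; first by rewrite expr0 mono0 subrr; exact: psupp0.
have hM : psupp (fun e => (e ia <= i)%N /\ (k * e ia + e ib + e ix = k * i)%N) (M ^+ i).
  rewrite -(subrK (mono R i 0 0) (M ^+ i)); apply: psuppD.
    by refine (psuppW _ IH) => e [h1 h2]; split=> //; exact: ltnW.
  by apply: psuppX; rewrite !expoE !addn0.
have -> : M ^+ i.+1 - mono R i.+1 0 0 = mono R 1 0 0 * (M ^+ i - mono R i 0 0) + q * M ^+ i.
  have -> : mono R i.+1 0 0 = mono R 1 0 0 * mono R i 0 0 by rewrite monoM add1n.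
  rewrite exprS ME; ring.
apply: psuppD.
- have ha : psupp (fun e => e = expo 1 0 0) (mono R 1 0 0) by exact: psuppX.
  apply: (psuppM _ ha IH) => e1 e [-> [h1 h2]].
  by rewrite /lower !mnmDE !expoE; lia.
- apply: (psuppM _ q_supp hM) => e e' [h1 h2 h3] [h4 h5].
  by rewrite /lower !mnmDE; lia.
Qed.

(** M_b a^i b^s = m a^i b^(m-1+s) x^n + terms with a higher power of b. *)
Let step_e i s d : (k * i + d = nu)%N -> (d.+1 = k + s)%N ->
  (forall p' s', (p' + s' = d)%N -> (m + s <= p')%N -> normalizable (mono R i p' s')) ->
  normalizable (mono R i (m.-1 + s) n).
Proof.
move=> Ed Es ht.
have h : normalizable (mderiv ib M * mono R i s 0) by apply: normal_e; lia.
have E : mderiv ib M * mono R i s 0 = m%:R *: mono R i (m.-1 + s) n +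
    (mderiv ib M - m%:R *: mono R 0 m.-1 n) * mono R i s 0.
  by rewrite mulrBl -scalerAl monoM add0n addn0 addrC subrK.
apply: (@normalizable_cancel m%:R); first by rewrite pnatr_eq0 -lt0n.
apply: normalizable_subl (_ : normalizable ((mderiv ib M - m%:R *: mono R 0 m.-1 n) * mono R i s 0)) _.
  have hs : psupp (fun e => e = expo i s 0) (mono R i s 0) by exact: psuppX.
  have h2 : psupp (tail i (m + s) d) ((mderiv ib M - m%:R *: mono R 0 m.-1 n) * mono R i s 0).
    apply: (psuppM _ Mb_tail hs) => e1 e [h1 h2 h3] ->.
    by rewrite /tail !mnmDE !expoE; split; lia.
  apply: (normalizable_supp h2) => i' p' s'; rewrite /tail !expoE => -[-> h1 h3].
  exact: ht.
by rewrite -E.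
Qed.

(** M^i x^d = a^i x^d + terms of lower degree in a. *)
Let step_g i d : (k * i + d = nu)%N ->
  (forall i' p' s', (i' < i)%N -> (k * i' + p' + s' = nu)%N -> normalizable (mono R i' p' s')) ->
  normalizable (mono R i 0 d).
Proof.
move=> Ed hl; have h := normal_g Ed.
have E : mono R 0 0 d * M ^+ i = mono R i 0 d + mono R 0 0 d * (M ^+ i - mono R i 0 0).
  by rewrite mulrBr monoM !add0n addn0 addrC subrK.
apply: normalizable_subl (_ : normalizable (mono R 0 0 d * (M ^+ i - mono R i 0 0))) _.
  have hs : psupp (fun e => e = expo 0 0 d) (mono R 0 0 d) by exact: psuppX.
  have h2 : psupp (lower i nu) (mono R 0 0 d * (M ^+ i - mono R i 0 0)).
    apply: (psuppM _ hs (@MX_lower i)) => e1 e -> [h1 h2].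
    by rewrite /lower !mnmDE !expoE; split; lia.
  apply: (normalizable_supp h2) => i' p' s'; rewrite /lower !expoE => -[h1 h3].
  exact: hl.
by rewrite -E.
Qed.

(** M_x M^i x^s = n a^i b^m x^(n-1+s) + terms with a higher power of b, or of
    lower degree in a. *)
Let step_f i s d : (k * i + d = nu)%N -> (d.+1 = k + s)%N ->
  (forall i' p' s', (i' < i)%N -> (k * i' + p' + s' = nu)%N -> normalizable (mono R i' p' s')) ->
  (forall p' s', (p' + s' = d)%N -> (m < p')%N -> normalizable (mono R i p' s')) ->
  normalizable (mono R i m (n.-1 + s)).
Proof.
move=> Ed Es hl ht.
have h : normalizable (mderiv ix M * (mono R 0 0 s * M ^+ i)) by apply: normal_f; lia.
pose D := mderiv ix M - n%:R *: mono R 0 m n.-1.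
pose P := M ^+ i - mono R i 0 0.
have E : mderiv ix M * (mono R 0 0 s * M ^+ i) = n%:R *: mono R i m (n.-1 + s) +
   (D * mono R i 0 s + mderiv ix M * (mono R 0 0 s * P)).
  have -> : n%:R *: mono R i m (n.-1 + s) = (n%:R *: mono R 0 m n.-1) * mono R i 0 s.
    by rewrite -scalerAl monoM !add0n addn0.
  have -> : mono R i 0 s = mono R 0 0 s * mono R i 0 0 by rewrite monoM !addn0 !add0n.
  exact: split_product.
apply: (@normalizable_cancel n%:R); first by rewrite pnatr_eq0 -lt0n.
apply: normalizable_subl (_ : normalizable (D * mono R i 0 s + mderiv ix M * (mono R 0 0 s * P))) _; last by rewrite -E.
apply: normalizableD.
- have hs : psupp (fun e => e = expo i 0 s) (mono R i 0 s) by exact: psuppX.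
  have h2 : psupp (tail i m.+1 d) (D * mono R i 0 s).
    apply: (psuppM _ Mx_tail hs) => e1 e [h1 h2 h3] ->.
    by rewrite /tail !mnmDE !expoE; split; lia.
  apply: (normalizable_supp h2) => i' p' s'; rewrite /tail !expoE => -[-> h1 h3].
  exact: ht.
- have hs : psupp (fun e => e = expo 0 0 s) (mono R 0 0 s) by exact: psuppX.
  have h2 : psupp (lower i (k * i + s)) (mono R 0 0 s * P).
    apply: (psuppM _ hs (@MX_lower i)) => e1 e -> [h1 h2].
    by rewrite /lower !mnmDE !expoE; split; lia.
  have hx : psupp (tail 0 0 k.-1) (mderiv ix M).
    rewrite -(subrK (n%:R *: mono R 0 m n.-1) (mderiv ix M)); apply: psuppD.
      by refine (psuppW _ Mx_tail) => e [].
    by apply: psuppZ; apply: psuppX; rewrite /tail !expoE; split; lia.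
  have h3 : psupp (lower i nu) (mderiv ix M * (mono R 0 0 s * P)).
    apply: (psuppM _ hx h2) => e1 e [a1 a2 a3] [b1 b2].
    by rewrite /lower !mnmDE; split; lia.
  apply: (normalizable_supp h3) => i' p' s'; rewrite /lower !expoE => -[c1 c3].
  exact: hl.
Qed.

Let excludedP i p s d : (k * i + d = nu)%N -> (p + s = d)%N ->
  normalizable (mono R i p s) \/
  [\/ p = 0, s = 0 | [\/ p = m /\ n.-1 <= s, s = n /\ m.-1 <= p,
    p = 2 * m /\ s = 2 * n | p = 3 * m /\ s = 3 * n]]%N.
Proof.
move=> Ed Es; have [h|h] := pselect (excluded k m n nu i p s); last first.
  left; apply: normalizable_normal; apply: psuppX.
  by rewrite /normal_part wt_w3 !expoE; split=> //; lia.
right; have : (k * i + p + s = nu)%N by lia.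
case: h => [i' j' _|i' j' _|i' j' _|i' j' _|i' _|i' _|i' m1 _|i' n1 _] hw.
- by apply: Or31.
- by apply: Or32.
- by apply: Or33; apply: Or41; split=> //; lia.
- by apply: Or33; apply: Or42; split=> //; lia.
- by apply: Or33; apply: Or43.
- by apply: Or33; apply: Or44.
- by apply: Or33; apply: Or41; split=> //; lia.
- by apply: Or33; apply: Or42; split=> //; lia.
Qed.

Let normal_bottom i p s d : (k * i + d = nu)%N -> (p + s = d)%N ->
  (m < p)%N -> (s < n)%N -> normalizable (mono R i p s).
Proof.
move=> Ed Es mp sn; case: (excludedP Ed Es) => [//|[p0|s0|[[h _]|[h _]|[h1 h2]|[h1 h2]]]]; try lia.
by rewrite s0; apply: normal_h; lia.
Qed.

Let normal_xn i p d : (k * i + d = nu)%N -> (p + n = d)%N -> (m <= p)%N ->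
  normalizable (mono R i p n).
Proof.
move=> Ed Es mp; have -> : (p = m.-1 + (d.+1 - k))%N by lia.
apply: (step_e Ed); first by lia.
move=> p' s' E' hp'; apply: (normal_bottom Ed E'); lia.
Qed.

Let normal_tail i p s d : (k * i + d = nu)%N -> (p + s = d)%N -> (m < p)%N ->
  ~ (p = 2 * m /\ s = 2 * n)%N -> ~ (p = 3 * m /\ s = 3 * n)%N ->
  normalizable (mono R i p s).
Proof.
move=> Ed Es mp h2 h3.
case: (excludedP Ed Es) => [//|[p0|s0|[[h _]|[h _]|h|h]]]; try lia; try by [].
- by rewrite s0; apply: normal_h; lia.
- rewrite h; apply: (normal_xn Ed); lia.
Qed.

(** The elimination at a fixed degree in a. Its order matters: powers of b above m
    come first, then b^m, then b^(m-1) x^n, because the terms left over by each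
    generator have to be dealt with already; the pure powers of x and b come from
    g and h. *)
Let normal_level i d : (k * i + d = nu)%N ->
  (forall i' p' s', (i' < i)%N -> (k * i' + p' + s' = nu)%N -> normalizable (mono R i' p' s')) ->
  (d = 2 * k -> normalizable (mono R i (2 * m) (2 * n)))%N ->
  (d = 3 * k -> normalizable (mono R i (3 * m) (3 * n)))%N ->
  forall p s, (p + s = d)%N -> normalizable (mono R i p s).
Proof.
move=> Ed hl u2 u3.
have tl p s : (p + s = d)%N -> (m < p)%N -> normalizable (mono R i p s).
  move=> Es mp.
  have [[e1 e2]|h2] := pselect (p = 2 * m /\ s = 2 * n)%N.
    by rewrite e1 e2; apply: u2; lia.
  have [[e1 e2]|h3] := pselect (p = 3 * m /\ s = 3 * n)%N.
    by rewrite e1 e2; apply: u3; lia.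
  exact: normal_tail Ed Es mp h2 h3.
have atm s : (m + s = d)%N -> (n.-1 <= s)%N -> normalizable (mono R i m s).
  move=> Es ns; have -> : (s = n.-1 + (d.+1 - k))%N by lia.
  apply: (step_f Ed) => //; lia.
move=> p s Es.
case: (excludedP Ed Es) => [//|[p0|s0|[[pm h]|[h h']|[h1 h2]|[h1 h2]]]].
- have -> : s = d by lia.
  by rewrite p0; exact: step_g.
- by rewrite s0; apply: normal_h; lia.
- by rewrite pm; apply: atm => //; lia.
- have [mp|mp] := ltnP m p; first exact: tl.
  have [pm|pm] := eqVneq p m; first by rewrite pm; apply: atm; lia.
  have -> : (p = m.-1 + (d.+1 - k))%N by lia.
  rewrite h; apply: (step_e Ed); first by lia.
  move=> p' s' E' hp'; have [mp'|mp'] := ltnP m p'; first exact: tl.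
  have -> : p' = m by lia.
  by apply: atm; lia.
- by rewrite h1 h2; apply: u2; lia.
- by rewrite h1 h2; apply: u3; lia.
Qed.

(** In degree at least 4k in (b, x) the monomials b^(2m) x^(2n) and
    b^(3m) x^(3n) do not interfere. *)
Let normal_high i p s : (k * i + p + s = nu)%N -> (4 * k <= p + s)%N ->
  normalizable (mono R i p s).
Proof.
elim/ltn_ind: i p s => i IH p s E h.
apply: (@normal_level i (p + s)) => //; try lia.
move=> i' p' s' hi E'; apply: IH => //.
have : (k * i' <= k * i)%N by rewrite leq_mul2l ltnW ?orbT.
lia.
Qed.

Let normalizable_sum (F : nat -> mpoly 3 R) lo hi :
  (forall r, (lo <= r < hi)%N -> normalizable (F r)) ->
  normalizable (\sum_(lo <= r < hi) F r).
Proof.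
move=> h; rewrite big_nat; elim/big_ind: _ => //; first exact: normalizable0.
exact: normalizableD.
Qed.

Section Resonance.
Variable N : nat.
Hypotheses (nuE : nu = (k * N)%N) (N_gt1 : (1 < N)%N).

Let u r := mono R (N - r) (r * m) (r * n).

Let lvl r : (r <= N)%N -> (k * (N - r) + r * k = nu)%N.
Proof. by move=> h; rewrite nuE mulnC -mulnDl subnK// mulnC. Qed.

Let u0 : normalizable (u 0%N).
Proof. by rewrite /u subn0 !mul0n; apply: normal_h; rewrite addn0. Qed.

Let u1 : normalizable (u 1%N).
Proof.
have h : (1 <= N)%N by lia.
rewrite /u !mul1n; have := lvl h; rewrite mul1n => E.
by apply: (normal_xn E).
Qed.

Let u_high r : (4 <= r)%N -> (r <= N)%N -> normalizable (u r).
Proof.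
move=> h1 h2; have := lvl h2; rewrite /u => E.
have e : (r * m + r * n = r * k)%N by rewrite -mulnDr mnk.
have : (4 * k <= r * k)%N by rewrite leq_mul2r h1 orbT.
by move=> h; apply: normal_high; lia.
Qed.

Let u_tail r Z : (0 < r)%N -> (r <= N)%N ->
  psupp (tail (N - r) (r * m).+1 (r * k)) Z -> normalizable Z.
Proof.
move=> r0 rN hZ; apply: (normalizable_supp hZ) => i p s; rewrite /tail !expoE => -[-> h1 h2].
have E := lvl rN.
have [r4|r4] := leqP 4 r.
  have : (4 * k <= r * k)%N by rewrite leq_mul2r r4 orbT.
  by move=> h; apply: normal_high; lia.
apply: (normal_tail E h2).
- apply: leq_trans h1; rewrite ltnS; apply: leq_pmull; exact: r0.
- case=> e1 e2; have : (r * k = 2 * k)%N by rewrite -h2 e1 e2 -mnk; lia.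
  move/eqP; rewrite eqn_pmul2r; last by lia.
  by move=> /eqP E2; move: h1; rewrite E2 e1 ltnn.
- case=> e1 e2; have : (r * k = 3 * k)%N by rewrite -h2 e1 e2 -mnk; lia.
  move/eqP; rewrite eqn_pmul2r; last by lia.
  by move=> /eqP E2; move: h1; rewrite E2 e1 ltnn.
Qed.

Let u_term r c (W : mpoly 3 R) : (0 < r)%N -> (r <= N)%N ->
  psupp (tail 0 (r * m).+1 (r * k)) (W - c *: mono R 0 (r * m) (r * n)) ->
  normalizable (mono R (N - r) 0 0 * W - c *: u r).
Proof.
move=> r0 rN hW; apply: (u_tail r0 rN).
have -> : mono R (N - r) 0 0 * W - c *: u r =
   mono R (N - r) 0 0 * (W - c *: mono R 0 (r * m) (r * n)).
  by rewrite mulrBr -scalerAr monoM addn0.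
have hs : psupp (fun e => e = expo (N - r) 0 0) (mono R (N - r) 0 0) by exact: psuppX.
apply: (psuppM _ hs hW) => e1 e -> [h1 h2 h3].
by rewrite /tail !mnmDE !expoE; split; lia.
Qed.

(** Modulo normalizable polynomials only u_2 and u_3 survive in a combination of
    the u_r: u_0 is a power of a, u_1 comes from e, and u_r for r >= 4 has large
    degree in (b, x). *)
Let pick (c : nat -> R) : ((N < 3)%N -> c 3%N = 0) ->
  normalizable (\sum_(0 <= r < N.+1) c r *: u r) ->
  normalizable (c 2%N *: u 2%N + c 3%N *: u 3%N).
Proof.
move=> c3; do 3 (rewrite big_ltn; last by lia).
have cu r : normalizable (u r) -> normalizable (c r *: u r) by exact: normalizableZ.
rewrite addrC => /(normalizable_subl (cu _ u0)); rewrite addrC => /(normalizable_subl (cu _ u1)).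
have [N3|N3] := ltnP N 3.
  by rewrite big_geq// c3// scale0r.
rewrite big_ltn; last by lia.
rewrite addrA; apply: normalizable_subl; apply: normalizable_sum => r hr.
apply/cu/u_high; lia.
Qed.

(** The binomial expansion of M^N = (a + q)^N, which comes from g = y^N; each
    a^(N-r) q^r equals u_r up to a tail. *)
Let first_relation :
  normalizable ('C(N, 2)%:R *: u 2%N + 'C(N, 3)%:R *: u 3%N).
Proof.
apply: (@pick (fun r => 'C(N, r)%:R)); first by move=> h; rewrite bin_small.
have hM : normalizable (M ^+ N).
  by have := @normal_g N 0; rewrite mono0 mul1r; apply; rewrite addn0.
apply: (@normalizable_subl _ (M ^+ N - \sum_(0 <= r < N.+1) 'C(N, r)%:R *: u r)); last first.
  by rewrite addrC subrK.
have -> : M ^+ N = \sum_(0 <= r < N.+1) 'C(N, r)%:R *: (mono R (N - r) 0 0 * q ^+ r).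
  rewrite ME exprDn big_mkord; apply: eq_bigr => r _.
  by rewrite monoX !muln0 muln1 scaler_nat.
rewrite -sumrB; apply: normalizable_sum => r /andP[_ hr].
rewrite -scalerBr; apply: normalizableZ.
case: r hr => [|r] hr.
  by rewrite expr0 mulr1 /u !mul0n subrr; exact: normalizable0.
rewrite -[u r.+1]scale1r; apply: u_term => //; rewrite scale1r; exact: qX_tail.
Qed.

(** The expansion of x M_x M^(N-1), which comes from f = x y^(N-1); the leading
    term of x M_x is n b^m x^n. *)
Let second_relation :
  normalizable (((N.-1)%:R * n%:R) *: u 2%N + ('C(N.-1, 2)%:R * n%:R) *: u 3%N).
Proof.
pose c r : R := if r is r'.+1 then 'C(N.-1, r')%:R * n%:R else 0.
have -> : (N.-1)%:R * n%:R = c 2%N by rewrite /c bin1.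
apply: (@pick c) => [h|]; first by rewrite /c bin_small ?mul0r//; lia.
pose W r : mpoly 3 R := mderiv ix M * mono R 0 0 1 * q ^+ r.
have hM : normalizable (mderiv ix M * (mono R 0 0 1 * M ^+ N.-1)).
  apply: normal_f; rewrite nuE; have -> : (N = N.-1.+1)%N by lia.
  by rewrite mulnS /=; lia.
rewrite big_ltn// {1}/c scale0r add0r.
apply: (@normalizable_subl _ (mderiv ix M * (mono R 0 0 1 * M ^+ N.-1) -
   \sum_(1 <= r < N.+1) c r *: u r)); last by rewrite addrC subrK.
have -> : mderiv ix M * (mono R 0 0 1 * M ^+ N.-1) =
    \sum_(1 <= r < N.+1) 'C(N.-1, r.-1)%:R *: (mono R (N - r) 0 0 * W r.-1).
  rewrite big_add1 /= mulrA ME exprDn -ME mulr_sumr big_mkord.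
  have -> : N.-1.+1 = N by lia.
  apply: eq_bigr => r _; rewrite monoX !muln0 muln1.
  have -> : (N - r.+1 = N.-1 - r)%N by lia.
  rewrite -scaler_nat -scalerAr; congr (_ *: _).
  by rewrite /W mulrCA mulrA.
rewrite -sumrB; apply: normalizable_sum => -[//|r] /andP[_ hr] /=.
rewrite -scalerA -scalerBr; apply: normalizableZ.
apply: u_term => //; rewrite /W.
have E : mderiv ix M * mono R 0 0 1 * q ^+ r - n%:R *: mono R 0 (r.+1 * m) (r.+1 * n) =
  (mderiv ix M - n%:R *: mono R 0 m n.-1) * mono R 0 0 1 * q ^+ r +
  (n%:R *: mono R 0 m n) * (q ^+ r - mono R 0 (r * m) (r * n)).
  have -> : mono R 0 (r.+1 * m) (r.+1 * n) = mono R 0 m n * mono R 0 (r * m) (r * n).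
    by rewrite monoM !mulSn.
  have -> : n%:R *: mono R 0 m n = (n%:R *: mono R 0 m n.-1) * mono R 0 0 1.
    by rewrite -scalerAl monoM !addn0 addn1 prednK.
  rewrite scalerAl.
  have -> : n%:R *: mono R 0 m n = (n%:R *: mono R 0 m n.-1) * mono R 0 0 1.
    by rewrite -scalerAl monoM !addn0 addn1 prednK.
  by ring.
rewrite E !mulSn; apply: psuppD.
- have hs : psupp (fun e => e = expo 0 0 1) (mono R 0 0 1) by exact: psuppX.
  have h1 : psupp (tail 0 m.+1 k) ((mderiv ix M - n%:R *: mono R 0 m n.-1) * mono R 0 0 1).
    apply: (psuppM _ Mx_tail hs) => e1 e [h1 h2 h3] ->.
    by rewrite /tail !mnmDE !expoE; split; lia.
  by apply: (psuppM _ h1 (@qX_supp r)) => e e'; rewrite -addSn; exact: tailM.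
- have hm : psupp (tail 0 m k) (n%:R *: mono R 0 m n).
    by apply: psuppZ; apply: psuppX; rewrite /tail !expoE.
  by apply: (psuppM _ hm (@qX_tail r)) => e e'; rewrite -addnS; exact: tailM.
Qed.

Let bin2R L : 'C(L.+2, 2)%:R = (L.+2)%:R * (L.+1)%:R / 2 :> R.
Proof.
have E : ('C(L.+2, 2) * 2 = L.+2 * L.+1)%N.
  by have := bin_ffact L.+2 2; rewrite !ffactnS ffactn0 !factS fact0 !muln1.
by rewrite -natrM -E natrM mulfK ?pnatr_eq0.
Qed.

Let bin3R L : 'C(L.+3, 3)%:R = (L.+3)%:R * (L.+2)%:R * (L.+1)%:R / 6 :> R.
Proof.
have E : ('C(L.+3, 3) * 6 = L.+3 * L.+2 * L.+1)%N.
  by have := bin_ffact L.+3 3; rewrite !ffactnS ffactn0 !factS fact0 !muln1 -mulnA.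
by rewrite -!natrM -E natrM mulfK ?pnatr_eq0.
Qed.

(** Eliminates u_2 from the two relations. *)
Let normal_u3 : (2 < N)%N -> normalizable (u 3%N).
Proof.
move=> N3; have [L NE] : exists L, N = L.+3 by exists (N - 3)%N; lia.
have r1 := first_relation; have r2 := second_relation.
have h := normalizableB (normalizableZ ((N.-1)%:R * n%:R) r1) (normalizableZ ('C(N, 2)%:R) r2).
rewrite !scalerDr !scalerA in h.
set x2 := _ *: u 2%N in h.
have E : 'C(N, 2)%:R * ((N.-1)%:R * n%:R) *: u 2%N = x2 by rewrite /x2 mulrC.
rewrite E opprD addrACA subrr add0r -scalerBl in h.
apply: normalizable_cancel h; rewrite NE /= bin2R bin3R bin2R.
have a1 : (L.+1)%:R != 0 :> R by rewrite pnatr_eq0.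
have a2 : (L.+2)%:R != 0 :> R by rewrite pnatr_eq0.
have a3 : (L.+3)%:R != 0 :> R by rewrite pnatr_eq0.
have a4 : n%:R != 0 :> R by rewrite pnatr_eq0 -lt0n.
move: a1 a2 a3 a4.
move: (L.+1%:R : R) (L.+2%:R : R) (L.+3%:R : R) (n%:R : R) => x y z w x0 y0 z0 w0.
have -> : y * w * (z * y * x / 6) - z * y / 2 * (y * x / 2 * w) = - (x * y * y * z * w / 12).
  by field.
by rewrite oppr_eq0 !mulf_neq0.
Qed.

Let normal_u2 : normalizable (u 2%N).
Proof.
have c0 : 'C(N, 2)%:R != 0 :> R by rewrite pnatr_eq0 -lt0n bin_gt0.
apply: (normalizable_cancel c0).
have [N3|N3] := ltnP N 3.
  by have := first_relation; rewrite [X in _ + X *: _](_ : _ = 0) ?scale0r ?addr0// bin_small.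
apply: normalizable_subl first_relation.
exact/normalizableZ/normal_u3.
Qed.

Lemma resonant_monomials i d : (k * i + d = nu)%N ->
  (d = 2 * k -> normalizable (mono R i (2 * m) (2 * n)))%N /\
  (d = 3 * k -> normalizable (mono R i (3 * m) (3 * n)))%N.
Proof.
have k0 : (0 < k)%N by lia.
move=> E; split=> dE.
- have -> : (i = N - 2)%N.
    have : (k * (i + 2) = k * N)%N by rewrite -nuE mulnDr; lia.
    by move/eqP; rewrite eqn_pmul2l// => /eqP; lia.
  exact: normal_u2.
- have : (k * (i + 3) = k * N)%N by rewrite -nuE mulnDr; lia.
  move/eqP; rewrite eqn_pmul2l// => /eqP iN.
  have -> : (i = N - 3)%N by lia.
  by apply: normal_u3; lia.
Qed.

End Resonance.

Lemma normalizable_mono i p s : (k * i + p + s = nu)%N -> normalizable (mono R i p s).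
Proof.
have k0 : (0 < k)%N by lia.
elim/ltn_ind: i p s => i IH p s E.
have E' : (k * i + (p + s) = nu)%N by lia.
have res c : (2 <= c)%N -> (p + s = c * k)%N -> nu = (k * (i + c))%N.
  by move=> c2 h; rewrite -E' h mulnDr [(c * k)%N]mulnC.
apply: (normal_level E') => //.
- by move=> i' p' s' hi; apply: IH.
- move=> h; have N1 : (1 < i + 2)%N by lia.
  by have [+ _] := resonant_monomials (res 2%N isT h) N1 E'; apply.
- move=> h; have N1 : (1 < i + 3)%N by lia.
  by have [_ +] := resonant_monomials (res 3%N isT h) N1 E'; apply.
Qed.

Theorem normalizable_homogeneous Z : psupp (fun e => wt (w3 k) e = nu) Z -> normalizable Z.
Proof.
move=> h; apply: (normalizable_supp h) => i p s; rewrite wt_w3 !expoE.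
exact: normalizable_mono.
Qed.

End Homological.

(** * Images of graphs under product maps *)

Section Images.
Variable R : realType.

Definition coords2 (x y : R) (i : 'I_2) : R := if i == fst2 then x else y.
Definition row2 (x y : R) : 'rV[R]_2 := \row_i coords2 x y i.

Lemma pt3E (a b x : R) : (pt3 a b x 0 ia = a) * (pt3 a b x 0 ib = b) * (pt3 a b x 0 ix = x).
Proof. by rewrite !mxE. Qed.

Lemma pt3_eta (v : 'rV[R]_3) : v = pt3 (v 0 ia) (v 0 ib) (v 0 ix).
Proof. by apply/rowP; apply: ord3P; rewrite pt3E. Qed.

Lemma row2E (x y : R) : (row2 x y 0 fst2 = x) * (row2 x y 0 snd2 = y).
Proof. by rewrite !mxE. Qed.

Lemma row2_eta (p : 'rV[R]_2) : p = row2 (p 0 fst2) (p 0 snd2).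
Proof. by apply/rowP; apply: ord2P; rewrite row2E. Qed.

Lemma peval2 (P : mpoly 2 R) (p : 'rV[R]_2) :
  peval P p = meval (coords2 (p 0 fst2) (p 0 snd2)) P.
Proof. by apply: meval_eq; apply: ord2P. Qed.

Lemma is_image_comp (phi psi phi' psi' : 'rV[R]_2 -> 'rV[R]_2) (F F' F'' : 'rV[R]_3 -> R) :
  {for 0, continuous phi} -> {for 0, continuous psi} -> phi 0 = 0 -> psi 0 = 0 ->
  is_image phi psi F F' -> is_image phi' psi' F' F'' ->
  is_image (phi' \o phi) (psi' \o psi) F F''.
Proof.
move=> cphi cpsi phi0 psi0 [[A B] /= [nA nB] h] [[A' B'] /= [nA' nB'] h'].
have nA2 : nbhs (0 : 'rV[R]_2) (phi @^-1` A') by apply: cphi; rewrite phi0.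
have nB2 : nbhs (0 : 'rV[R]_2) (psi @^-1` B') by apply: cpsi; rewrite psi0.
have F0 := nbhs_filter (0 : 'rV[R]_2).
exists (A `&` phi @^-1` A', B `&` psi @^-1` B') => /=.
  by split; apply: (@filterI _ _ F0).
move=> [p q] /= [[Ap A'p] [Bq B'q]].
have h1 := h (p, q) (conj Ap Bq); have h2 := h' (phi p, psi q) (conj A'p B'q).
exact: iff_trans h1 h2.
Qed.

Lemma is_image_id (F : 'rV[R]_3 -> R) : is_image id id F F.
Proof. by exists (setT, setT) => //=; split; exact: filterT. Qed.

(** A point of S over (a, b, x) is mapped to a point over H (a, b, x); so where G
    inverts H, the image is the graph of Y composed with G. Conversely, a point
    (p, q) mapped into that graph has the same image as the point of S over
    G (A, B, X), and injectivity of phi and psi near 0 identifies both. *)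
Lemma exists_image (phi psi : 'rV[R]_2 -> 'rV[R]_2) (F : 'rV[R]_3 -> R)
    (H := fun v : 'rV[R]_3 => pt3 (psi (row2 (v 0 ia) (v 0 ib)) 0 fst2)
                       (psi (row2 (v 0 ia) (v 0 ib)) 0 snd2)
                       (phi (row2 (v 0 ix) (F v)) 0 fst2)) :
  local_diffeo0 phi -> local_diffeo0 psi -> smooth0 F -> F 0 = 0 ->
  local_diffeo0 H ->
  exists G : 'rV[R]_3 -> 'rV[R]_3,
   [/\ G 0 = 0, smooth_map0 G, \forall w \near (0 : 'rV[R]_3), H (G w) = w &
   is_image phi psi F (fun w => phi (row2 (G w 0 ix) (F (G w))) 0 snd2)].
Proof.
case=> phi0 sphi [phi' [phi'0 sphi' phi'K _]].
case=> psi0 spsi [psi' [psi'0 spsi' psi'K _]].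
move=> sF F0 [H0 sH [G [G0 sG GK HK]]].
exists G; split => //.
have F2 := nbhs_filter (0 : 'rV[R]_2); have F3 := nbhs_filter (0 : 'rV[R]_3).
have cG := smooth_map0_continuous sG.
pose xF (v : 'rV[R]_3) := row2 (v 0 ix) (F v); pose ab (v : 'rV[R]_3) := row2 (v 0 ia) (v 0 ib).
have xF0 : xF 0 = 0 by apply/rowP; apply: ord2P; rewrite row2E ?F0 !mxE.
have ab0 : ab 0 = 0 by apply/rowP; apply: ord2P; rewrite row2E !mxE.
have cxF : {for 0, continuous xF}.
  apply: continuous_coord; apply: ord2P.
    rewrite (_ : (fun u => xF u 0 fst2) = (fun u => u 0 ix)); last by apply/funext => u; rewrite row2E.
    exact: continuous_coordinate.
  rewrite (_ : (fun u => xF u 0 snd2) = F); last by apply/funext => u; rewrite row2E.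
  exact: smooth0_continuous.
have cab : {for 0, continuous ab}.
  apply: continuous_coord; apply: ord2P.
    rewrite (_ : (fun u => ab u 0 fst2) = (fun u => u 0 ia)); last by apply/funext => u; rewrite row2E.
    exact: continuous_coordinate.
  rewrite (_ : (fun u => ab u 0 snd2) = (fun u => u 0 ib)); last by apply/funext => u; rewrite row2E.
  exact: continuous_coordinate.
have k1 : \forall v \near (0 : 'rV[R]_3), phi' (phi (xF v)) = xF v.
  suff h : nbhs (xF 0) [set p | phi' (phi p) = p] by exact: cxF h.
  by rewrite xF0.
have k2 : \forall v \near (0 : 'rV[R]_3), psi' (psi (ab v)) = ab v.
  suff h : nbhs (ab 0) [set p | psi' (psi p) = p] by exact: cab h.
  by rewrite ab0.
have k3 : \forall w \near (0 : 'rV[R]_3),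
    phi' (phi (xF (G w))) = xF (G w) /\ psi' (psi (ab (G w))) = ab (G w).
  suff h : nbhs (G 0) [set v | phi' (phi (xF v)) = xF v /\ psi' (psi (ab v)) = ab v].
    exact: cG h.
  by rewrite G0; exact: (@filterI _ _ F3).
have [r1 r1_gt0 hr1] := (near0P_norm _).1 GK.
have [r2 r2_gt0 hr2] := (near0P_norm _).1 (@filterI _ _ F3 _ _ HK k3).
have small (f : 'rV[R]_2 -> 'rV[R]_2) : smooth_map0 f -> f 0 = 0 ->
    \forall p \near (0 : 'rV[R]_2), `|f p| < r2.
  move=> sf f0; suff h : nbhs (f 0) [set p : 'rV[R]_2 | `|p| < r2].
    exact: (smooth_map0_continuous sf) h.
  by rewrite f0; apply/near0P_norm; exists r2.
have small1 : \forall p \near (0 : 'rV[R]_2), `|p| < r1.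
  by apply/near0P_norm; exists r1.
exists ([set p | [/\ phi' (phi p) = p, `|phi p| < r2 & `|p| < r1]],
        [set q | [/\ psi' (psi q) = q, `|psi q| < r2 & `|q| < r1]]) => /=.
  split.
    by apply: (@filterS3 _ _ F2) phi'K (small _ sphi phi0) small1.
  by apply: (@filterS3 _ _ F2) psi'K (small _ spsi psi0) small1.
move=> [p q] /= [[phiK phir pr1] [psiK psir qr1]].
rewrite /on_hypersurface.
set v := pt3 (q 0 fst2) (q 0 snd2) (p 0 fst2).
set w := pt3 (psi q 0 fst2) (psi q 0 snd2) (phi p 0 fst2).
have vr : `|v| < r1.
  apply: norm_lt_coord => //; apply: ord3P; rewrite pt3E.
  - by apply: le_lt_trans qr1; exact: coord_le_norm.
  - by apply: le_lt_trans qr1; exact: coord_le_norm.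
  - by apply: le_lt_trans pr1; exact: coord_le_norm.
have wr : `|w| < r2.
  apply: norm_lt_coord => //; apply: ord3P; rewrite pt3E.
  - by apply: le_lt_trans psir; exact: coord_le_norm.
  - by apply: le_lt_trans psir; exact: coord_le_norm.
  - by apply: le_lt_trans phir; exact: coord_le_norm.
split.
- move=> yF.
  have Hv : H v = w.
    by rewrite /H !pt3E -yF -!row2_eta.
  by rewrite -Hv hr1// !pt3E -yF -row2_eta.
- move=> E; have [HGw [k4 k5]] := hr2 w wr.
  have Ep : phi (xF (G w)) = phi p.
    rewrite [LHS]row2_eta [RHS]row2_eta -E; congr (row2 _ _).
    by have := congr1 (fun M : 'rV[R]_3 => M 0 ix) HGw; rewrite !pt3E.
  have Eq : psi (ab (G w)) = psi q.
    rewrite [LHS]row2_eta [RHS]row2_eta; congr (row2 _ _).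
      by have := congr1 (fun M : 'rV[R]_3 => M 0 ia) HGw; rewrite !pt3E.
    by have := congr1 (fun M : 'rV[R]_3 => M 0 ib) HGw; rewrite !pt3E.
  have Ep' : xF (G w) = p by rewrite -k4 Ep.
  have Eq' : ab (G w) = q by rewrite -k5 Eq.
  have Gwv : G w = v by rewrite [LHS]pt3_eta /v -Ep' -Eq' !row2E.
  by rewrite -Gwv -Ep' row2E.
Qed.

End Images.

(** * Normalizing one weight *)

Section Model.
Variables (R : realType) (k m n : nat) (gamma : nat -> R).
Hypotheses (m_gt0 : (0 < m)%N) (n_gt0 : (0 < n)%N) (mnk : (m + n = k)%N).
Let M := model k m n gamma.

Lemma model_homogeneous : psupp (fun e => wt (w3 k) e = k) M.
Proof.
apply: psuppD; [apply: psuppD|].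
- by apply: psuppX; rewrite wt_w3 !expoE; lia.
- by apply: psuppX; rewrite wt_w3 !expoE; lia.
- apply: psupp_sum => j; rewrite mem_index_iota => hj _; apply: psuppZ; apply: psuppX.
  by rewrite wt_w3 !expoE; lia.
Qed.

Lemma mderiv_a_model : mderiv ia M = 1.
Proof.
have h0 p s : mderiv ia (mono R 0 p s) = 0 by rewrite mderiv_a_mono scale0r.
rewrite /M /model !mderivD mderiv_a_mono scale1r mono0 h0 addr0 raddf_sum /=.
by rewrite big1 ?addr0// => j _; rewrite mderivZ h0 scaler0.
Qed.

Lemma model_a_axis (h : R) : peval M (h *: dir R ia) = h.
Proof.
have e0 p s : (0 < p)%N -> meval (fun i => (h *: dir R ia) 0 i) (mono R 0 p s) = 0.
  move=> p0; rewrite /mono mevalX big_ord3 /= !expoE !mxE /=.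
  by rewrite mulr0 expr0n gtn_eqF// mul0r mulr0.
rewrite /peval /M /model !mevalD e0// addr0 raddf_sum /= big_nat big1 => [|j hj].
  by rewrite /mono mevalX big_ord3 /= !expoE !mxE /= mulr1 !expr1 !expr0 !mulr1 addr0.
by rewrite mevalZ e0 ?mulr0//; lia.
Qed.

End Model.

Section Step.
Variables (R : realType) (k m n : nat) (gamma : nat -> R).
Hypotheses (k_gt1 : (1 < k)%N) (m_gt0 : (0 < m)%N) (n_gt0 : (0 < n)%N) (mnk : (m + n = k)%N).
Let M := model k m n gamma.
Let w3k := w3 k.
Let w3_gt0 i : (0 < w3k i)%N.
Proof. by rewrite /w3k /w3; case: ifP => _ //; lia. Qed.
Let wxy_gt0 i : (0 < wxy k i)%N.
Proof. by rewrite /wxy; case: ifP => _ //; lia. Qed.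
Let wab_gt0 i : (0 < wab k i)%N.
Proof. by rewrite /wab; case: ifP => _ //; lia. Qed.

Lemma peval_restrict_xy f (v : 'rV[R]_3) :
  peval (restrict_xy k m n gamma f) v = meval (coords2 (v 0 ix) (peval M v)) f.
Proof.
rewrite /peval /restrict_xy comp_mpoly_meval; apply: meval_eq; apply: ord2P.
  by rewrite (tnth_nth 0) /= /mono mevalX big_ord3 !expoE /= !expr0 !mul1r expr1.
by rewrite (tnth_nth 0).
Qed.

Lemma peval_lift_ab f (v : 'rV[R]_3) :
  peval (lift_ab f) v = meval (coords2 (v 0 ia) (v 0 ib)) f :> R.
Proof.
rewrite /peval /lift_ab comp_mpoly_meval; apply: meval_eq; apply: ord2P.
  by rewrite (tnth_nth 0) /= /mono mevalX big_ord3 !expoE /= !expr0 !mulr1 expr1.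
by rewrite (tnth_nth 0) /= /mono mevalX big_ord3 !expoE /= !expr0 mulr1 mul1r expr1.
Qed.

Lemma peval_homological f g h e (v : 'rV[R]_3) :
  peval (homological k m n gamma f g h e) v =
  meval (coords2 (v 0 ix) (peval M v)) g - meval (coords2 (v 0 ia) (v 0 ib)) h
    - peval (mderiv ib M) v * meval (coords2 (v 0 ia) (v 0 ib)) e
    - peval (mderiv ix M) v * meval (coords2 (v 0 ix) (peval M v)) f.
Proof.
by rewrite /homological 3!pevalB 2!pevalM 2!peval_restrict_xy 2!peval_lift_ab.
Qed.

Variables (nu : nat) (F : 'rV[R]_3 -> R) (N : mpoly 3 R).
Hypotheses (nu_gtk : (k < nu)%N) (sF : smooth0 F).
Hypothesis Nw : psupp (fun e => k < wt w3k e)%N N.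
Hypothesis FO : wO w3k nu (fun v => F v - peval (M + N) v).

Let M_supp : psupp (fun e => k <= wt w3k e)%N M.
Proof.
have h : psupp (fun e => wt (w3 k) e = k) M by apply: model_homogeneous.
by refine (psuppW _ h) => e ->.
Qed.

Let MO : wO w3k k (peval M).
Proof. exact: wO_peval. Qed.

Let FMO : wO w3k k.+1 (fun v => F v - peval M v).
Proof.
have h1 : wO w3k k.+1 (fun v => F v - peval (M + N) v) by apply: wO_le FO.
have h2 : wO w3k k.+1 (peval N) by exact: wO_peval.
by apply: eq_wO (wOD h1 h2) => v; rewrite /peval mevalD; ring.
Qed.

Let FkO : wO w3k k F.
Proof.
have h1 : wO w3k k (fun v => F v - peval M v) by apply: wO_le FMO.
by apply: eq_wO (wOD h1 MO) => v; rewrite subrK.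
Qed.

(** By uniqueness of weighted Taylor polynomials, those of F can only differ from
    M + N in weights at least nu. *)
Lemma next_component : exists2 P, psupp (fun e => wt w3k e = nu) P &
  wO w3k nu.+1 (fun v => F v - peval (M + N + P) v).
Proof.
have [T TO] := smooth0_taylor_wO nu.+1 w3_gt0 sF.
pose D := T - (M + N).
have DO : wO w3k nu (peval D).
  have h : wO w3k nu (fun v => F v - peval T v) by apply: wO_le TO.
  by apply: eq_wO (wOB FO h) => v; rewrite /D /peval mevalB; ring.
have Dw := wO_psupp w3_gt0 DO.
exists (wpart w3k nu D).
  by move=> e; rewrite mcoeff_wpart; case: (wt w3k e =P nu) => // _; rewrite eqxx.
have rO : wO w3k nu.+1 (peval (D - wpart w3k nu D)).
  apply: wO_peval => e; rewrite mcoeffB mcoeff_wpart; case: (wt w3k e =P nu) => [_|h].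
    by rewrite subrr eqxx.
  by rewrite subr0 => /Dw h2; rewrite ltn_neqAle h2 andbT eq_sym; apply/eqP.
apply: eq_wO (wOD TO rO) => v; rewrite /D /peval !mevalB !mevalD; ring.
Qed.

Section Solved.
Variables (P0 : mpoly 3 R) (f g h e : mpoly 2 R).
Hypothesis P0w : psupp (fun u => wt w3k u = nu) P0.
Hypothesis P0O : wO w3k nu.+1 (fun v => F v - peval (M + N + P0) v).
Hypotheses (fw : psupp (fun u => wt (wxy k) u + k = nu.+1)%N f)
  (gw : psupp (fun u => wt (wxy k) u = nu) g)
  (hw : psupp (fun u => wt (wab k) u = nu) h)
  (ew : psupp (fun u => wt (wab k) u + k = nu.+1)%N e).
Let P1 := P0 + homological k m n gamma f g h e.
Hypothesis P1w : psupp (normal_part k m n nu) P1.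
Let Q := M + N + P1.

Let phi (i : 'I_2) : mpoly 2 R := mpolyX R (mnm1 i) + (if i == fst2 then f else g).
Let psi (i : 'I_2) : mpoly 2 R := mpolyX R (mnm1 i) + (if i == fst2 then h else e).

Let phiE p : (polymap phi p 0 fst2 = p 0 fst2 + meval (coords2 (p 0 fst2) (p 0 snd2)) f) *
  (polymap phi p 0 snd2 = p 0 snd2 + meval (coords2 (p 0 fst2) (p 0 snd2)) g).
Proof. by rewrite !mxE /phi /= /peval !mevalD !mevalXU -!/(peval _ _) !peval2. Qed.

Let psiE p : (polymap psi p 0 fst2 = p 0 fst2 + meval (coords2 (p 0 fst2) (p 0 snd2)) h) *
  (polymap psi p 0 snd2 = p 0 snd2 + meval (coords2 (p 0 fst2) (p 0 snd2)) e).
Proof. by rewrite !mxE /psi /= /peval !mevalD !mevalXU -!/(peval _ _) !peval2. Qed.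

Let phi_diffeo : local_diffeo0 (polymap phi).
Proof.
apply: (unipotent_local_diffeo wxy_gt0); first exact: smooth_map0_polymap.
move=> j; apply: (@eq_wO _ _ _ _ (peval (if j == fst2 then f else g))).
  by move=> v; rewrite mxE /phi /peval mevalD mevalXU addrC addKr.
have [e1 e2] : wxy k fst2 = 1%N /\ wxy k snd2 = k by [].
move: j; apply: ord2P; apply: wO_peval.
  by refine (psuppW _ fw) => u; lia.
by refine (psuppW _ gw) => u; lia.
Qed.

Let psi_diffeo : local_diffeo0 (polymap psi).
Proof.
apply: (unipotent_local_diffeo wab_gt0); first exact: smooth_map0_polymap.
move=> j; apply: (@eq_wO _ _ _ _ (peval (if j == fst2 then h else e))).
  by move=> v; rewrite mxE /psi /peval mevalD mevalXU addrC addKr.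
have [e1 e2] : wab k fst2 = k /\ wab k snd2 = 1%N by [].
move: j; apply: ord2P; apply: wO_peval.
  by refine (psuppW _ hw) => u; lia.
by refine (psuppW _ ew) => u; lia.
Qed.

Let fF (v : 'rV[R]_3) := meval (coords2 (v 0 ix) (F v)) f.
Let gF (v : 'rV[R]_3) := meval (coords2 (v 0 ix) (F v)) g.
Let hab (v : 'rV[R]_3) := meval (coords2 (v 0 ia) (v 0 ib)) h.
Let eab (v : 'rV[R]_3) := meval (coords2 (v 0 ia) (v 0 ib)) e.
Let dl (i : 'I_3) (v : 'rV[R]_3) : R :=
  if i == ia then hab v else if i == ib then eab v else fF v.

Let d := (nu - k)%N.

Let xyO (Y : 'rV[R]_3 -> R) i : wO w3k k Y ->
  wO w3k (wxy k i) (fun v => coords2 (v 0 ix) (Y v) i).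
Proof.
move=> YO; move: i; apply: ord2P; rewrite /wxy /coords2 /=; last exact: YO.
exact: (wO_coord R w3k ix).
Qed.

Let abO i : wO w3k (wab k i) (fun v : 'rV[R]_3 => coords2 (v 0 ia) (v 0 ib) i).
Proof.
move: i; apply: ord2P; rewrite /wab /coords2 /=; first exact: (wO_coord R w3k ia).
exact: (wO_coord R w3k ib).
Qed.

Let wO_xy (Y : 'rV[R]_3 -> R) j G : wO w3k k Y ->
  psupp (fun u => j <= wt (wxy k) u)%N G ->
  wO w3k j (fun v : 'rV[R]_3 => meval (coords2 (v 0 ix) (Y v)) G).
Proof.
move=> YO Gw.
apply: (@wO_meval R 3 2 w3k (wxy k) 0 (fun i v => coords2 (v 0 ix) (Y v) i) (fun i v => 0) _ _ G j Gw).
  by move=> i; exact: xyO.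
by move=> i; exact: wO0.
Qed.

Let wO_ab j G : psupp (fun u => j <= wt (wab k) u)%N G ->
  wO w3k j (fun v : 'rV[R]_3 => meval (coords2 (v 0 ia) (v 0 ib)) G).
Proof.
move=> Gw.
apply: (@wO_meval R 3 2 w3k (wab k) 0 (fun i v => coords2 (v 0 ia) (v 0 ib) i) (fun i v => 0) _ _ G j Gw).
  by move=> i; exact: abO.
by move=> i; exact: wO0.
Qed.

Let dlO i : wO w3k (w3k i + d) (dl i).
Proof.
move: i; apply: ord3P; rewrite /w3k /w3 /dl /=.
- by apply: wO_ab; refine (psuppW _ hw) => u; rewrite /d; lia.
- by apply: wO_ab; refine (psuppW _ ew) => u; rewrite /d; lia.
- by apply: wO_xy => //; refine (psuppW _ fw) => u; rewrite /d; lia.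
Qed.

(** F - M has weight at least k + 1, one more than the weight of y. *)
Let restrict_error j G : psupp (fun u => j <= wt (wxy k) u)%N G ->
  wO w3k j.+1 (fun v : 'rV[R]_3 => meval (coords2 (v 0 ix) (F v)) G - meval (coords2 (v 0 ix) (peval M v)) G).
Proof.
move=> Gw.
(* pass from (x, M) to (x, F), a shift which raises the weight by one *)
have := @wO_meval_shift R 3 2 w3k (wxy k) 1 (fun i v => coords2 (v 0 ix) (peval M v) i)
  (fun i v => coords2 0 (F v - peval M v) i) _ _ G j Gw.
rewrite addn1 => H.
have E (v : 'rV[R]_3) : meval (coords2 (v 0 ix) (F v)) G =
   meval (fun i => coords2 (v 0 ix) (peval M v) i + coords2 0 (F v - peval M v) i) G.
  by apply: meval_eq; apply: ord2P; rewrite /coords2 /= ?addr0// addrC subrK.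
apply: eq_wO (H _ _) => [v|i|]; first by rewrite E.
  by apply: xyO; exact: MO.
by apply: ord2P; rewrite /wxy /coords2 /=; [exact: wO0|rewrite addn1; exact: FMO].
Qed.

Let H (v : 'rV[R]_3) : 'rV[R]_3 := pt3 (v 0 ia + hab v) (v 0 ib + eab v) (v 0 ix + fF v).

Let H_E v i : H v 0 i = v 0 i + dl i v.
Proof. by move: i; apply: ord3P; rewrite /H pt3E. Qed.

Let H_unip j : wO w3k (w3k j).+1 (fun v => H v 0 j - v 0 j).
Proof.
apply: (@eq_wO _ _ _ _ (dl j)); first by move=> v; rewrite H_E addrC addKr.
by apply: wO_le (dlO j); rewrite /d; lia.
Qed.

Let smooth_xy G : smooth0 (fun v : 'rV[R]_3 => meval (coords2 (v 0 ix) (F v)) G).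
Proof.
have -> : (fun v : 'rV[R]_3 => meval (coords2 (v 0 ix) (F v)) G) = peval G \o (fun v : 'rV[R]_3 => row2 (v 0 ix) (F v)).
  by apply/funext => v; rewrite /= peval2 !row2E.
apply: smooth0_comp; first exact: smooth0_peval.
  apply: ord2P.
    rewrite (_ : (fun u => _) = (fun u : 'rV[R]_3 => u 0 ix)); last by apply/funext => u; rewrite row2E.
    by apply/smooth0P; exists setT; split; [exact: openT| |move=> r; apply: Cr_coord; exact: openT].
  by rewrite (_ : (fun u => _) = F)//; apply/funext => u; rewrite row2E.
have F00 : F 0 = 0 by apply: wO_at0 FkO; lia.
by apply/rowP; apply: ord2P; rewrite row2E ?F00 !mxE.
Qed.

Let smooth_coord (i : 'I_3) : smooth0 (fun u : 'rV[R]_3 => u 0 i).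
Proof.
by apply/smooth0P; exists setT; split; [exact: openT| |move=> r; apply: Cr_coord; exact: openT].
Qed.

Let smooth_ab G : smooth0 (fun v : 'rV[R]_3 => meval (coords2 (v 0 ia) (v 0 ib)) G).
Proof.
have -> : (fun v : 'rV[R]_3 => meval (coords2 (v 0 ia) (v 0 ib)) G) = peval (lift_ab G).
  by apply/funext => v; rewrite peval_lift_ab.
exact: smooth0_peval.
Qed.

Let H_smooth : smooth_map0 H.
Proof.
move=> i; have -> : (fun v => H v 0 i) = (fun v => v 0 i + dl i v).
  by apply/funext => v; rewrite H_E.
apply: smooth0D; first exact: smooth_coord.
by move: i; apply: ord3P; rewrite /dl /=; [exact: smooth_ab|exact: smooth_ab|exact: smooth_xy].
Qed.

(** On S one has to compare Q (A, B, X) with Y = F + g(x, F). The model is expanded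
    to second order in (h, e, f), which leaves an error of weight
    k + 2 (nu - k) > nu; in N and P1 the substitution only produces terms of
    weight above nu, and so does replacing F by M inside f and g. What remains
    cancels by the definition of the operator homological. *)
Let jet_equation : wO w3k nu.+1 (fun v => peval Q (H v) - (F v + gF v)).
Proof.
have wM : wO w3k nu.+1 (fun v => peval M (H v) - peval M v
    - \sum_i peval (mderiv i M) v * dl i v).
  have := @wO_meval_shift2 R 3 3 w3k w3k d (fun i v => v 0 i) dl (wO_coord R w3k) dlO M k M_supp.
  move=> h0; have {}h0 := wO_le (_ : nu.+1 <= k + 2 * d)%N h0.
  apply: eq_wO (h0 _) => [v|]; last by rewrite /d; lia.
  by congr (_ - _ - _); apply: meval_eq => i; rewrite H_E.
have wP (j : nat) (P : mpoly 3 R) : psupp (fun e => j <= wt w3k e)%N P -> (nu.+1 <= j + d)%N ->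
    wO w3k nu.+1 (fun v => peval P (H v) - peval P v).
  move=> Pw hj.
  have h0 := @wO_meval_shift R 3 3 w3k w3k d (fun i v => v 0 i) dl (wO_coord R w3k) dlO P j Pw.
  apply: eq_wO (wO_le hj h0) => v.
  by congr (_ - _); apply: meval_eq => i; rewrite H_E.
have wN : wO w3k nu.+1 (fun v => peval N (H v) - peval N v).
  by apply: (wP k.+1) => //; rewrite /d; lia.
have wP1 : wO w3k nu.+1 (fun v => peval P1 (H v) - peval P1 v).
  apply: (wP nu); last by rewrite /d; lia.
  by refine (psuppW _ P1w) => u [->].
have wg : wO w3k nu.+1 (fun v => gF v - meval (coords2 (v 0 ix) (peval M v)) g).
  by apply: restrict_error; refine (psuppW _ gw) => u ->.
have wf : wO w3k nu.+1 (fun v => peval (mderiv ix M) v * (fF v - meval (coords2 (v 0 ix) (peval M v)) f)).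
  have h1 : wO w3k k.-1 (peval (mderiv ix M)).
    apply: wO_peval => u; rewrite mcoeff_deriv => h0.
    have : mcoeff (mnm_add u (mnm1 ix)) M != 0 by apply: contraNneq h0 => ->; rewrite mul0rn.
    by move=> /M_supp; rewrite wtD wtU /w3k /w3 /=; lia.
  have h2 : wO w3k (nu - k).+2 (fun v => fF v - meval (coords2 (v 0 ix) (peval M v)) f).
    by apply: restrict_error; refine (psuppW _ fw) => u; lia.
  apply: wO_le (wOM h1 h2); lia.
apply: eq_wO (wOB (wOB (wOD (wOD (wOD wM wN) wP1) wf) wg) P0O) => v.
rewrite big_ord3 /= /dl /= mderiv_a_model.
have -> : peval 1 v = 1 by rewrite /peval meval1.
have EQ : peval Q (H v) = peval M (H v) + peval N (H v) + peval P1 (H v).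
  by rewrite /Q (pevalD (M + N)) (pevalD M).
have E0 : peval (M + N + P0) v = peval M v + peval N v + peval P0 v.
  by rewrite (pevalD (M + N)) (pevalD M).
have E1 : peval P1 v = peval P0 v + (meval (coords2 (v 0 ix) (peval M v)) g - hab v
    - peval (mderiv ib M) v * eab v
    - peval (mderiv ix M) v * meval (coords2 (v 0 ix) (peval M v)) f).
  by rewrite /P1 (pevalD P0) peval_homological.
rewrite EQ E0 E1.
move: (peval M (H v)) (peval N (H v)) (peval P1 (H v)) (peval M v) (peval N v)
  (peval P0 v) (meval _ g) (meval _ f) (peval (mderiv ib M) v)
  (peval (mderiv ix M) v) (hab v) (eab v) (fF v) (gF v) (F v) => *; ring.
Qed.

Lemma normalized_image : exists (phi psi : 'I_2 -> mpoly 2 R) (F' : 'rV[R]_3 -> R),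
  [/\ local_diffeo0 (polymap phi), local_diffeo0 (polymap psi), smooth0 F',
      is_image (polymap phi) (polymap psi) F F' &
      wO w3k nu.+1 (fun v => F' v - peval Q v)].
Proof.
have F00 : F 0 = 0 by apply: wO_at0 FkO; lia.
have H_diffeo : local_diffeo0 H by exact: unipotent_local_diffeo w3_gt0 H_smooth H_unip.
have HE (v : 'rV[R]_3) : pt3 (polymap psi (row2 (v 0 ia) (v 0 ib)) 0 fst2)
     (polymap psi (row2 (v 0 ia) (v 0 ib)) 0 snd2)
     (polymap phi (row2 (v 0 ix) (F v)) 0 fst2) = H v.
  by rewrite !psiE !phiE !row2E.
have := @exists_image R (polymap phi) (polymap psi) F phi_diffeo psi_diffeo sF F00.
rewrite (_ : (fun v : 'rV[R]_3 => pt3 _ _ _) = H); last by apply/funext => v; exact: HE.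
move=> /(_ H_diffeo)[G [G0 sG HG0 im]].
have HG : \forall w \near (0 : 'rV[R]_3), H (G w) = w.
  by apply: (@filterS _ _ (nbhs_filter _)) HG0 => w; rewrite HE.
have E : (fun w => polymap phi (row2 (G w 0 ix) (F (G w))) 0 snd2) =
    (fun w => F (G w) + gF (G w)).
  by apply/funext => w; rewrite phiE !row2E.
rewrite E in im.
exists phi, psi, (fun w => F (G w) + gF (G w)).
split; [exact: phi_diffeo|exact: psi_diffeo| |exact: im|].
- have sFg : smooth0 (fun v => F v + gF v).
    apply: smooth0D; [exact: sF|exact: smooth_xy].
  exact: (smooth0_comp sFg sG G0).
- have GO := wO_inverse w3_gt0 H_unip (smooth_map0_continuous sG) G0 HG.
  have h0 := wON (wO_comp w3_gt0 GO jet_equation).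
  apply: (near_eq_wO w3_gt0) h0.
  apply: (@filterS _ _ (nbhs_filter _)) HG => w /= ->.
  by rewrite opprB.
Qed.

End Solved.

Lemma normalization_step : exists (phi psi : 'I_2 -> mpoly 2 R) (F' : 'rV[R]_3 -> R) (P : mpoly 3 R),
  [/\ local_diffeo0 (polymap phi) /\ local_diffeo0 (polymap psi), smooth0 F',
      is_image (polymap phi) (polymap psi) F F',
      psupp (normal_part k m n nu) P &
      wO w3k nu.+1 (fun v => F' v - peval (M + N + P) v)].
Proof.
have [P0 P0w P0O] := next_component.
have [f [g [h [e [fw gw hw ew P1w]]]]] := normalizable_homogeneous gamma m_gt0 n_gt0 mnk P0w.
have [phi [psi [F' [h1 h2 h3 h4 h5]]]] := normalized_image P0O fw gw hw ew P1w.
by exists phi, psi, F', (P0 + homological k m n gamma f g h e).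
Qed.

End Step.

(** * Normal forms of every order *)

Section Jets.
Variables (R : realType) (k : nat).
Hypothesis k_gt0 : (0 < k)%N.

Lemma w3_gt0 i : (0 < w3 k i)%N.
Proof. by rewrite /w3; case: ifP. Qed.

Lemma dilationE (t : R) (v : 'rV[R]_3) : dilation k t v = dil (w3 k) t v.
Proof. by apply/rowP; apply: ord3P; rewrite /dilation pt3E mxE /w3 /= ?expr1. Qed.

Lemma mono_weightE e : mono_weight k e = wt (w3 k) e.
Proof. by rewrite wt_w3. Qed.

(** The weighted jet asks for t of both signs. Since dilation by -t maps v into
    the same box as dilation by t, one bound serves for both. *)
Lemma weighted_jet_of_wO l (F : 'rV[R]_3 -> R) (P : mpoly 3 R) :
  psupp (fun e => wt (w3 k) e <= l)%N P ->
  wO (w3 k) l.+1 (fun v => F v - peval P v) -> is_weighted_jet k l F P.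
Proof.
move=> Pw FO; split; first by move=> e /Pw; rewrite mono_weightE.
move=> v; apply/eqoP => eps eps0.
have bound (s : R) : (s = 1 \/ s = -1) -> exists C : R, \forall t \near (0 : R)^'+,
    `|F (dilation k (s * t) v) - peval P (dilation k (s * t) v)| <= C * t ^+ l.+1.
  move=> hs; have [C C0 h] := FO; pose c := 1 + `|v|.
  have c0 : 0 < c by rewrite ltr_pwDl.
  exists (C * c ^+ l.+1); have h' := right_scale c0 h; near=> t.
  have t0 : 0 < t by near: t; exact: right_gt0.
  have ht : forall u, box (w3 k) (c * t) u ->
    `|F u - peval P u| <= C * (c * t) ^+ l.+1 by near: t.
  rewrite -mulrA -exprMn; apply: ht => i; rewrite dilationE.
  have := @box_dil R 3 (w3 k) c t v w3_gt0 (ltW t0).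
  rewrite lerDl lerDr => /(_ _ _ i)/=; rewrite !mxE !normrM !normrX normrM.
  have -> : `|s| = 1 by case: hs => ->; rewrite ?normrN normr1.
  by rewrite mul1r; apply.
have [C1 h1] := bound 1 (or_introl erefl); have [C2 h2] := bound (-1) (or_intror erefl).
have main C s : (\forall t \near (0 : R)^'+,
    `|F (dilation k (s * t) v) - peval P (dilation k (s * t) v)| <= C * t ^+ l.+1) ->
    \forall t \near (0 : R)^'+,
    `|F (dilation k (s * t) v) - peval P (dilation k (s * t) v)| <= eps * t ^+ l.
  move=> h; have c1 : 0 < `|C| + 1 by rewrite ltr_wpDl.
  near=> t.
  have t0 : 0 < t by near: t; exact: right_gt0.
  have te : t <= eps / (`|C| + 1) by near: t; apply: right_le; rewrite divr_gt0.
  have ht : `|F (dilation k (s * t) v) - peval P (dilation k (s * t) v)| <= C * t ^+ l.+1.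
    by near: t.
  apply: le_trans ht _; rewrite exprS mulrA ler_wpM2r ?exprn_ge0 ?(ltW t0)//.
  apply: (@le_trans _ _ ((`|C| + 1) * t)); last by rewrite mulrC -ler_pdivlMr.
  by rewrite ler_wpM2r ?(ltW t0)// (le_trans (ler_norm C))// lerDl.
have [e1 /= e1_gt0 he1] := main _ _ h1; have [e2 /= e2_gt0 he2] := main _ _ h2.
exists (Num.min e1 e2) => /=; first by rewrite lt_min e1_gt0.
move=> t /=; rewrite sub0r normrN lt_min => /andP[te1 te2] t0.
have [tp|tn] := ltP 0 t.
  have := he1 t; rewrite /= sub0r normrN te1 => /(_ isT tp).
  by rewrite mul1r normrX gtr0_norm.
have tn' : 0 < - t by rewrite oppr_gt0 lt_neqAle t0.
have := he2 (- t); rewrite /= sub0r opprK te2 => /(_ isT tn').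
rewrite mulrNN mul1r normrX ler0_norm//.
Unshelve. all: by end_near. Qed.

Lemma weighted_jet_bound l (F : 'rV[R]_3 -> R) (P : mpoly 3 R) v :
  is_weighted_jet k l F P ->
  \forall t \near (0 : R)^'+, `|F (dilation k t v) - peval P (dilation k t v)| <= t ^+ l.
Proof.
case=> _ /(_ v)/eqoP/(_ 1 ltr01)[e /= e0 h]; exists e => //= t te t0.
have := h t te (lt0r_neq0 t0); rewrite mul1r normrX gtr0_norm//.
Qed.

End Jets.

Section Induction.
Variables (R : realType) (k m n : nat) (gamma : nat -> R).
Hypotheses (k_gt1 : (1 < k)%N) (m_gt0 : (0 < m)%N) (n_gt0 : (0 < n)%N) (mnk : (m + n = k)%N).
Let M := model k m n gamma.
Let k_gt0 : (0 < k)%N. Proof. exact: ltnW. Qed.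

(** The jets of the standing form are controlled along each orbit of the
    dilations separately. Comparing them with a Taylor polynomial of F, whose
    error is uniform, turns this into a bound on boxes. *)
Lemma standing_form_model F : smooth0 F -> standing_form k m n gamma F ->
  wO (w3 k) k.+1 (fun v => F v - peval M v).
Proof.
move=> sF [P [Pw Pjet]].
have [T TO] := smooth0_taylor_wO k.+1 (w3_gt0 k_gt0) sF.
have jet := Pjet k.+1 (ltnSn k); rewrite big_nat1 in jet.
have DO : wO (w3 k) k.+1 (peval (T - M)).
  apply: wO_peval; apply: (small_polynomial (j := k.+1)) => v.
  have [C hC] := wO_dil v (w3_gt0 k_gt0) TO.
  have jv := weighted_jet_bound v jet.
  exists (C + 1 + `|peval (P k.+1) v|); near=> t.
  have t0 : 0 < t by near: t; exact: right_gt0.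
  have a1 : `|F (dil (w3 k) t v) - peval T (dil (w3 k) t v)| <= C * t ^+ k.+1 by near: t.
  have a2 : `|F (dilation k t v) - peval (M + P k.+1) (dilation k t v)| <= t ^+ k.+1 by near: t.
  rewrite dilationE // in a2.
  have a3 : `|peval (P k.+1) (dil (w3 k) t v)| <= `|peval (P k.+1) v| * t ^+ k.+1.
    rewrite -dilationE// (Pw _ (ltnSn k)) normrM mulrC ler_wpM2l//.
    by rewrite ger0_norm// exprn_ge0// ltW.
  rewrite pevalD in a2; rewrite pevalB.
  move: a1 a2 a3; move: (F _) (peval T _) (peval M _) (peval (P k.+1) (dil _ _ _)) => x y z w.
  move=> a1 a2 a3.
  have -> : y - z = - (x - y) + (x - (z + w)) + w by ring.
  apply: le_trans (ler_normD _ _) _; rewrite !mulrDl mul1r lerD//.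
  by apply: le_trans (ler_normD _ _) _; rewrite normrN lerD.
apply: eq_wO (wOD TO DO) => v; rewrite pevalB; ring.
Unshelve. all: by end_near. Qed.

Definition normalized_to l F := exists (phi psi : 'I_2 -> mpoly 2 R)
    (F' : 'rV[R]_3 -> R) (P : nat -> mpoly 3 R),
  [/\ local_diffeo0 (polymap phi) /\ local_diffeo0 (polymap psi), smooth0 F',
      is_image (polymap phi) (polymap psi) F F',
      forall nu, (k < nu <= l)%N -> psupp (normal_part k m n nu) (P nu) &
      wO (w3 k) l.+1 (fun v => F' v - peval (M + \sum_(k.+1 <= nu < l.+1) P nu) v)].

Lemma polymap_id r : polymap (fun i : 'I_r => mpolyX R (mnm1 i)) = id.
Proof. by apply/funext => v; apply/rowP => i; rewrite mxE /peval mevalXU. Qed.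

Lemma polymap_comp r (phi psi : 'I_r -> mpoly r R) :
  polymap (fun i => comp_mpoly [tuple phi j | j < r] (psi i)) = polymap psi \o polymap phi.
Proof.
apply/funext => v; apply/rowP => i; rewrite !mxE /peval comp_mpoly_meval.
by apply: meval_eq => j; rewrite tnth_mktuple mxE.
Qed.

Lemma local_diffeo0_id r : local_diffeo0 (id : 'rV[R]_r -> 'rV[R]_r).
Proof.
rewrite -polymap_id; split; [by rewrite polymap_id|exact: smooth_map0_polymap|].
exists (polymap (fun i : 'I_r => mpolyX R (mnm1 i))); split.
- by rewrite polymap_id.
- exact: smooth_map0_polymap.
- by rewrite polymap_id; apply/near0P_norm; exists 1.
- by rewrite polymap_id; apply/near0P_norm; exists 1.
Qed.

Lemma components_supp l (P : nat -> mpoly 3 R) :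
  (forall nu, (k < nu <= l)%N -> psupp (normal_part k m n nu) (P nu)) ->
  psupp (fun e => k < wt (w3 k) e <= l)%N (\sum_(k.+1 <= nu < l.+1) P nu).
Proof.
move=> hP; apply: psupp_sum => nu; rewrite mem_index_iota ltnS => hnu _.
by refine (psuppW _ (hP nu hnu)) => e [-> _].
Qed.

Lemma normalization l F : (k <= l)%N -> smooth0 F ->
  wO (w3 k) k.+1 (fun v => F v - peval M v) -> normalized_to l F.
Proof.
move=> kl sF FM; elim: l kl => [|l IH] kl; first by lia.
have [kl'|lk] := leqP k l; last first.
  have -> : l.+1 = k by lia.
  exists (fun i => mpolyX R (mnm1 i)), (fun i => mpolyX R (mnm1 i)), F, (fun=> 0).
  rewrite polymap_id; split => //.
  - by split; exact: local_diffeo0_id.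
  - exact: is_image_id.
  - by move=> nu h; lia.
  - by rewrite big_geq// addr0.
have [phi [psi [F' [P [[dphi dpsi] sF' im Pn F'O]]]]] := IH kl'.
have Nw : psupp (fun e => k < wt (w3 k) e)%N (\sum_(k.+1 <= nu < l.+1) P nu).
  by refine (psuppW _ (components_supp Pn)) => e /andP[].
have [phi' [psi' [F'' [P' [[dphi' dpsi'] sF'' im' Pn' F''O]]]]] :=
  normalization_step k_gt1 m_gt0 n_gt0 mnk (kl' : (k < l.+1)%N) sF' Nw F'O.
exists (fun i => comp_mpoly [tuple phi j | j < 2] (phi' i)),
  (fun i => comp_mpoly [tuple psi j | j < 2] (psi' i)), F'',
  (fun nu => if nu == l.+1 then P' else P nu).
rewrite !polymap_comp; split => //.
- by split; apply: local_diffeo0_comp.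
- case: dphi => phi0 sphi _; case: dpsi => psi0 spsi _.
  by apply: is_image_comp im im' => //; exact: smooth_map0_continuous.
- move=> nu hnu; case: eqP => [->//|h]; apply: Pn; lia.
- rewrite big_nat_recr//= eqxx addrA.
  rewrite (_ : \sum_(k.+1 <= i < l.+1) _ = \sum_(k.+1 <= i < l.+1) P i)//.
  by rewrite !big_nat; apply: eq_bigr => i hi; case: eqP => // E; exfalso; lia.
Qed.

(** F and the model agree to weight k, the weight of a, so they have the same
    derivative in a at the origin; on the a-axis the model is the identity. *)
Lemma para_CR_of_jet F : smooth0 F -> wO (w3 k) k.+1 (fun v => F v - peval M v) -> para_CR F.
Proof.
move=> sF FM.
have M0 : peval M 0 = 0.
  by rewrite -(scale0r (dir R ia)) model_a_axis.
have F0 : F 0 = 0 by have := wO_at0 (ltn0Sn _) FM; rewrite M0 subr0.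
split => //.
have sM : smooth0 (peval M) by exact: smooth0_peval.
have dF := @smooth0_derivable R 3 F ia sF; have dM := @smooth0_derivable R 3 (peval M) ia sM.
have := @wO_partial0 R 3 (w3 k) (fun v => F v - peval M v) ia (w3_gt0 k_gt0).
move=> /(_ (derivableB dF dM) FM); rewrite /partial.
rewrite [X in X = _](deriveB dF dM) => /eqP; rewrite subr_eq0 => /eqP ->.
suff -> : 'D_(dir R ia) (peval M) 0 = 1 by rewrite oner_neq0.
have [_ <-] : is_derive (0 : 'rV[R]_3) (dir R ia) (fun u => u 0 ia) 1.
  by have := derive_coord ia (0 : 'rV[R]_3) (dir R ia); rewrite mxE !eqxx.
have E : (fun h : R => h^-1 *: ((peval M \o shift 0) (h *: dir R ia) - peval M 0)) =
  (fun h => h^-1 *: (((fun u : 'rV[R]_3 => u 0 ia) \o shift 0) (h *: dir R ia) - (0 : 'rV[R]_3) 0 ia)).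
  apply/funext => h /=.
  by rewrite !addr0 model_a_axis// M0 !mxE !eqxx mulr1.
by rewrite /derive E.
Qed.

End Induction.

Theorem theorem3 (R : realType) (F : 'rV[R]_3 -> R) (k m n : nat)
    (gamma : nat -> R)
    (hS : para_CR F) (hk : (2 < k)%N) (hftype : finite_type F k)
    (hm : (1 <= m <= k - 1)%N) (hn : n = (k - m)%N)
    (hF : standing_form k m n gamma F)
    (l : nat) (hl : (k < l)%N) :
  exists (phi psi : 'I_2 -> mpoly 2 R) (Fs : 'rV[R]_3 -> R),
    [/\ local_diffeo0 (polymap phi), local_diffeo0 (polymap psi),
        para_CR Fs, is_image (polymap phi) (polymap psi) F Fs &
        normal_form k m n gamma l Fs].
Proof.
have [sF _ _] := hS.
have [k_gt1 m_gt0 n_gt0 mnk] : [/\ 1 < k, 0 < m, 0 < n & m + n = k]%N by split; lia.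
have k_gt0 : (0 < k)%N by lia.
have [phi [psi [F' [P [[dphi dpsi] sF' im Pn F'O]]]]] :=
  normalization k_gt1 m_gt0 n_gt0 mnk (ltnW hl) sF (standing_form_model k_gt1 sF hF).
have Nw := components_supp Pn.
have F'M : wO (w3 k) k.+1 (fun v => F' v - peval (model k m n gamma) v).
  have h1 : wO (w3 k) k.+1 (peval (\sum_(k.+1 <= nu < l.+1) P nu)).
    by apply: wO_peval; refine (psuppW _ Nw) => e /andP[].
  have h2 := wO_le (_ : k.+1 <= l.+1)%N F'O.
  by apply: eq_wO (wOD (h2 (ltnW hl)) h1) => v; rewrite pevalD; ring.
have Mw : psupp (fun e => wt (w3 k) e = k) (model k m n gamma) by exact: model_homogeneous.
exists phi, psi, F'; split => //.
  exact: para_CR_of_jet F'M.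
exists P; split.
- by apply: weighted_jet_of_wO => //; refine (psuppW _ Mw) => e ->.
- move=> nu hnu t v; rewrite dilationE; apply: peval_dil.
  by refine (psuppW _ (Pn nu hnu)) => e [].
- apply: weighted_jet_of_wO => //; apply: psuppD.
    by refine (psuppW _ Mw) => e ->; exact: ltnW.
  by refine (psuppW _ Nw) => e /andP[].
- move=> nu i p q hnu ex; apply/eqP; apply: contraT => h.
  by have [_] := Pn nu hnu _ h; rewrite !expoE.
Qed.
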